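(* Let $M$ be a contact sub-Riemannian manifold and $q\in M$. Then there exists a sequence $\{q_n\}_{n\in\mathbb{N}}$ in $M$ such that $$\lim_{n\to\infty}q_n=q\qquad\text{and}\qquad\lim_{n\to\infty}\nu(q_n)=\infty .$$
   Context: A contact sub-Riemannian manifold is a connected odd-dimensional manifold $M$ with a hyperplane distribution $\mathcal D\subset TM$, locally $\mathcal D=\ker\alpha$ for a one-form $\alpha$ with $d\alpha|_{\mathcal D}$ non-degenerate, and a smooth metric on $\mathcal D$. A geodesic is a non-constant Lipschitz curve $\gamma:[0,1]\to M$, tangent to $\mathcal D$ a.e., which is locally a minimizer of the energy $\frac12\int\|\dot\gamma\|^2dt$ between its endpoints. $\nu(p)$ is the number of ''local'' geodesics joining $q$ and $p$, i.e. geodesics from $q$ to $p$ whose image is contained in a (fixed) coordinate chart around $q$. *)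

(* Defs.v *)
From HB Require Import structures.
From mathcomp Require Import all_boot all_order all_algebra.
From mathcomp Require Import all_classical all_reals all_analysis.

Set Implicit Arguments.
Unset Strict Implicit.
Unset Printing Implicit Defensive.

Import Order.TTheory GRing.Theory Num.Theory.
Import numFieldNormedType.Exports.

Local Open Scope classical_set_scope.
Local Open Scope ring_scope.

Section smooth.
Context {R : realType} {d : nat}.
Implicit Types (U : set 'rV[R]_d) (f : 'rV[R]_d -> R).

(* Only meant for open [U], where it is the usual class C^k. *)
Fixpoint class_C (k : nat) U f : Prop :=
  (forall x, U x -> {for x, continuous f}) /\
  if k is k'.+1 then
    forall i : 'I_d,
      (forall x, U x -> derivable f x (delta_mx 0 i)) /\
      class_C k' U ('D_(delta_mx 0 i) f)
  else True.

Definition smooth_on U f : Prop := forall k, class_C k U f.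

Definition smooth_map_on U (F : 'rV[R]_d -> 'rV[R]_d) : Prop :=
  forall i : 'I_d, smooth_on U (fun x => F x 0 i).

End smooth.

(* The values of [cmap] outside [cdom], and of [cinv] outside the image of [cdom],
   are irrelevant. *)
Record chart (R : realType) (d : nat) (M : topologicalType) := Chart {
  cdom : set M;
  cmap : M -> 'rV[R]_d;
  cinv : 'rV[R]_d -> M;
  cdom_open : open cdom;
  cimg_open : open (cmap @` cdom);
  cmapK : forall p, cdom p -> cinv (cmap p) = p;
  cmap_continuous : forall p, cdom p -> {for p, continuous cmap};
  cinv_continuous : forall x, (cmap @` cdom) x -> {for x, continuous cinv}
}.

Section charts.
Context {R : realType} {d : nat} {M : topologicalType}.
Implicit Types c : chart R d M.

Definition cimg c : set 'rV[R]_d := cmap c @` cdom c.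

Definition transition c c' : 'rV[R]_d -> 'rV[R]_d := cmap c' \o cinv c.

Definition compatible c c' : Prop :=
  smooth_map_on (cmap c @` (cdom c `&` cdom c')) (transition c c') /\
  smooth_map_on (cmap c' @` (cdom c `&` cdom c')) (transition c' c).

(* Change of the components, at [p], of a tangent vector with components [v]
   in the chart [c]. *)
Definition change_coord c c' (p : M) (v : 'rV[R]_d) : 'rV[R]_d :=
  'D_v (transition c c') (cmap c p).

End charts.

Record smooth_manifold (R : realType) (d : nat) := SmoothManifold {
  carrier :> topologicalType;
  manifold_hausdorff : hausdorff_space carrier;
  manifold_second_countable : @second_countable carrier;
  atlas : set (chart R d carrier);
  atlas_cover : forall p, exists2 c, atlas c & cdom c p;
  atlas_compatible : forall c c', atlas c -> atlas c' -> compatible c c';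
  atlas_maximal : forall c, (forall c', atlas c' -> compatible c c') -> atlas c
}.

Section one_forms.
Context {R : realType} {d : nat}.
(* A one-form on an open set of R^d, given by its components. *)
Implicit Types alpha : 'rV[R]_d -> 'rV[R]_d.

Definition form_app alpha (x v : 'rV[R]_d) : R :=
  \sum_(i < d) alpha x 0 i * v 0 i.

(* d alpha (v, w) = v (alpha w) - w (alpha v) - alpha [v, w], where the last
   term vanishes because v and w are constant vector fields. *)
Definition form_diff alpha (x v w : 'rV[R]_d) : R :=
  'D_v (fun y => form_app alpha y w) x - 'D_w (fun y => form_app alpha y v) x.

End one_forms.

(* [distr c p] and [metric c p] are the distribution and the metric at [p] read
   in the components of the chart [c]; they are relevant only when
   [atlas c] and [cdom c p], and [metric c p] only on [distr c p]. In dimension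
   1 the definition of a contact distribution degenerates to [D = 0], which is
   excluded. *)
Record contact_subriemannian_manifold (R : realType) (d : nat) := ContactSR {
  csr_manifold :> smooth_manifold R d;
  csr_connected : connected [set: csr_manifold];
  csr_dim_odd : odd d;
  csr_dim_gt1 : (1 < d)%N;
  distr : chart R d csr_manifold -> csr_manifold -> set 'rV[R]_d;
  distr_change_coord : forall c c' p v,
    atlas c -> atlas c' -> cdom c p -> cdom c' p ->
    distr c p v <-> distr c' p (change_coord c c' p v);
  distr_contact : forall c x, atlas c -> cimg c x ->
    exists (W : set 'rV[R]_d) (alpha : 'rV[R]_d -> 'rV[R]_d),
      [/\ open_nbhs x W, W `<=` cimg c, smooth_map_on W alpha &
        forall y, W y ->
          [/\ alpha y != 0,
              forall v, distr c (cinv c y) v <-> form_app alpha y v = 0 &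
              forall v, distr c (cinv c y) v ->
                (forall w, distr c (cinv c y) w -> form_diff alpha y v w = 0) ->
                v = 0]];
  metric : chart R d csr_manifold -> csr_manifold ->
    'rV[R]_d -> 'rV[R]_d -> R;
  metric_change_coord : forall c c' p v w,
    atlas c -> atlas c' -> cdom c p -> cdom c' p ->
    distr c p v -> distr c p w ->
    metric c' p (change_coord c c' p v) (change_coord c c' p w) =
      metric c p v w;
  metric_linear : forall c p (a : R) u v w, atlas c -> cdom c p ->
    distr c p u -> distr c p v -> distr c p w ->
    metric c p (a *: u + v) w = a * metric c p u w + metric c p v w;
  metric_symmetric : forall c p v w, atlas c -> cdom c p ->
    distr c p v -> distr c p w -> metric c p v w = metric c p w v;
  metric_pos : forall c p v, atlas c -> cdom c p ->
    distr c p v -> v != 0 -> 0 < metric c p v v;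
  metric_smooth : forall c (W : set 'rV[R]_d) (X Y : 'rV[R]_d -> 'rV[R]_d),
    atlas c -> open W -> W `<=` cimg c ->
    smooth_map_on W X -> smooth_map_on W Y ->
    (forall x, W x -> distr c (cinv c x) (X x)) ->
    (forall x, W x -> distr c (cinv c x) (Y x)) ->
    smooth_on W (fun x => metric c (cinv c x) (X x) (Y x))
}.

Section geodesics.
Context {R : realType} {d : nat} (M : contact_subriemannian_manifold R d).
(* Curves are total functions, of which only the restriction to the interval
   at hand matters. *)
Implicit Types (c : chart R d M) (g : R -> M) (a b t : R).

Definition velocity c g t : 'rV[R]_d := derive1 (cmap c \o g) t.

(* On a compact interval this is the Lipschitz property with respect to any
   Riemannian metric of M. *)
Definition lipschitz_curve a b g : Prop :=
  forall c t, atlas c -> a <= t <= b -> cdom c (g t) ->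
    exists V : set R, [/\ nbhs t V,
      forall s, V s -> a <= s <= b -> cdom c (g s) &
      [lipschitz cmap c (g s) | s in V `&` `[a, b]]].

Definition horizontal a b g : Prop :=
  {ae lebesgue_measure, forall t : R, a <= t <= b ->
    forall c, atlas c -> cdom c (g t) ->
      derivable (cmap c \o g) t 1 /\ distr c (g t) (velocity c g t)}.

Definition admissible a b g : Prop :=
  lipschitz_curve a b g /\ horizontal a b g.

(* At the times where the curve is differentiable and tangent to the
   distribution, the set below is a singleton by [metric_change_coord]. *)
Definition sq_speed g t : R :=
  xget 0 [set e | exists c, [/\ atlas c, cdom c (g t) &
    e = metric c (g t) (velocity c g t) (velocity c g t)]].

Definition energy a b g : \bar R :=
  ((2^-1)%:E * \int[lebesgue_measure]_(t in `[a, b]) (sq_speed g t)%:E)%E.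

Definition energy_minimizer a b g : Prop :=
  forall h, admissible a b h -> h a = g a -> h b = g b ->
    (energy a b g <= energy a b h)%E.

Definition geodesic g : Prop :=
  [/\ admissible 0 1 g,
      (exists2 t : R, 0 <= t <= 1 & g t <> g 0) &
      forall t, 0 <= t <= 1 -> exists2 e : R, 0 < e &
        forall a b, 0 <= a -> a < b -> b <= 1 ->
          `|a - t| < e -> `|b - t| < e -> energy_minimizer a b g].

Definition local_geodesics c (q p : M) : set (R -> M) :=
  [set g | [/\ geodesic g, g 0 = q, g 1 = p & g @` `[0, 1] `<=` cdom c]].

(* Geodesics are counted as maps on [0, 1]. *)
Definition nu c (q p : M) : \bar R :=
  counting [set (fun t : `[0%R, 1%R :> R]%classic => g (\val t))
           | g in local_geodesics c q p].

End geodesics.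

(* Main.v *)
(* Normal extremals through a point are geodesics: if [(y, p)] solves the Hamiltonian system,
   then [p . w + psi |w| ^ 2 + H t] with [w = h - y] grows along any competitor [h] at most like
   its energy (Fenchel's inequality plus a Taylor expansion of [H]), and it bounds from below
   the energy of competitors leaving a small box. It remains to find many extremals from [q]
   to the same nearby point. In coordinates where the distribution is spanned by the fields
   [b_i + a_i e], the rescaling [y = y0 + eta ^ 2 X . b + eta ^ 3 Z e] makes the system an
   [O(eta)] perturbation of the Heisenberg-type system [X' = U, U' = s J U], where [s] is the
   conserved vertical momentum. Prescribe [X 0 = 0] and [X 1 = xi]; for [s] off the resonances
   a contraction argument solves the perturbed system, with a solution Lipschitz in [s]. The
   vertical displacement at time 1 tends, as [eta] goes to 0, to an explicit function of [s]
   that blows up to the right of each [2 k pi / al], where [al ^ 2] is the eigenvalue of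
   [- J ^ 2] at [xi]. So for [eta] small enough each of finitely many intervals next to these
   poles contains an [s] whose extremal ends at the common target
   [y0 + eta ^ 2 xi . b + eta ^ 4 Zh e]; different intervals give different initial
   velocities, hence different geodesics. *)
Require Import Defs.
From mathcomp Require Import all_boot all_order all_algebra.
From mathcomp Require Import all_classical all_reals all_analysis.
From mathcomp Require Import measurable_realfun ring lra.
From mathcomp Require complex.

Set Implicit Arguments.
Unset Strict Implicit.
Unset Printing Implicit Defensive.

Import Order.TTheory GRing.Theory Num.Theory.
Import numFieldNormedType.Exports.

Local Open Scope classical_set_scope.
Local Open Scope ring_scope.

(** The dilation with factor [eta ^ 2] would give the weights 2 and 4. Writing [eta ^ 3 Z] instead
    leaves a spare factor [eta] everywhere: even the leading area term joins the perturbation, so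
    the unperturbed system is linear in [(X, U)] and explicitly solvable, while the endpoint moves
    by [eta ^ 4] along [e]. Existence comes from the contraction itself: the unknown is the forcing
    [f], with [f = eta F] along the response to [f] of the linear boundary value problem. Since
    [X 0] and [X 1] are built in, a single scalar equation in [s] remains, and the intermediate
    value theorem suffices. The target keeps a horizontal part [xi]: with [X 1 = 0] the nontrivial
    model extremals are the resonant ones, which are degenerate and need not survive a perturbation.
    The order of choices matters: finitely many intervals of multipliers, then a height [Zh] that
    all of them bracket with margin 1, and only then [eta]. *)

Section prim.
Context {R : realType}.
Implicit Types f F : R -> R.

(** * Derivatives, primitives and continuity in one variable *)

Lemma derD (t : R) f g df dg : is_derive t 1 f df -> is_derive t 1 g dg ->
  is_derive t 1 (fun x => f x + g x) (df + dg).
Proof. by move=> hf hg; exact: is_deriveD. Qed.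

Lemma derN (t : R) f df : is_derive t 1 f df -> is_derive t 1 (fun x => - f x) (- df).
Proof. by move=> hf; exact: is_deriveN. Qed.

Lemma derB (t : R) f g df dg : is_derive t 1 f df -> is_derive t 1 g dg ->
  is_derive t 1 (fun x => f x - g x) (df - dg).
Proof. by move=> hf hg; exact: is_deriveB. Qed.

Lemma derM (t : R) f g df dg : is_derive t 1 f df -> is_derive t 1 g dg ->
  is_derive t 1 (fun x => f x * g x) (df * g t + f t * dg).
Proof.
move=> hf hg; have := @is_deriveM _ _ f g t 1 df dg hf hg.
by rewrite addrC [X in X + _]mulrC.
Qed.

Lemma dercst (t c : R) : is_derive t 1 (fun=> c) (0 : R).
Proof. exact: is_derive_cst. Qed.

Lemma derid (t : R) : is_derive t 1 (fun x : R => x) (1 : R).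
Proof. exact: is_derive_id. Qed.

Lemma derMl (t c : R) f df : is_derive t 1 f df -> is_derive t 1 (fun x => c * f x) (c * df).
Proof. by move=> hf; exact: (@is_deriveZ _ _ _ f c). Qed.

Lemma dersum (t : R) n (f : 'I_n -> R -> R) (df : 'I_n -> R) :
  (forall i, is_derive t 1 (f i) (df i)) ->
  is_derive t 1 (fun x => \sum_i f i x) (\sum_i df i).
Proof.
move=> hf; have := @is_derive_sum _ _ _ n f t 1 df hf.
by congr (is_derive _ _ _ _); apply/funext => x; rewrite fct_sumE.
Qed.

Lemma der_eq (t : R) f (df df' : R) : is_derive t 1 f df -> df = df' -> is_derive t 1 f df'.
Proof. by move=> + <-. Qed.

(** The base point [A] is kept strictly to the left of the points of interest, so that two-sided
    derivatives are available even at the left end of the interval in use. *)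
Lemma antiderivative (A : R) f : continuous f ->
  exists F, forall x, A < x -> is_derive x 1 F (f x).
Proof.
move=> cf; exists (fun x => \int[lebesgue_measure]_(t in `[A, x]) f t) => x Ax.
have xu : x < x + 1 by rewrite ltrDl.
have itg : lebesgue_measure.-integrable `[A, (x + 1)] (EFin \o f).
  apply: continuous_compact_integrable; first exact: segment_compact.
  exact: continuous_subspaceT.
have [dF eF] := continuous_FTC1_closed xu itg Ax (cf x).
by apply: (DeriveDef dF); rewrite -derive1E; exact: eF.
Qed.

Lemma is_derive_continuous {V : normedModType R} (f : R -> V) (x : R) (l : V) :
  is_derive x 1 f l -> {for x, continuous f}.
Proof.
by move=> df; apply: differentiable_continuous; apply/derivable1_diffP; apply: ex_derive.
Qed.

(** Derivatives as limits along a sequence of positive steps: this form feeds dominated convergence,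
    and it sees only the values of [f] at [x] and to its right. *)
Lemma is_derive_cvg_seq (f : R -> R) (x l : R) : is_derive x 1 f l ->
  n.+1%:R * (f (x + n.+1%:R^-1) - f x) @[n --> \oo] --> l.
Proof.
move=> [/cvg_ex[/= l' df] <-]; have -> : 'D_1 f x = l' by apply/cvg_lim.
apply/cvgrPdist_lt => e e0; move/cvgrPdist_lt: df => /(_ e e0).
move=> -[d /= d0 H].
near=> n.
have := H (n.+1%:R^-1); rewrite /= sub0r normrN ger0_norm ?invr_ge0 //.
rewrite invrK -[n.+1%:R^-1 *: 1]/(n.+1%:R^-1 * 1) mulr1 addrC.
rewrite [_ + x]addrC.
rewrite [X in `|X|]addrC; apply; last by rewrite invr_neq0.
near: n; exact: near_infty_natSinv_lt (PosNum d0).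
Unshelve. all: by end_near. Qed.

Lemma lip_for_continuous {V W : normedModType R} (K r : R) (f : V -> W) (x : V) : 0 < r ->
  (forall y, `|x - y| < r -> `|f x - f y| <= K * `|x - y|) -> {for x, continuous f}.
Proof.
move=> r0 H; apply/cvgrPdist_lt => e e0.
have K1 : 0 < `|K| + 1 by rewrite ltr_wpDl.
have d0 : 0 < Num.min r ((`|K| + 1)^-1 * e) by rewrite lt_min r0 mulr_gt0 ?invr_gt0.
have := nbhsx_ballx x _ d0; apply: filterS => y; rewrite -ball_normE /= lt_min => /andP[xr xe].
apply: le_lt_trans (H _ xr) _; rewrite ltr_pdivlMl // in xe; apply: le_lt_trans xe.
by apply: ler_wpM2r => //; rewrite (le_trans (ler_norm _))// lerDl.
Qed.

Lemma continuous_open_eq {T : topologicalType} {W : normedModType R} (U : set T)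
    (f g : T -> W) x : open U -> (forall x, U x -> f x = g x) -> U x ->
  {for x, continuous f} -> {for x, continuous g}.
Proof.
move=> oU fg Ux /cvgrPdist_lt cf; have nU := open_nbhs_nbhs (conj oU Ux).
apply/cvgrPdist_lt => e e0; near=> y; have Uy : U y by near: y.
by rewrite -(fg _ Ux) -(fg _ Uy); near: y; exact: cf.
Unshelve. all: by end_near. Qed.

End prim.

(** * Real induction and Lipschitz functions on a segment *)

Section real_induction.
Context {R : realType}.

(** The supremum [m] of the [s] such that [P] holds on [[a, s]] satisfies [P] by the last
    hypothesis; if [m < b], the extension hypothesis would go past [m]. *)
Lemma real_ind (P : R -> Prop) (a b : R) : P a ->
  (forall s, a <= s -> s < b -> (forall r, a <= r <= s -> P r) ->
     exists2 s', s < s' & forall r, s < r -> r <= s' -> r <= b -> P r) ->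
  (forall s, a < s -> s <= b -> (forall r, a <= r -> r < s -> P r) -> P s) ->
  forall s, a <= s <= b -> P s.
Proof.
move=> Pa Pright Pleft s0 /andP[as0 s0b].
have ab := le_trans as0 s0b.
pose A := [set s | a <= s <= b /\ forall r, a <= r <= s -> P r].
have Aa : A a.
  split; first by rewrite lexx.
  by move=> r; rewrite -eq_le => /eqP <-.
have supA : has_sup A by split; [exists a | exists b => s [/andP[]]].
pose m := sup A.
have am : a <= m by apply: sup_upper_bound.
have mb : m <= b by apply: ge_sup; [exists a | move=> s [/andP[]]].
have Plt r : a <= r -> r < m -> P r.
  move=> ar rm; have /(sup_adherent)/(_ supA)[s [sab Ps]] : 0 < m - r by rewrite subr_gt0.
  by rewrite -/m subKr => rs; apply: Ps; rewrite ar ltW.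
have Pm : P m.
  move: am; rewrite le_eqVlt => /predU1P[<- //|am]; exact: Pleft.
have Am : A m.
  split; first by rewrite am.
  move=> r /andP[ar]; rewrite le_eqVlt => /predU1P[-> //|]; exact: Plt.
move: (mb); rewrite le_eqVlt => /predU1P[mb'|mb'].
  by case: Am => _; apply; rewrite as0 mb'.
have [s' ms' Ps'] := Pright _ am mb' Am.2.
have : A (Num.min s' b).
  split; first by rewrite le_min ltW ?(le_lt_trans am)//= ab ge_min lexx orbT.
  move=> r /andP[ar]; rewrite le_min => /andP[rs' rb].
  case: (leP r m) => rm; first by apply: Am.2; rewrite ar.
  exact: Ps'.
move/(sup_upper_bound supA); rewrite -/m => sm.
have : m < Num.min s' b by rewrite lt_min ms'.
by rewrite ltNge sm.
Qed.

Definition lip_seg {V : normedModType R} (K a b : R) (f : R -> V) :=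
  forall s t, a <= s -> s <= t -> t <= b -> `|f t - f s| <= K * (t - s).

Lemma lip_seg_sym {V : normedModType R} (K a b : R) (f : R -> V) s t : lip_seg K a b f ->
  a <= s <= b -> a <= t <= b -> `|f t - f s| <= K * `|t - s|.
Proof.
move=> H /andP[? ?] /andP[? ?]; case: (leP s t) => st.
  by rewrite ger0_norm ?subr_ge0//; exact: H.
by rewrite distrC (distrC t) gtr0_norm ?subr_gt0//; apply: H => //; exact: ltW.
Qed.

Lemma lip_seg_glue {V : normedModType R} (K a m b : R) (f : R -> V) :
  lip_seg K a m f -> lip_seg K m b f -> lip_seg K a b f.
Proof.
move=> Kam Kmb s t sa st tb.
case: (leP t m) => tm; first exact: Kam.
case: (leP m s) => ms; first exact: Kmb.
rewrite -(subrKA (f m)) (le_trans (ler_normD _ _))//.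
apply: (@le_trans _ _ (K * (t - m) + K * (m - s))); last by lra.
by apply: lerD; [apply: Kmb|apply: Kam] => //; exact: ltW.
Qed.

Lemma lip_segW {V : normedModType R} (K K' a b : R) (f : R -> V) : K <= K' ->
  lip_seg K a b f -> lip_seg K' a b f.
Proof.
move=> KK' H s t ? ? ?; apply: le_trans (H _ _ _ _ _) _ => //.
by apply: ler_wpM2r => //; rewrite subr_ge0.
Qed.

(** Real induction on the right end, with the constant quantified inside the predicate: each step
    glues one more local constant by taking a maximum, so the local constants need not be
    uniform. *)
Lemma locally_lip_seg {V : normedModType R} (a b : R) (f : R -> V) :
  (forall t, a <= t <= b -> exists2 e, 0 < e & exists K, forall s s',
     a <= s -> s <= s' -> s' <= b -> `|s - t| < e -> `|s' - t| < e ->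
     `|f s' - f s| <= K * (s' - s)) ->
  exists2 K, 0 <= K & lip_seg K a b f.
Proof.
move=> H.
have [ab|ba] := leP a b; last first.
  exists 0 => // s t as_ st tb; exfalso.
  by have := le_trans (le_trans as_ st) tb; rewrite leNgt ba.
apply: (@real_ind (fun s => exists2 K, 0 <= K & lip_seg K a s f) a b _ _ _ b);
  last by rewrite ab lexx.
- exists 0 => // s t as_ st ta; have -> : s = a by apply/le_anti; rewrite as_ andbT (le_trans st).
  have -> : t = a by apply/le_anti; rewrite ta (le_trans as_).
  by rewrite !subrr normr0 mul0r.
- move=> s as_ sb /(_ s); rewrite as_ lexx => /(_ isT)[K K0 Ks].
  have [|e e0 [K' Ke]] := H s; first by rewrite as_ ltW.
  exists (s + e / 2); first by rewrite ltrDl divr_gt0.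
  move=> r sr rse rb; exists (Num.max K K'); first by rewrite le_max K0.
  apply: (@lip_seg_glue _ _ _ s); first by apply: lip_segW Ks; rewrite le_max lexx.
  apply: (@lip_segW _ K'); first by rewrite le_max lexx orbT.
  have e2 : e / 2 < e by rewrite gtr_pMr // invf_lt1// ltr1n.
  move=> u v su uv vr; apply: Ke => //; rewrite ?(le_trans as_) ?(le_trans vr) //.
    by rewrite ger0_norm ?subr_ge0// ltrBlDl (le_lt_trans uv)// (le_lt_trans vr)// (le_lt_trans rse)// ltrD2l.
  by rewrite ger0_norm ?subr_ge0 ?(le_trans su)// ltrBlDl (le_lt_trans vr)// (le_lt_trans rse)// ltrD2l.
- move=> s as_ sb Hs; have [|e e0 [K' Ke]] := H s; first by rewrite ltW.
  pose r := Num.max a (s - e / 2).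
  have e20 : 0 < e / 2 by rewrite divr_gt0.
  have rs : r < s by rewrite gt_max as_ ltrBlDr ltrDl.
  have ar : a <= r by rewrite le_max lexx.
  have [K K0 Kr] := Hs r ar rs.
  exists (Num.max K K'); first by rewrite le_max K0.
  apply: (@lip_seg_glue _ _ _ r); first by apply: lip_segW Kr; rewrite le_max lexx.
  apply: (@lip_segW _ K'); first by rewrite le_max lexx orbT.
  have e2 : e / 2 < e by rewrite gtr_pMr // invf_lt1// ltr1n.
  have rse : s - e / 2 <= r by rewrite le_max lexx orbT.
  move=> u v ru uv vs; apply: Ke => //; rewrite ?(le_trans ar) ?(le_trans vs) //.
    by rewrite ler0_norm ?subr_le0 ?(le_trans uv)//; lra.
  by rewrite ler0_norm ?subr_le0 //; lra.
Qed.

End real_induction.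

(** * The fundamental theorem of calculus as an inequality for Lipschitz functions *)

Section ftc_ineq.
Context {R : realType}.
Local Notation mu := (@lebesgue_measure R).

(** The integral of a nonnegative function is a supremum over the simple functions below it, so
    monotonicity holds without measurability. This matters because [sq_speed] of a competitor is not
    known to be measurable. *)
Lemma le_nnintegral (f1 f2 : R -> \bar R) :
  (forall x, 0 <= f1 x)%E -> (forall x, f1 x <= f2 x)%E ->
  (\int[mu]_x f1 x <= \int[mu]_x f2 x)%E.
Proof.
move=> f10 f12; rewrite !ge0_integralTE//; last by move=> x; exact: le_trans (f12 x).
apply: le_ereal_sup => _ [h hf1 <-]; exists h => // x.
exact: le_trans (f12 x).
Qed.

(** Measurability is asked of [h] alone. It allows the exceptional null set [N] to be removed from
    the domain of [h], and outside [N] the comparison with [g] is pointwise. *)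
Lemma ae_le_integral (D D' : set R) (h g : R -> \bar R) : measurable D -> D `<=` D' ->
  (forall x, D x -> 0 <= h x)%E -> measurable_fun D h ->
  {ae mu, forall x, D x -> (h x <= g x)%E} ->
  {ae mu, forall x, D' x -> (0 <= g x)%E} ->
  (\int[mu]_(x in D) h x <= \int[mu]_(x in D') g x)%E.
Proof.
move=> mD DD' h0 mh hg g0.
have [N [mN N0 sN]] : mu.-negligible (~` [set x | (D x -> h x <= g x)%E /\ (D' x -> 0 <= g x)%E]).
  exact: (@filterI _ (almost_everywhere mu) _ _ _ hg g0).
have sN' x : ~ N x -> (D x -> h x <= g x)%E /\ (D' x -> 0 <= g x)%E.
  by move=> Nx; apply: contrapT => H; apply: Nx; exact: sN.
rewrite (ge0_negligible_integral mN mD mh h0 N0).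
rewrite [leRHS]integralE.
(* On [D'] the negative part of [g] vanishes off [N]; it is therefore below the function equal to
   [+oo] on [N], whose integral over a null set is 0. *)
have -> : (\int[mu]_(x in D') g^\- x = 0)%E.
  apply/eqP; rewrite eq_le integral_ge0 ?andbT//.
  have -> : 0%E = (\int[mu]_(x in N) (cst +oo) x)%E.
    have := @ge0_negligible_integral _ _ R mu N N (cst +oo%E) mN mN (measurable_cst _)
      (fun _ _ => leey _) N0.
    by rewrite setDv integral_set0 => ->.
  rewrite [leLHS]integral_mkcond [leRHS]integral_mkcond; apply: le_nnintegral => x.
    by rewrite erestrict_ge0.
  rewrite /patch; case: ifPn => [|_]; last by case: ifP => // _; rewrite leey.
  rewrite inE => xD'; case: ifPn => [_|]; first by rewrite leey.
  rewrite notin_setE => /sN'[_ /(_ xD')] g0x.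
  by rewrite funenegE ge_max leeNl oppe0 g0x lexx.
rewrite sube0 [leLHS]integral_mkcond [leRHS]integral_mkcond; apply: le_nnintegral => x.
  by apply: erestrict_ge0 => y [Dy _]; exact: h0.
rewrite /patch; case: ifPn => [|_]; last by case: ifP => // _; exact: funepos_ge0.
rewrite inE => -[Dx /sN'[/(_ Dx) hgx _]].
by rewrite mem_set; [rewrite funeposE le_max hgx|exact: DD'].
Qed.

Lemma le_integral_funepos (D : set R) (h : R -> \bar R) :
  (\int[mu]_(x in D) h x <= \int[mu]_(x in D) funepos h x)%E.
Proof.
rewrite integralE geeDl// oppe_le0 integral_ge0//.
Qed.

(* Difference quotients of a Lipschitz function are bounded, hence dominated convergence
   applies; no absolute continuity theory is needed. *)
Lemma lip_ftc_le (a c b K : R) (f g : R -> R) : a < c -> c <= b -> lip_seg K a c f ->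
  {ae mu, forall t, a < t < c -> derivable f t 1 /\ derive1 f t <= g t} ->
  {ae mu, forall t, a <= t <= b -> 0 <= g t} ->
  ((f c - f a)%:E <= \int[mu]_(t in `[a, b]) (g t)%:E)%E.
Proof.
move=> ac cb lf dfg g0.
(* Clamping extends [f] from [[a, c]] to a [K]-Lipschitz function [F] on the whole line, so that
   forward difference quotients make sense up to [c]. *)
pose cl (t : R) := Num.max a (Num.min c t).
have acl t : a <= cl t <= c by rewrite /cl le_max lexx/= ge_max (ltW ac)/= ge_min lexx.
have clid t : a <= t <= c -> cl t = t.
  by move=> /andP[at_ tc]; rewrite /cl (min_idPr tc) (max_idPr at_).
have cllip s t : `|cl t - cl s| <= `|t - s|.
  have := ler_norm (t - s); have := ler_norm (s - t); rewrite (distrC s) => ts1 ts2.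
  rewrite /cl; rewrite !maxEle !minEle;
  case: (leP c t) => ? ; case: (leP c s) => ?; repeat (case: ifPn; rewrite -?ltNge => ?);
    apply/ler_normlP; split; lra.
pose F := f \o cl.
have K0 : 0 <= K.
  have := lf a c (lexx _) (ltW ac) (lexx _); move/(le_trans (normr_ge0 _)).
  by rewrite pmulr_lge0 // subr_gt0.
have Flip s t : `|F t - F s| <= K * `|t - s|.
  apply: (le_trans (lip_seg_sym lf (acl s) (acl t))).
  exact: ler_wpM2l.
have cF : continuous F.
  by move=> x; apply: (@lip_for_continuous _ _ _ K 1) => // y _; rewrite distrC (distrC x).
have [Phi dPhi] := antiderivative (a - 1) cF.
pose D_ (n : nat) t := n.+1%:R * (F (t + n.+1%:R^-1) - F t).
(* [G_ n] is a primitive of the difference quotient [D_ n] and tends to [F]: hence the integral of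
   [D_ n] over [[a, c]] tends to [F c - F a]. *)
pose G_ (n : nat) t := n.+1%:R * (Phi (t + n.+1%:R^-1) - Phi t).
have cD n : continuous (D_ n).
  move=> x; apply: (@lip_for_continuous _ _ _ (n.+1%:R * (K + K)) 1) => // y _.
  rewrite /D_ -mulrBr normrM ger0_norm// -mulrA ler_wpM2l//.
  rewrite (_ : _ - _ = (F (x + n.+1%:R^-1) - F (y + n.+1%:R^-1)) - (F x - F y)); last by ring.
  rewrite (le_trans (ler_normB _ _))// mulrDl lerD// (le_trans (Flip _ _))//.
  by rewrite opprD addrACA subrr addr0.
have bD n t : `|D_ n t| <= K.
  rewrite normrM ger0_norm// -ler_pdivlMl// mulrC (le_trans (Flip _ _))//.
  by rewrite addrAC subrr add0r ger0_norm // invr_ge0.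
have dG n t : a - 1 < t -> is_derive t 1 (G_ n) (D_ n t).
  move=> at_.
  have at2 : a - 1 < t + n.+1%:R^-1 by rewrite ltr_wpDr ?invr_ge0.
  have d1 := dPhi _ at_; have d2 := dPhi _ at2.
  have d3 : is_derive t 1 (fun t => Phi (t + n.+1%:R^-1)) (F (t + n.+1%:R^-1)).
    have := @is_derive1_comp _ Phi (fun t => t + n.+1%:R^-1) t (F (t + n.+1%:R^-1)) 1 d2 _.
    by rewrite mulr1; apply; exact: is_derive_shift.
  exact: derMl (derB d3 d1).
have gt1 : a - 1 < a by rewrite gtrBl.
have intD n : (\int[mu]_(t in `[a, c]) (D_ n t)%:E = (G_ n c - G_ n a)%:E)%E.
  rewrite (@continuous_FTC2 _ (D_ n) (G_ n))//.
  - by apply: continuous_subspaceT => x; exact: cD.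
  - split.
    + move=> x; rewrite in_itv/= => /andP[ax _]; 
      by have [] := dG n x (lt_trans gt1 ax).
    + apply: cvg_at_right_filter; apply: is_derive_continuous (dG n a _).
      by rewrite gtrBl.
    + apply: cvg_at_left_filter; apply: is_derive_continuous (dG n c _).
      by rewrite (lt_trans _ ac)// gtrBl.
  - move=> x; rewrite in_itv/= => /andP[ax _]; rewrite derive1E.
    by have [] := dG n x (lt_trans gt1 ax).
have cvgG t : a - 1 < t -> G_ n t @[n --> \oo] --> F t.
  by move=> at_; apply: is_derive_cvg_seq; exact: dPhi.
have [N0 [mN0 N00 sN0]] := dfg.
pose N := N0 `|` [set a] `|` [set c].
have mN : measurable N by apply: measurableU => //; exact: measurableU.
have muN : mu N = 0.
  have sing x : mu.-negligible [set x].
    by apply/negligibleP => //; exact: lebesgue_measure_set1.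
  apply/negligibleP => //; apply: negligibleU => //; apply: negligibleU => //.
  exact/negligibleP.
pose D : set R := `[a, c]%classic `\` N.
have mD : measurable D by apply: measurableD.
have DP t : D t -> a < t < c /\ (derivable f t 1 /\ derive1 f t <= g t).
  move=> [/=]; rewrite in_itv/= => /andP[at_ tc] /not_orP[/not_orP[N0t ta] tc'].
  have act : a < t < c.
    by rewrite !lt_neqAle at_ tc !andbT; apply/andP; split; apply/eqP; [move/esym|].
  split=> //; have : ~ ~ (a < t < c -> derivable f t 1 /\ derive1 f t <= g t).
    by move=> H; apply: N0t; exact: sN0.
  by move/contrapT; apply.
have cvgD t : D t -> (D_ n t)%:E @[n --> \oo] --> (derive1 f t)%:E.
  move=> /DP[act [df _]]; apply: cvg_EFin; first exact: nearW.
  apply: is_derive_cvg_seq.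
  apply: (@near_eq_is_derive _ _ _ f); rewrite ?oner_eq0//.
    near=> s; rewrite /F/= clid//; near: s.
    have : \forall s \near t, s \in `]a, c[.
      by apply: near_in_itvoo; rewrite in_itv.
    by apply: filterS => s; rewrite in_itv/= => /andP[? ?]; rewrite !ltW.
  by rewrite derive1E; exact: derivableP.
have mDn n : measurable_fun D (EFin \o D_ n).
  apply/measurable_EFinP; apply: measurable_funTS.
  by apply: continuous_measurable_fun => x; exact: cD.
have mf' : measurable_fun D (EFin \o derive1 f).
  by apply: (emeasurable_fun_cvg _ _ mDn) => t Dt; exact: cvgD.
have finD : (mu D < +oo)%E.
  apply: (@le_lt_trans _ _ (mu `[a, c])); first by apply: le_measure; rewrite ?inE//; exact: subDsetl.
  by rewrite lebesgue_measure_itv /= lte_fin ac -EFinB ltry.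
have [_ _ cvgI] : [/\ mu.-integrable D (EFin \o derive1 f),
    [sequence (\int[mu]_(x in D) `|(D_ n x)%:E - (derive1 f x)%:E|)%E]_n @ \oo --> 0%E &
    [sequence (\int[mu]_(x in D) (D_ n x)%:E)%E]_n @ \oo --> (\int[mu]_(x in D) (derive1 f x)%:E)%E].
  apply: (@dominated_convergence _ _ _ mu _ mD _ _ (EFin \o cst K)) => //.
  - exact: aeW.
  - apply: (@integrableS _ _ _ mu `[a, c]%classic D) => //; first exact: subDsetl.
    apply: continuous_compact_integrable; first exact: segment_compact.
    by apply: continuous_subspaceT => x; exact: cst_continuous.
  - by apply: aeW => x n _ /=; rewrite lee_fin.
have intDn n : (\int[mu]_(x in D) (D_ n x)%:E = (G_ n c - G_ n a)%:E)%E.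
  rewrite -intD -negligible_integral//.
  apply: continuous_compact_integrable; first exact: segment_compact.
  by apply: continuous_subspaceT => x; exact: cD.
have lim : (\int[mu]_(x in D) (derive1 f x)%:E = (f c - f a)%:E)%E.
  apply: cvg_unique cvgI _ => //.
  have -> : [sequence (\int[mu]_(x in D) (D_ n x)%:E)%E]_n = fun n => (G_ n c - G_ n a)%:E.
    by apply/funext => n /=; rewrite intDn.
  apply: cvg_EFin; first exact: nearW.
  have -> : f c - f a = F c - F a by rewrite /F/= !clid// ?lexx ?ltW.
  by apply: cvgB; apply: cvgG; lra.
(* [derive1 f] may be negative, and [g] is integrated over the larger segment up to [b]; passing to
   the positive part makes the comparison across the two domains possible. *)
rewrite -lim (le_trans (le_integral_funepos _ _))//.
apply: ae_le_integral => //.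
- by move=> t [] /=; rewrite !in_itv/= => /andP[-> /le_trans ->].
- exact: measurable_funepos.
- apply: (@filterS _ (almost_everywhere mu) (ae_filter_ringOfSetsType _) _ _ _ g0) => t g0t Dt.
  have [/andP[a_t tc] [_ f'g]] := DP _ Dt.
  rewrite funeposE ge_max !lee_fin f'g/= g0t//.
  by rewrite ltW//= (le_trans (ltW tc)).
Unshelve. all: by end_near. Qed.

End ftc_ineq.

(** * Algebra of functions of class C^k *)

Section class_C_theory.
Context {R : realType} {d : nat}.
Implicit Types (U V : set 'rV[R]_d) (f g : 'rV[R]_d -> R).

Lemma class_C_continuous k U f x : class_C k U f -> U x -> {for x, continuous f}.
Proof. by case: k => [|k] [H _]; exact: H. Qed.

Lemma class_C_sub k U V f : V `<=` U -> class_C k U f -> class_C k V f.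
Proof.
move=> VU; elim: k f => [|k IH] f /= [cf H]; split => //; try by move=> x /VU; exact: cf.
move=> i; have [df Hi] := H i; split; last exact: IH.
by move=> x /VU; exact: df.
Qed.

Lemma class_C_pred k U f : class_C k.+1 U f -> class_C k U f.
Proof.
elim: k f => [|k IH] f [cf H]; split => //.
by move=> i; have [df Hi] := H i; split => //; exact: IH.
Qed.

Lemma class_C_eq k U f g : open U -> (forall x, U x -> f x = g x) ->
  class_C k U f -> class_C k U g.
Proof.
move=> oU; elim: k f g => [|k IH] f g fg.
  by move=> [cf _]; split=> // x Ux; exact: (continuous_open_eq oU fg Ux (cf x Ux)).
have nfg x : U x -> {near x, f =1 g}.
  by move=> Ux; have := open_nbhs_nbhs (conj oU Ux); apply: filterS => y; exact: fg.
have ngf x : U x -> {near x, g =1 f}.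
  by move=> /nfg; apply: filterS => y.
move=> [cf H]; split.
  by move=> x Ux; exact: (continuous_open_eq oU fg Ux (cf x Ux)).
move=> i; have [df Hi] := H i; split.
  move=> x Ux; have [d0|d0] := eqVneq (delta_mx 0 i : 'rV[R]_d) 0.
    by rewrite d0; exact: derivable0.
  by apply: (@near_eq_derivable _ _ _ f) => //; [exact: nfg|exact: df].
apply: IH Hi => x Ux.
have [d0|d0] := eqVneq (delta_mx 0 i : 'rV[R]_d) 0; first by rewrite d0 !derive0.
by apply: near_eq_derive => //; exact: nfg.
Qed.

Lemma class_C_cst k U (c : R) : class_C k U (fun=> c).
Proof.
elim: k c => [|k IH] c; split => //; try by move=> x _; exact: cst_continuous.
move=> i; split; first by move=> x _; exact: derivable_cst.
have -> : 'D_(delta_mx 0 i) (fun=> c) = (fun=> 0) :> ('rV[R]_d -> R).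
  by apply: funext => x; exact: (@derive_cst _ _ _ c).
exact: IH.
Qed.

Lemma class_C_add k U f g : open U -> class_C k U f -> class_C k U g ->
  class_C k U (fun x => f x + g x).
Proof.
move=> oU; elim: k f g => [|k IH] f g [cf Hf] [cg Hg]; split => //;
  try by move=> x Ux; exact: continuousD (cf x Ux) (cg x Ux).
move=> i; have [df Hfi] := Hf i; have [dg Hgi] := Hg i; split.
  by move=> x Ux; apply: derivableD; [exact: df|exact: dg].
apply: class_C_eq (IH _ _ Hfi Hgi) => // x Ux.
exact/esym/(deriveD (df x Ux) (dg x Ux)).
Qed.

Lemma class_C_mul k U f g : open U -> class_C k U f -> class_C k U g ->
  class_C k U (fun x => f x * g x).
Proof.
move=> oU; elim: k f g => [|k IH] f g Hf0 Hg0; have [cf Hf] := Hf0; have [cg Hg] := Hg0;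
  split => //; try by move=> x Ux; exact: continuousM (cf x Ux) (cg x Ux).
move=> i; have [df Hfi] := Hf i; have [dg Hgi] := Hg i; split.
  by move=> x Ux; apply: derivableM; [exact: df|exact: dg].
have := class_C_add oU (IH _ _ (class_C_pred Hf0) Hgi) (IH _ _ (class_C_pred Hg0) Hfi).
apply: class_C_eq => // x Ux.
exact/esym/(deriveM (df x Ux) (dg x Ux)).
Qed.

Lemma class_C_inv k U f : open U -> (forall x, U x -> f x != 0) -> class_C k U f ->
  class_C k U (fun x => (f x)^-1).
Proof.
move=> oU f0; elim: k => [|k IH] Hf0; have [cf Hf] := Hf0; split => //;
  try by move=> x Ux; exact: continuousV (f0 x Ux) (cf x Ux).
move=> i; have [df Hfi] := Hf i; split.
  by move=> x Ux; apply: derivableV; [exact: f0|exact: df].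
have IHk := IH (class_C_pred Hf0).
have := class_C_mul oU (class_C_mul oU (class_C_cst k U (-1)) (class_C_mul oU IHk IHk)) Hfi.
apply: class_C_eq => // x Ux.
have := deriveV (f0 x Ux) (df x Ux); rewrite /= => ->.
by rewrite mulN1r -expr2 exprVn.
Qed.

Lemma smooth_eq U f g : open U -> (forall x, U x -> f x = g x) ->
  smooth_on U f -> smooth_on U g.
Proof. by move=> oU fg H k; exact: class_C_eq (H k). Qed.

Lemma smooth_cst U c : smooth_on U (fun=> c).
Proof. by move=> k; exact: class_C_cst. Qed.

Lemma smooth_add U f g : open U -> smooth_on U f -> smooth_on U g ->
  smooth_on U (fun x => f x + g x).
Proof. by move=> oU Hf Hg k; exact: class_C_add. Qed.

Lemma smooth_mul U f g : open U -> smooth_on U f -> smooth_on U g ->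
  smooth_on U (fun x => f x * g x).
Proof. by move=> oU Hf Hg k; exact: class_C_mul. Qed.

Lemma smooth_inv U f : open U -> (forall x, U x -> f x != 0) -> smooth_on U f ->
  smooth_on U (fun x => (f x)^-1).
Proof. by move=> oU f0 Hf k; exact: class_C_inv. Qed.

Lemma smooth_sum U (I : Type) (r : seq I) (P : pred I) (F : I -> 'rV[R]_d -> R) : open U ->
  (forall i, P i -> smooth_on U (F i)) -> smooth_on U (fun x => \sum_(i <- r | P i) F i x).
Proof.
move=> oU HF; elim: r => [|i r IH].
  by apply: (@smooth_eq _ (fun=> 0)) => // [x _|]; [rewrite big_nil|exact: smooth_cst].
case Pi : (P i).
  apply: (@smooth_eq _ (fun x => F i x + \sum_(j <- r | P j) F j x)) => //.
    by move=> x _; rewrite big_cons Pi.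
  by apply: smooth_add => //; exact: HF.
by apply: smooth_eq IH => // x _; rewrite big_cons Pi.
Qed.

Lemma smooth_prod U (I : Type) (r : seq I) (P : pred I) (F : I -> 'rV[R]_d -> R) : open U ->
  (forall i, P i -> smooth_on U (F i)) -> smooth_on U (fun x => \prod_(i <- r | P i) F i x).
Proof.
move=> oU HF; elim: r => [|i r IH].
  by apply: (@smooth_eq _ (fun=> 1)) => // [x _|]; [rewrite big_nil|exact: smooth_cst].
case Pi : (P i).
  apply: (@smooth_eq _ (fun x => F i x * \prod_(j <- r | P j) F j x)) => //.
    by move=> x _; rewrite big_cons Pi.
  by apply: smooth_mul => //; exact: HF.
by apply: smooth_eq IH => // x _; rewrite big_cons Pi.
Qed.

Lemma smooth_det U n (A : 'rV[R]_d -> 'M[R]_n) : open U ->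
  (forall i j, smooth_on U (fun x => A x i j)) -> smooth_on U (fun x => \det (A x)).
Proof.
move=> oU HA; apply: smooth_sum => // s _; apply: smooth_mul => //; first exact: smooth_cst.
by apply: smooth_prod => // i _; exact: HA.
Qed.

Lemma smooth_invmx U n (A : 'rV[R]_d -> 'M[R]_n) : open U ->
  (forall x, U x -> A x \in unitmx) ->
  (forall i j, smooth_on U (fun x => A x i j)) ->
  forall i j, smooth_on U (fun x => invmx (A x) i j).
Proof.
move=> oU uA HA i j.
apply: (@smooth_eq _ (fun x => (\det (A x))^-1 * ((-1) ^+ (j + i) * \det (row' j (col' i (A x)))))) => //.
  by move=> x Ux; rewrite /invmx uA// !mxE.
apply: smooth_mul => //.
  by apply: smooth_inv => //; [move=> x /uA; rewrite unitmxE unitfE|exact: smooth_det].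
apply: smooth_mul => //; first exact: smooth_cst.
by apply: smooth_det => // k l; apply: smooth_eq (HA (lift j k) (lift i l)) => // x _; rewrite !mxE.
Qed.

End class_C_theory.

(** * Taylor estimates on boxes for functions of class C^2 *)

Section C11_estimates.
Context {R : realType} {d : nat}.
Implicit Types (f : 'rV[R]_d -> R) (x y : 'rV[R]_d).

Lemma ler_mx_norm m p (A : 'M[R]_(m, p)) i j : `|A i j| <= `|A|.
Proof.
rewrite [leRHS]/Num.Def.normr/= mx_normrE.
by apply: le_trans; last exact: (le_bigmax _ _ (i, j)).
Qed.

Lemma mx_norm_le m p (A : 'M[R]_(m, p)) (C : R) : 0 <= C ->
  (forall i j, `|A i j| <= C) -> `|A| <= C.
Proof.
by move=> C0 H; rewrite /Num.Def.normr/= mx_normrE (bigmax_le _ C0)//= => -[i j] _; exact: H.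
Qed.

(* [df] are meant to be the partial derivatives of [f]. *)
Definition C11 (y0 : 'rV[R]_d) (rho C : R) f (df : 'I_d -> 'rV[R]_d -> R) :=
  forall x y, `|x - y0| <= rho -> `|y - y0| <= rho ->
  [/\ `|f x| <= C, (forall l, `|df l x| <= C), `|f y - f x| <= C * `|y - x|,
      (forall l, `|df l y - df l x| <= C * `|y - x|) &
      `|f y - f x - \sum_l df l x * (y 0 l - x 0 l)| <= C * `|y - x| ^+ 2].

Lemma is_derive_line f w e (s l : R) : is_derive (w + s *: e) e f l ->
  is_derive s 1 (fun s => f (w + s *: e)) l.
Proof.
have H : (fun h : R => h^-1 *: (((fun s => f (w + s *: e)) \o shift s) (h *: (1 : R)) - f (w + s *: e)))
    = (fun h : R => h^-1 *: ((f \o shift (w + s *: e)) (h *: e) - f (w + s *: e))).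
  apply: funext => h /=; congr (_ *: (f _ - _)).
  by rewrite [h *: 1]mulr1 scalerDl addrCA.
by move=> [df dl]; split; [rewrite /derivable H|rewrite /derive H].
Qed.

(** Class C^1 only speaks of partial derivatives, so the path from [x] to [y] changes one coordinate
    at a time and the mean value theorem is applied on each edge. The path stays in the box because
    the norm is the sup norm. *)
Lemma coord_mvt f (U : set 'rV[R]_d) y0 rho x y :
  (forall z, `|z - y0| <= rho -> U z) -> class_C 1 U f ->
  `|x - y0| <= rho -> `|y - y0| <= rho ->
  exists z : 'I_d -> 'rV[R]_d,
    (forall k, `|z k - y0| <= rho /\ `|z k - x| <= `|y - x|) /\
    f y - f x = \sum_k 'D_(delta_mx 0 k) f (z k) * (y 0 k - x 0 k).
Proof.
move=> BU [_ Cf] xr yr.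
have rho0 : 0 <= rho by apply: le_trans xr.
pose w (m : nat) (s : R) : 'rV[R]_d :=
  \row_i (if (i < m)%N then y 0 i else if i == m :> nat then s else x 0 i).
have wE (k : 'I_d) s : w k s = w k 0 + s *: delta_mx 0 k.
  apply/rowP => i; rewrite !mxE eqxx /=.
  rewrite -val_eqE /=; case: ltngtP => [ik|ik|ik]; by rewrite ?mulr0 ?addr0 ?mulr1 ?add0r.
(* When [k] is the last index, [k.+1] is not a coordinate and the default value 0 is never read. *)
have wS (k : 'I_d) : w k.+1 (if insub k.+1 is Some j then x 0 (j : 'I_d) else 0) = w k (y 0 k).
  apply/rowP => i; rewrite !mxE ltnS leq_eqVlt.
  case: (ltngtP i k) => //= ik; last by rewrite -(val_inj ik).
  case: eqP => // ik1; case: insubP => [j _ /= jk|]; last by rewrite -ik1 ltn_ord.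
  by congr (x _ _); apply: val_inj; rewrite /= jk -ik1.
have btw (k : 'I_d) s : Num.min (x 0 k) (y 0 k) <= s <= Num.max (x 0 k) (y 0 k) ->
    `|w k s - y0| <= rho /\ `|w k s - x| <= `|y - x|.
  have cx i : `|x 0 i - y0 0 i| <= rho by have := le_trans (ler_mx_norm (x - y0) 0 i) xr; rewrite !mxE.
  have cy i : `|y 0 i - y0 0 i| <= rho by have := le_trans (ler_mx_norm (y - y0) 0 i) yr; rewrite !mxE.
  have cyx i : `|y 0 i - x 0 i| <= `|y - x| by have := ler_mx_norm (y - x) 0 i; rewrite !mxE.
  move=> /andP[]; rewrite ge_min le_max => s1 s2.
  split; apply: mx_norm_le => // j i; rewrite ord1 !mxE; case: ltngtP => // ik.
  - have := cx i; have := cy i; rewrite (val_inj ik) !ler_norml => /andP[? ?] /andP[? ?].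
    case/orP: s1 => ?; case/orP: s2 => ?; apply/andP; split; lra.
  - by rewrite subrr normr0.
  - have := cyx i; rewrite (val_inj ik) => c1; apply: le_trans c1.
    have := ler_norm (y 0 k - x 0 k); have := ler_norm (- (y 0 k - x 0 k)); rewrite normrN => ? ?.
    case/orP: s1 => ?; case/orP: s2 => ?; apply/ler_normlP; split; lra.
have dw (k : 'I_d) s : Num.min (x 0 k) (y 0 k) <= s <= Num.max (x 0 k) (y 0 k) ->
    is_derive s 1 (fun s => f (w k s)) ('D_(delta_mx 0 k) f (w k s)).
  move=> /btw[/BU Uw _].
  have -> : (fun s => f (w k s)) = (fun s => f (w k 0 + s *: delta_mx 0 k)).
    by apply: funext => s'; rewrite -wE.
  by apply: is_derive_line; rewrite -wE; apply: derivableP; have [H _] := Cf k; exact: H.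
have step (k : 'I_d) : exists s, Num.min (x 0 k) (y 0 k) <= s <= Num.max (x 0 k) (y 0 k) /\
    f (w k (y 0 k)) - f (w k (x 0 k)) = 'D_(delta_mx 0 k) f (w k s) * (y 0 k - x 0 k).
  case: (leP (x 0 k) (y 0 k)) => xy.
    have [||s] := @MVT_segment _ (fun s => f (w k s)) (fun s => 'D_(delta_mx 0 k) f (w k s)) _ _ xy.
    - move=> s; rewrite in_itv/= => /andP[/ltW s1 /ltW s2]; apply: dw.
      by rewrite (min_idPl xy) (max_idPr xy) s1.
    - apply: derivable_within_continuous => s; rewrite in_itv/= => sxy.
      have [] // := dw k s; by rewrite (min_idPl xy) (max_idPr xy).
    rewrite in_itv/= => sxy ->; by exists s.
  have yx := ltW xy.
  have [||s] := @MVT_segment _ (fun s => f (w k s)) (fun s => 'D_(delta_mx 0 k) f (w k s)) _ _ yx.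
  - move=> s; rewrite in_itv/= => /andP[/ltW s1 /ltW s2]; apply: dw.
    by rewrite (min_idPr yx) (max_idPl yx) s1.
  - apply: derivable_within_continuous => s; rewrite in_itv/= => sxy.
    have [] // := dw k s; by rewrite (min_idPr yx) (max_idPl yx).
  rewrite in_itv/= => sxy H; exists s; split => //.
  by rewrite -[LHS]opprB H -mulrN opprB.
have {step}/choice[s Hs] := step.
exists (fun k : 'I_d => w k (s k)); split; first by move=> k; apply: btw; exact: (Hs k).1.
under eq_bigr => k _ do rewrite -(Hs k).2.
pose F (m : nat) := f (w m (if insub m is Some j then x 0 (j : 'I_d) else 0)).
have -> : f y - f x = F d - F 0%N.
  congr (f _ - f _); apply/rowP => i; rewrite !mxE; first by rewrite ltn_ord.
  rewrite ltn0; case: eqP => // i0; case: insubP => [j _ /= j0|].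
    by congr (x _ _); apply: val_inj; rewrite /= j0 i0.
  by have := ltn_ord i; rewrite {1}i0 => ->.
rewrite -(@telescope_sumr _ 0 d F) // big_mkord; apply: eq_bigr => k _.
rewrite /F wS; congr (_ - f (w _ _)).
by case: insubP => [j _ jk|]; [congr (x _ _); exact: val_inj|rewrite ltn_ord].
Qed.

Lemma closed_box_compact y0 (rho : R) : compact [set z : 'rV[R]_d | `|z - y0| <= rho].
Proof.
have [r0|r0] := leP 0 rho; last first.
  rewrite (_ : [set _ | _] = set0); first exact: compact0.
  by apply/seteqP; split => // z /= /(le_trans (normr_ge0 _)); rewrite leNgt r0.
rewrite (_ : [set z : 'rV[R]_d | _] = [set v : 'rV[R]_d | forall i, `[y0 0 i - rho, y0 0 i + rho]%classic (v ord0 i)]).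
  by apply: (@rV_compact R d (fun i => `[y0 0 i - rho, y0 0 i + rho]%classic)) => i; exact: segment_compact.
apply/seteqP; split => z /= H.
  move=> i; rewrite in_itv/=; have := le_trans (ler_mx_norm (z - y0) 0 i) H.
  rewrite !mxE ler_norml => /andP[? ?].
  by change (y0 0 i - rho <= z 0 i <= y0 0 i + rho); apply/andP; split; lra.
apply: mx_norm_le => // j i; rewrite ord1 !mxE ler_norml.
have := H i; rewrite in_itv/=; change (y0 0 i - rho <= z 0 i <= y0 0 i + rho -> - rho <= z 0 i - y0 0 i <= rho).
by move=> /andP[? ?]; apply/andP; split; lra.
Qed.

Lemma continuous_box_bounded f y0 (rho : R) :
  (forall z, `|z - y0| <= rho -> {for z, continuous f}) ->
  exists2 C : R, 0 <= C & forall z, `|z - y0| <= rho -> `|f z| <= C.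
Proof.
move=> cf; have [r0|r0] := leP 0 rho; last first.
  by exists 0 => // z /(le_trans (normr_ge0 _)); rewrite leNgt r0.
pose B := [set z : 'rV[R]_d | `|z - y0| <= rho].
have [|||c cB H] := @compact_EVT_max _ R (fun z => `|f z|) B.
- by exists y0; rewrite /B /= subrr normr0.
- exact: closed_box_compact.
- apply/subspace_continuousP => z Bz.
  apply: cvg_within_filter; apply: (@cvg_norm _ _ _ _ _ f); exact: cf.
by exists `|f c| => // z Bz; apply: H; rewrite inE.
Qed.

(** The constants are bounds on the compact box for [f] and its derivatives up to order two. For the
    quadratic remainder, [coord_mvt] expresses the increment by partial derivatives at nearby
    points, which are then moved to [x] at the price of a second factor [|y - x|]. *)
Lemma class_C2_C11 f (U : set 'rV[R]_d) y0 rho :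
  (forall z, `|z - y0| <= rho -> U z) -> class_C 2 U f ->
  exists2 C : R, 0 <= C & C11 y0 rho C f (fun l => 'D_(delta_mx 0 l) f).
Proof.
move=> BU Cf.
have [C0 C00 HC0] : exists2 C : R, 0 <= C & forall z, `|z - y0| <= rho -> `|f z| <= C.
  by apply: continuous_box_bounded => z /BU; exact: class_C_continuous Cf.
have dC k : class_C 1 U ('D_(delta_mx 0 k) f) by case: Cf => _ /(_ k)[].
have ddC k l : class_C 0 U ('D_(delta_mx 0 l) ('D_(delta_mx 0 k) f)).
  by case: (dC k) => _ /(_ l)[].
have /choice[C1 HC1] k : exists C : R, 0 <= C /\ forall z, `|z - y0| <= rho -> `|'D_(delta_mx 0 k) f z| <= C.
  have [|C c0 cH] := @continuous_box_bounded ('D_(delta_mx 0 k) f) y0 rho; last by exists C.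
  by move=> z /BU; exact: class_C_continuous (dC k).
have /choice[C2 HC2] (kl : 'I_d * 'I_d) : exists C : R, 0 <= C /\ forall z, `|z - y0| <= rho ->
    `|'D_(delta_mx 0 kl.2) ('D_(delta_mx 0 kl.1) f) z| <= C.
  have [|C c0 cH] := @continuous_box_bounded ('D_(delta_mx 0 kl.2) ('D_(delta_mx 0 kl.1) f)) y0 rho; last by exists C.
  by move=> z /BU; exact: class_C_continuous (ddC _ _).
pose D1 := \sum_k C1 k; pose D2 := \sum_kl C2 kl.
have C1D k : C1 k <= D1.
  by rewrite /D1 (bigD1 k)//= lerDl sumr_ge0// => i _; case: (HC1 i).
have D10 : 0 <= D1 by apply: sumr_ge0 => i _; case: (HC1 i).
have D20 : 0 <= D2 by apply: sumr_ge0 => i _; case: (HC2 i).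
have lin g (h : 'I_d -> 'rV[R]_d -> R) (c : 'I_d -> R) x y : True -> (forall k, `|g k| <= c k) ->
    `|\sum_k g k * (y 0 k - x 0 k)| <= (\sum_k c k) * `|y - x|.
  move=> _ gc; rewrite (le_trans (ler_norm_sum _ _ _))// mulr_suml ler_sum// => k _.
  rewrite normrM ler_pM//.
  by have := ler_mx_norm (y - x) 0 k; rewrite !mxE.
have Lf x y : `|x - y0| <= rho -> `|y - y0| <= rho -> `|f y - f x| <= D1 * `|y - x|.
  move=> xr yr; have [z [Hz ->]] := coord_mvt BU (class_C_pred Cf) xr yr.
  apply: (lin _ (fun=> f)) => // k; apply: (HC1 k).2; exact: (Hz k).1.
have Ldf k x y : `|x - y0| <= rho -> `|y - y0| <= rho ->
    `|'D_(delta_mx 0 k) f y - 'D_(delta_mx 0 k) f x| <= (\sum_l C2 (k, l)) * `|y - x|.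
  move=> xr yr; have [z [Hz ->]] := coord_mvt BU (dC k) xr yr.
  apply: (lin _ (fun=> f)) => // l; apply: (HC2 (k, l)).2; exact: (Hz l).1.
have D2E : D2 = \sum_k \sum_l C2 (k, l).
  by rewrite /D2 pair_bigA /=; apply: eq_bigr => -[].
have C2D k : \sum_l C2 (k, l) <= D2.
  rewrite D2E [leRHS](bigD1 k)//= lerDl; apply: sumr_ge0 => i _; apply: sumr_ge0 => l _.
  by case: (HC2 (i, l)).
exists (C0 + D1 + D2); first by rewrite !addr_ge0.
move=> x y xr yr; split.
- by rewrite (le_trans (HC0 _ xr))// -addrA lerDl addr_ge0.
- by move=> l; rewrite (le_trans ((HC1 l).2 _ xr))// (le_trans (C1D l))// addrAC lerDr addr_ge0.
- rewrite (le_trans (Lf _ _ xr yr))// ler_wpM2r// addrAC lerDr addr_ge0//.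
- move=> l; rewrite (le_trans (Ldf l _ _ xr yr))// ler_wpM2r// (le_trans (C2D l))// lerDr addr_ge0//.
have [z [Hz ->]] := coord_mvt BU (class_C_pred Cf) xr yr.
rewrite -sumrB.
under eq_bigr => k _ do rewrite -mulrBl.
apply: (@le_trans _ _ ((\sum_k (\sum_l C2 (k, l)) * `|y - x|) * `|y - x|)).
  apply: (lin _ (fun=> f)) => // k.
  rewrite (le_trans (Ldf k _ _ xr (Hz k).1))// ler_wpM2l ?(Hz k).2//.
  by apply: sumr_ge0 => l _; case: (HC2 (k, l)).
by rewrite -mulr_suml -mulrA -expr2 -D2E ler_wpM2r ?sqr_ge0// lerDr addr_ge0.
Qed.

(** Lets second-order Taylor remainders be dropped when differentiating along a curve. *)
Lemma der_quadratic (r : R -> R) (t C delta : R) : 0 < delta ->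
  (forall s, `|s - t| < delta -> `|r s| <= C * (s - t) ^+ 2) -> is_derive t 1 r 0.
Proof.
move=> d0 H.
have r0 : r t = 0.
  by apply/normr0_eq0/le_anti; rewrite normr_ge0 andbT (le_trans (H t _))// subrr ?normr0// expr0n mulr0.
suff cv : (fun h : R => h^-1 *: ((r \o shift t) (h *: (1 : R)) - r t)) @ 0^' --> (0 : R).
  by split; [apply/cvg_ex; exists 0|apply/cvg_lim].
apply/cvgrPdist_lt => e e0.
have C1 : 0 < `|C| + 1 by rewrite ltr_wpDl.
have m0 : 0 < Num.min delta (e / (`|C| + 1)) by rewrite lt_min d0 divr_gt0.
exists (Num.min delta (e / (`|C| + 1))) => // h; rewrite /ball_ /= sub0r normrN lt_min => /andP[hd he] hn0.
rewrite sub0r normrN r0 subr0 [h *: 1]mulr1 normrM normfV.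
have := H (h + t); rewrite addrK => /(_ hd) rh.
have h0 : 0 < `|h| by rewrite normr_gt0.
rewrite mulrC ltr_pdivrMr //.
move: he; rewrite ltr_pdivlMr// => he.
rewrite (le_lt_trans rh)// -(real_normK (num_real h)) expr2 mulrA ltr_pM2r //.
rewrite (le_lt_trans _ he)// mulrC ler_wpM2l//.
by rewrite (le_trans (ler_norm _))// lerDl.
Qed.

Lemma der_loc_lip {V : normedModType R} (x : R -> V) (t : R) (v : V) : is_derive t 1 x v ->
  exists2 delta : R, 0 < delta & forall s, `|s - t| < delta -> `|x s - x t| <= (`|v| + 1) * `|s - t|.
Proof.
move=> [/cvg_ex[/= l dx] xv].
have lv : l = v by rewrite -xv; apply/esym/cvg_lim.
move/cvgrPdist_lt: dx => /(_ 1 ltr01)[delta /= d0 H].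
exists delta => // s sd; have [->|st] := eqVneq s t; first by rewrite !subrr !normr0 mulr0.
have := H (s - t); rewrite /= sub0r normrN => /(_ sd); rewrite subr_eq0 => /(_ st).
rewrite [(s - t) *: 1]mulr1 subrK lv => {}H.
have st0 : 0 < `|s - t| by rewrite normr_gt0 subr_eq0.
rewrite -ler_pdivrMr // mulrC -normfV -normrZ.
rewrite -[X in `|X|](subrK v) (le_trans (ler_normD _ _))// addrC lerD2l ltW//.
by rewrite -opprB normrN.
Qed.

Lemma is_derive_rV {V : normedModType R} n (F : V -> 'rV[R]_n) (t v : V) (l : 'rV[R]_n) :
  (forall i, is_derive t v (fun s => F s 0 i) (l 0 i)) -> is_derive t v F l.
Proof.
move=> H; have dF : derivable F t v.
  by apply/derivable_mxP => i j; rewrite ord1; case: (H j).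
split=> //; rewrite derive_mx//; apply/rowP => i; rewrite mxE.
by case: (H i).
Qed.

Lemma is_derive_rV_coord {V : normedModType R} n (F : V -> 'rV[R]_n) (t v : V) (l : 'rV[R]_n) i :
  is_derive t v F l -> is_derive t v (fun s => F s 0 i) (l 0 i).
Proof.
move=> [dF <-]; have /derivable_mxP H := dF.
by apply: DeriveDef => //; rewrite derive_mx// mxE.
Qed.

(** Along a curve differentiable at [t] the quadratic remainder of [C11] is [O((s - t) ^ 2)], so it
    has derivative 0 and only the linear part contributes. *)
Lemma C11_chain y0 rho C f df (x : R -> 'rV[R]_d) (t : R) (v : 'rV[R]_d) :
  C11 y0 rho C f df -> `|x t - y0| < rho -> is_derive t 1 x v ->
  is_derive t 1 (f \o x) (\sum_l df l (x t) * v 0 l).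
Proof.
move=> Cf xt dx.
have [delta d0 Hd] := der_loc_lip dx.
have cx := is_derive_continuous dx.
have : nbhs t [set s | `|x s - y0| < rho].
  pose e := rho - `|x t - y0|; have e0 : 0 < e by rewrite subr_gt0.
  move/cvgrPdist_lt: cx => /(_ e e0); apply: filterS => s Hs /=.
  rewrite -[X in `|X|](subrKA (x t)) (le_lt_trans (ler_normD _ _))// -ltrBrDr.
  by rewrite distrC.
move=> /nbhs_ballP[e2 /= e20 He2].
pose r s := f (x s) - f (x t) - \sum_l df l (x t) * (x s 0 l - x t 0 l).
have dr : is_derive t 1 r 0.
  have m0 : 0 < Num.min delta e2 by rewrite lt_min d0.
  apply: (@der_quadratic r t (C * (`|v| + 1) ^+ 2) _ m0) => s; rewrite lt_min => /andP[sd se].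
  have xs : `|x s - y0| < rho by apply: He2; rewrite -ball_normE /= distrC.
  have [C0 _ _ _ H] := Cf _ _ (ltW xt) (ltW xs).
  have C00 : 0 <= C by apply: le_trans C0.
  rewrite (le_trans H)// -mulrA ler_wpM2l// -(real_normK (num_real (s - t))) -exprMn.
  by rewrite ler_sqr ?nnegrE ?mulr_ge0// ?addr_ge0// Hd.
have -> : f \o x = fun s => r s + (f (x t) + \sum_l df l (x t) * (x s 0 l - x t 0 l)).
  by apply: funext => s /=; rewrite /r; ring.
have dl l := derMl (df l (x t)) (derB (is_derive_rV_coord l dx) (dercst t (x t 0 l))).
apply: (der_eq (derD dr (derD (dercst t (f (x t))) (dersum dl)))).
by rewrite !add0r; apply: eq_bigr => l _; rewrite subr0.
Qed.

Lemma C11_dir y0 rho C f df x v : C11 y0 rho C f df -> `|x - y0| < rho ->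
  is_derive x v f (\sum_l df l x * v 0 l).
Proof.
move=> Cf xr.
have dl : is_derive (0 : R) 1 (fun s : R => x + s *: v) v.
  apply: is_derive_rV => i.
  have -> : (fun s : R => (x + s *: v) 0 i) = (fun s => x 0 i + v 0 i * s).
    by apply: funext => s; rewrite !mxE mulrC.
  by apply: (der_eq (derD (dercst _ _) (derMl _ (derid _)))); rewrite add0r mulr1.
have := @C11_chain y0 rho C f df (fun s => x + s *: v) 0 v Cf.
rewrite scale0r addr0 => /(_ xr dl) H.
have E : (fun h : R => h^-1 *: (((f \o (fun s : R => x + s *: v)) \o shift 0) (h *: (1 : R)) - (f \o (fun s : R => x + s *: v)) 0))
    = (fun h : R => h^-1 *: ((f \o shift x) (h *: v) - f x)).
  apply: funext => h /=; rewrite scale0r !addr0; congr (_ *: (f _ - _)).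
  by rewrite [h *: 1]mulr1 addrC.
by case: H => H1 H2; move: H1 H2; rewrite /derivable /derive E => H1 H2; split.
Qed.

End C11_estimates.

(** * Uniform first-order expansions and their products *)

Section jets.
Context {R : realType} {Q : Type} (D : Q -> Prop).

Definition ubd (x : Q -> R) := exists2 A : R, 0 <= A & forall q, D q -> `|x q| <= A.

Lemma ubd_cst c : ubd (fun=> c).
Proof. by exists `|c|. Qed.

Lemma ubd_add x y : ubd x -> ubd y -> ubd (fun q => x q + y q).
Proof.
move=> [A A0 HA] [B B0 HB]; exists (A + B); first exact: addr_ge0.
by move=> q Dq; rewrite (le_trans (ler_normD _ _))// lerD ?HA ?HB.
Qed.

Lemma ubd_mul x y : ubd x -> ubd y -> ubd (fun q => x q * y q).
Proof.
move=> [A A0 HA] [B B0 HB]; exists (A * B); first exact: mulr_ge0.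
by move=> q Dq; rewrite normrM ler_pM ?HA ?HB.
Qed.

Lemma ubd_sum m (x : 'I_m -> Q -> R) : (forall i, ubd (x i)) -> ubd (fun q => \sum_i x i q).
Proof.
move=> H.
have /choice[A HA] i : exists A : R, 0 <= A /\ forall q, D q -> `|x i q| <= A.
  by have [A A0 HA] := H i; exists A.
exists (\sum_i A i); first by apply: sumr_ge0 => i _; case: (HA i).
move=> q Dq; rewrite (le_trans (ler_norm_sum _ _ _))// ler_sum// => i _.
exact: (HA i).2.
Qed.

Variables (r : Q -> R) (r0 : R).
Hypothesis r_bd : forall q, D q -> 0 <= r q <= r0.

(* First-order expansions [x1 = x0 + dx + O(r ^ 2)], uniformly on [D]; they can be multiplied. *)
Definition ujet (x0 x1 dx : Q -> R) := exists2 A : R, 0 <= A & forall q, D q ->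
  [/\ `|x0 q| <= A, `|dx q| <= A * r q & `|x1 q - x0 q - dx q| <= A * r q ^+ 2].

Lemma ujet_ubd x0 x1 dx : ujet x0 x1 dx -> ubd x0.
Proof. by move=> [A A0 HA]; exists A => // q /HA[]. Qed.

Lemma ujet_cst c : ujet (fun=> c) (fun=> c) (fun=> 0).
Proof.
exists `|c| => // q Dq; have /andP[r1 _] := r_bd Dq.
by rewrite subrr subr0 normr0; split => //; rewrite mulr_ge0// ?exprn_ge0.
Qed.

Lemma ujet_add x0 x1 dx y0 y1 dy : ujet x0 x1 dx -> ujet y0 y1 dy ->
  ujet (fun q => x0 q + y0 q) (fun q => x1 q + y1 q) (fun q => dx q + dy q).
Proof.
move=> [A A0 HA] [B B0 HB]; exists (A + B); first exact: addr_ge0.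
move=> q Dq; have [a1 a2 a3] := HA q Dq; have [b1 b2 b3] := HB q Dq.
rewrite !mulrDl; split; try by rewrite (le_trans (ler_normD _ _))// lerD.
rewrite (_ : _ - _ - _ = (x1 q - x0 q - dx q) + (y1 q - y0 q - dy q)); last by ring.
by rewrite (le_trans (ler_normD _ _))// lerD.
Qed.

Lemma ujet_mul x0 x1 dx y0 y1 dy : ujet x0 x1 dx -> ujet y0 y1 dy ->
  ujet (fun q => x0 q * y0 q) (fun q => x1 q * y1 q) (fun q => dx q * y0 q + x0 q * dy q).
Proof.
(* Up to the factors [A] and [B], the [2] pays for the two second-order remainders and
   [(1 + |r0|) ^ 2] for the product of the two increments, each at most [(1 + |r0|) r]. *)
move=> [A A0 HA] [B B0 HB]; exists (A * B * (2 + (1 + `|r0|) ^+ 2)).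
  by rewrite !mulr_ge0// addr_ge0// sqr_ge0.
move=> q Dq; have [a1 a2 a3] := HA q Dq; have [b1 b2 b3] := HB q Dq.
have /andP[r1 r2] := r_bd Dq; have AB0 : 0 <= A * B by exact: mulr_ge0.
have r00 : 1 <= (1 + `|r0|) ^+ 2 by rewrite exprn_ege1// lerDl.
have D1 : `|x1 q - x0 q| <= A * (1 + `|r0|) * r q.
  rewrite -[X in `|X|](subrK (dx q)) (le_trans (ler_normD _ _))//.
  apply: (le_trans (lerD a3 a2)); rewrite expr2 mulrA -mulrDl ler_wpM2r// -[X in _ + X]mulr1 -mulrDr ler_wpM2l//.
  by rewrite addrC lerD2l (le_trans r2)// ler_norm.
have D2 : `|y1 q - y0 q| <= B * (1 + `|r0|) * r q.
  rewrite -[X in `|X|](subrK (dy q)) (le_trans (ler_normD _ _))//.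
  apply: (le_trans (lerD b3 b2)); rewrite expr2 mulrA -mulrDl ler_wpM2r// -[X in _ + X]mulr1 -mulrDr ler_wpM2l//.
  by rewrite addrC lerD2l (le_trans r2)// ler_norm.
split.
- rewrite normrM (le_trans (ler_pM _ _ a1 b1))// ler_peMr//.
  by rewrite (le_trans r00)// lerDr.
- rewrite (le_trans (ler_normD _ _))// !normrM.
  apply: (@le_trans _ _ (A * r q * B + A * (B * r q))).
    by apply: lerD; apply: ler_pM.
  rewrite (_ : _ + _ = A * B * 2 * r q); last by ring.
  by rewrite ler_wpM2r// ler_wpM2l// lerDl sqr_ge0.
rewrite (_ : _ - _ - _ = (x1 q - x0 q - dx q) * y0 q + x0 q * (y1 q - y0 q - dy q) +
  (x1 q - x0 q) * (y1 q - y0 q)); last by ring.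
rewrite (le_trans (ler_normD _ _))//.
apply: (@le_trans _ _ ((A * r q ^+ 2 * B + A * (B * r q ^+ 2)) +
    A * (1 + `|r0|) * r q * (B * (1 + `|r0|) * r q))).
  apply: lerD; last by rewrite normrM; apply: ler_pM.
  rewrite (le_trans (ler_normD _ _))// !normrM; apply: lerD; apply: ler_pM => //.
by rewrite le_eqVlt; apply/orP; left; apply/eqP; ring.
Qed.

Lemma ujet_sum m (x0 x1 dx : 'I_m -> Q -> R) : (forall i, ujet (x0 i) (x1 i) (dx i)) ->
  ujet (fun q => \sum_i x0 i q) (fun q => \sum_i x1 i q) (fun q => \sum_i dx i q).
Proof.
elim: m x0 x1 dx => [|m IH] x0 x1 dx H.
  have [A A0 HA] := ujet_cst 0; exists A => // q Dq; rewrite !big_ord0; exact: HA.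
have [A A0 HA] := ujet_add (IH _ _ _ (fun i => H (widen_ord (leqnSn m) i))) (H ord_max).
by exists A => // q Dq; rewrite !big_ord_recr/=; exact: HA.
Qed.

Lemma ujet_eq x0 x1 dx dx' : (forall q, D q -> dx q = dx' q) ->
  ujet x0 x1 dx -> ujet x0 x1 dx'.
Proof. by move=> E [A A0 HA]; exists A => // q Dq; rewrite -E//; exact: HA. Qed.

End jets.

(** * The Euclidean pairing, compared with the sup norm of row vectors *)

Definition dot {R : realType} {d : nat} (u v : 'rV[R]_d) : R := \sum_l u 0 l * v 0 l.

Section dot_theory.
Context {R : realType} {d : nat}.
Implicit Types u v w : 'rV[R]_d.

Lemma dotC u v : dot u v = dot v u.
Proof. by apply: eq_bigr => l _; rewrite mulrC. Qed.

Lemma dotDl u v w : dot (u + v) w = dot u w + dot v w.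
Proof. by rewrite -big_split; apply: eq_bigr => l _; rewrite mxE mulrDl. Qed.

Lemma dotDr u v w : dot u (v + w) = dot u v + dot u w.
Proof. by rewrite !(dotC u) dotDl. Qed.

Lemma dotZl c u v : dot (c *: u) v = c * dot u v.
Proof. by rewrite mulr_sumr; apply: eq_bigr => l _; rewrite mxE mulrA. Qed.

Lemma dotZr c u v : dot u (c *: v) = c * dot u v.
Proof. by rewrite !(dotC u) dotZl. Qed.

Lemma dotNl u v : dot (- u) v = - dot u v.
Proof. by rewrite -scaleN1r dotZl mulN1r. Qed.

Lemma dotNr u v : dot u (- v) = - dot u v.
Proof. by rewrite dotC dotNl dotC. Qed.

Lemma dotBl u v w : dot (u - v) w = dot u w - dot v w.
Proof. by rewrite dotDl dotNl. Qed.

Lemma dotBr u v w : dot u (v - w) = dot u v - dot u w.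
Proof. by rewrite dotDr dotNr. Qed.

Lemma dot_sumr I (s : seq I) (P : pred I) u (F : I -> 'rV[R]_d) :
  dot u (\sum_(i <- s | P i) F i) = \sum_(i <- s | P i) dot u (F i).
Proof.
rewrite /dot exchange_big; apply: eq_bigr => l _ /=.
by rewrite summxE mulr_sumr.
Qed.

Lemma norm_dot u v : `|dot u v| <= d%:R * (`|u| * `|v|).
Proof.
rewrite (le_trans (ler_norm_sum _ _ _))//.
rewrite mulr_natl -[X in _ *+ X]card_ord -sumr_const; apply: ler_sum => l _.
by rewrite normrM ler_pM// ler_mx_norm.
Qed.

Lemma dot_ge0 u : 0 <= dot u u.
Proof. by apply: sumr_ge0 => l _; rewrite -expr2 sqr_ge0. Qed.

Lemma dot_norm u : `|u| ^+ 2 <= dot u u.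
Proof.
have [->|u0] := eqVneq u 0; first by rewrite normr0 expr0n dot_ge0.
have : exists l, `|u 0 l| = `|u|.
  apply: contrapT => /forallNP H.
  have lt l : `|u 0 l| < `|u| by rewrite lt_neqAle ler_mx_norm andbT; apply/eqP.
  pose m := \big[Num.max/0]_l `|u 0 l|.
  have : `|u| <= m.
    apply: mx_norm_le; first exact: bigmax_ge_id.
    by move=> i l; rewrite ord1; exact: le_bigmax.
  rewrite leNgt => /negP; apply; apply/bigmax_ltP; split => //.
  by rewrite normr_gt0.
move=> [l <-]; rewrite real_normK ?num_real// /dot (bigD1 l)//= -expr2 lerDl.
by apply: sumr_ge0 => i _; rewrite -expr2 sqr_ge0.
Qed.

End dot_theory.

(** * The sub-Riemannian Hamiltonian: Taylor expansion, bounds and conservation *)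

Section hamiltonian.
Context {R : realType} {n d : nat} (b : 'M[R]_(n, d)) (e : 'rV[R]_d).
Context (K : 'I_n -> 'I_n -> 'rV[R]_d -> R) (dK : 'I_n -> 'I_n -> 'I_d -> 'rV[R]_d -> R).
Context (a : 'I_n -> 'rV[R]_d -> R) (da : 'I_n -> 'I_d -> 'rV[R]_d -> R).
Implicit Types (y p : 'rV[R]_d).

(* Sub-Riemannian Hamiltonian of the distribution spanned by the fields [b_i + a_i e], whose
   Gram matrix is the inverse of [K]; [dK] and [da] are the partial derivatives of [K], [a]. *)
Definition hframe y i : 'rV[R]_d := row i b + a i y *: e.
Definition hmom y p j : R := dot p (row j b) + a j y * dot p e.
Definition hctrl y p i : R := \sum_j K i j y * hmom y p j.
Definition hvel y p : 'rV[R]_d := \sum_i hctrl y p i *: hframe y i.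
Definition hfrc y p l : R :=
  2^-1 * (\sum_i \sum_j dK i j l y * hmom y p i * hmom y p j) +
  dot p e * \sum_j hctrl y p j * da j l y.
Definition ham y p : R := 2^-1 * \sum_i \sum_j K i j y * hmom y p i * hmom y p j.

Definition ham_sol (y p : R -> 'rV[R]_d) := forall t : R, 0 <= t <= 1 ->
  is_derive t 1 y (hvel (y t) (p t)) /\ is_derive t 1 p (- \row_l hfrc (y t) (p t) l).

Lemma hmom_frame y p j : hmom y p j = dot p (hframe y j).
Proof. by rewrite /hmom /hframe dotDr dotZr. Qed.

Lemma ham_ctrl y p : ham y p = 2^-1 * \sum_i hctrl y p i * hmom y p i.
Proof.
congr (_ * _); apply: eq_bigr => i _; rewrite mulr_suml; apply: eq_bigr => j _.
by ring.
Qed.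

(** Euler's identity: [ham] is quadratic in [p], and [hvel] is its gradient in [p]. *)
Lemma dot_hvel y p : dot p (hvel y p) = 2 * ham y p.
Proof.
rewrite ham_ctrl mulrA divff ?pnatr_eq0// mul1r dot_sumr; apply: eq_bigr => i _.
by rewrite dotZr hmom_frame.
Qed.

Variables (y0 : 'rV[R]_d) (rho : R).
Hypothesis K_C11 : forall i j, exists2 C : R, 0 <= C & C11 y0 rho C (K i j) (dK i j).
Hypothesis a_C11 : forall j, exists2 C : R, 0 <= C & C11 y0 rho C (a j) (da j).
Hypothesis K_sym : forall i j y, `|y - y0| <= rho -> K i j y = K j i y.

Let Q : Type := ('rV[R]_d * 'rV[R]_d * 'rV[R]_d * 'rV[R]_d)%type.
Let D Cp (q : Q) := [/\ `|q.1.1.1 - y0| <= rho, `|q.1.1.2 - y0| <= rho,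
  `|q.1.2| <= Cp & `|q.2| <= Cp].
Let r (q : Q) := `|q.1.1.2 - q.1.1.1| + `|q.2 - q.1.2|.

Let r_bd Cp q : D Cp q -> 0 <= r q <= 2 * rho + 2 * Cp.
Proof.
case: q => [[[y y'] p] p'] [/= h1 h2 h3 h4]; rewrite /r /= addr_ge0//= lerD//.
  rewrite -(subrKA y0) (le_trans (ler_normD _ _))// mulr_natl mulr2n lerD//.
  by rewrite distrC.
by rewrite (le_trans (ler_normB _ _))// mulr_natl mulr2n lerD.
Qed.

Let jC11 Cp f df : (exists2 C : R, 0 <= C & C11 y0 rho C f df) ->
  ujet (D Cp) r (fun q => f q.1.1.1) (fun q => f q.1.1.2)
    (fun q => \sum_l df l q.1.1.1 * (q.1.1.2 0 l - q.1.1.1 0 l)).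
Proof.
move=> [C C0 HC]; exists (C + d%:R * C); first by rewrite addr_ge0// mulr_ge0.
move=> [[[y y'] p] p'] [/= h1 h2 h3 h4]; have [c1 c2 c3 c4 c5] := HC _ _ h1 h2.
have rw : `|y' - y| <= r (y, y', p, p') by rewrite /r/= lerDl.
have dC0 : 0 <= d%:R * C by rewrite mulr_ge0.
split.
- by rewrite (le_trans c1)// lerDl.
- apply: (@le_trans _ _ (d%:R * C * `|y' - y|)); last first.
    by rewrite ler_pM// lerDr.
  rewrite (le_trans (ler_norm_sum _ _ _))//.
  rewrite -mulrA mulr_natl -[X in _ *+ X]card_ord -sumr_const; apply: ler_sum => l _.
  by rewrite normrM ler_pM//; have := ler_mx_norm (y' - y) 0 l; rewrite !mxE.
rewrite (le_trans c5)// ler_pM// ?exprn_ge0// ?lerDl// ler_sqr ?nnegrE//.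
by rewrite (le_trans _ rw).
Qed.

Let jdot Cp v : 0 <= Cp -> ujet (D Cp) r (fun q => dot q.1.2 v) (fun q => dot q.2 v)
    (fun q => dot (q.2 - q.1.2) v).
Proof.
move=> Cp0; exists (d%:R * (Cp * `|v|) + d%:R * `|v|); first by rewrite addr_ge0// !mulr_ge0.
move=> [[[y y'] p] p'] [/= h1 h2 h3 h4].
have rw : `|p' - p| <= r (y, y', p, p') by rewrite /r/= lerDr.
split.
- rewrite (le_trans (norm_dot _ _))//.
  apply: (@le_trans _ _ (d%:R * (Cp * `|v|))); last by rewrite lerDl mulr_ge0.
  by rewrite ler_wpM2l// ler_wpM2r.
- rewrite (le_trans (norm_dot _ _))//.
  rewrite mulrDl; apply: (@le_trans _ _ (d%:R * `|v| * r (y, y', p, p'))).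
    by rewrite -mulrA ler_wpM2l// mulrC ler_wpM2l.
  by rewrite lerDr !mulr_ge0// (le_trans _ rw).
rewrite dotBl subrr normr0; apply: mulr_ge0; last exact: sqr_ge0.
by apply: addr_ge0; rewrite !mulr_ge0.
Qed.

Let jmom Cp j : 0 <= Cp -> ujet (D Cp) r (fun q => hmom q.1.1.1 q.1.2 j)
    (fun q => hmom q.1.1.2 q.2 j)
    (fun q => dot (q.2 - q.1.2) (hframe q.1.1.1 j) +
      dot q.1.2 e * \sum_l da j l q.1.1.1 * (q.1.1.2 0 l - q.1.1.1 0 l)).
Proof.
move=> Cp0; have J := ujet_add (jdot (row j b) Cp0)
  (ujet_mul (@r_bd Cp) (jC11 Cp (a_C11 j)) (jdot e Cp0)).
by apply: ujet_eq J => q _; rewrite /hframe dotDr dotZr; ring.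
Qed.

Let jctrl Cp i : 0 <= Cp -> ubd (D Cp) (fun q => hctrl q.1.1.1 q.1.2 i).
Proof.
move=> Cp0; apply: ubd_sum => j; apply: ubd_mul.
  exact: ujet_ubd (jC11 Cp (K_C11 i j)).
exact: ujet_ubd (jmom j Cp0).
Qed.

(** [ham] is a polynomial in quantities that have first-order expansions, so the remainder estimate
    comes with the product rule of jets. What has to be checked is that the first-order part is the
    one given by [hfrc] and [hvel]; the symmetry of [K] merges the variations of the two momentum
    factors. *)
Lemma ham_taylor Cp : 0 <= Cp -> exists2 C : R, 0 <= C & forall y y' p p',
  `|y - y0| <= rho -> `|y' - y0| <= rho -> `|p| <= Cp -> `|p'| <= Cp ->
  `|ham y' p' - ham y p -
    (\sum_l hfrc y p l * (y' 0 l - y 0 l) + dot (hvel y p) (p' - p))|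
  <= C * (`|y' - y| + `|p' - p|) ^+ 2.
Proof.
move=> Cp0.
have J : ujet (D Cp) r (fun q => ham q.1.1.1 q.1.2) (fun q => ham q.1.1.2 q.2)
    (fun q => \sum_l hfrc q.1.1.1 q.1.2 l * (q.1.1.2 0 l - q.1.1.1 0 l) +
      dot (hvel q.1.1.1 q.1.2) (q.2 - q.1.2)).
  have J1 i j := ujet_mul (@r_bd Cp) (ujet_mul (@r_bd Cp) (jC11 Cp (K_C11 i j)) (jmom i Cp0)) (jmom j Cp0).
  have J2 := ujet_mul (@r_bd Cp) (ujet_cst (@r_bd Cp) 2^-1)
    (ujet_sum (@r_bd Cp) (fun i => ujet_sum (@r_bd Cp) (J1 i))).
  apply: ujet_eq J2 => -[[[y y'] p] p'] [/= h1 h2 h3 h4].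
  rewrite mul0r add0r.
  set w := fun l => y' 0 l - y 0 l; set dp := p' - p.
  (* The first-order variation of [hmom y p i]. *)
  pose dP i := dot dp (hframe y i) + dot p e * \sum_l da i l y * w l.
  have -> : \sum_l hfrc y p l * w l = 2^-1 * (\sum_i \sum_j (\sum_l dK i j l y * w l) * hmom y p i * hmom y p j)
      + dot p e * \sum_i hctrl y p i * \sum_l da i l y * w l.
    rewrite mulr_sumr [X in _ = X + _](_ : _ = \sum_l 2^-1 * (\sum_i \sum_j dK i j l y * hmom y p i * hmom y p j) * w l).
      rewrite [X in _ = _ + X](_ : _ = \sum_l dot p e * (\sum_j hctrl y p j * da j l y) * w l).
        by rewrite -big_split; apply: eq_bigr => l _; rewrite /hfrc mulrDl.
      under [RHS]eq_bigr => l _ do rewrite -mulrA mulr_suml.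
      under [LHS]eq_bigr => i _ do rewrite !mulr_sumr.
      rewrite exchange_big; apply: eq_bigr => l _ /=.
      by rewrite mulr_sumr; apply: eq_bigr => i _; ring.
    rewrite mulr_sumr.
    under [RHS]eq_bigr => l _ do rewrite mulrAC -mulrA mulr_sumr mulr_sumr.
    rewrite exchange_big; apply: eq_bigr => i _ /=.
    rewrite mulr_sumr.
    under [RHS]eq_bigr => l _ do rewrite mulr_sumr mulr_sumr.
    rewrite exchange_big; apply: eq_bigr => j _ /=.
    rewrite mulr_suml mulr_suml mulr_sumr; apply: eq_bigr => l _.
    by ring.
  have -> : dot (hvel y p) dp = \sum_i hctrl y p i * dot dp (hframe y i).
    by rewrite dotC dot_sumr; apply: eq_bigr => i _; rewrite dotZr.
  have E1 : \sum_i hctrl y p i * dP i = \sum_i hctrl y p i * dot dp (hframe y i) +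
      dot p e * \sum_i hctrl y p i * \sum_l da i l y * w l.
    by rewrite mulr_sumr -big_split; apply: eq_bigr => i _; rewrite /dP /=; ring.
  have E2 : \sum_i \sum_j K i j y * hmom y p i * dP j = \sum_i hctrl y p i * dP i.
    rewrite exchange_big; apply: eq_bigr => j _ /=; rewrite mulr_suml; apply: eq_bigr => i _.
    by rewrite (K_sym i j h1).
  have E3 : \sum_i \sum_j K i j y * dP i * hmom y p j = \sum_i hctrl y p i * dP i.
    by apply: eq_bigr => i _ /=; rewrite mulr_suml; apply: eq_bigr => j _; ring.
  transitivity (2^-1 * (\sum_i \sum_j (\sum_l dK i j l y * w l) * hmom y p i * hmom y p j) +
     2^-1 * (\sum_i \sum_j K i j y * dP i * hmom y p j + \sum_i \sum_j K i j y * hmom y p i * dP j)).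
    rewrite -mulrDr; congr (_ * _); rewrite -!big_split; apply: eq_bigr => i _ /=.
    rewrite -!big_split; apply: eq_bigr => j _ /=; rewrite -/w -/dp -/(dP i) -/(dP j).
    by ring.
  by rewrite E2 E3 E1; field.
have [C C0 HC] := J; exists C => // y y' p p' h1 h2 h3 h4.
by have [_ _] := HC (y, y', p, p') (And4 h1 h2 h3 h4).
Qed.

Lemma hvel_bounded Cp : 0 <= Cp -> exists2 C : R, 0 <= C & forall y p,
  `|y - y0| <= rho -> `|p| <= Cp -> `|hvel y p| <= C.
Proof.
move=> Cp0.
have H l : ubd (D Cp) (fun q => hvel q.1.1.1 q.1.2 0 l).
  have H1 : ubd (D Cp) (fun q => \sum_i hctrl q.1.1.1 q.1.2 i * (b i l + a i q.1.1.1 * e 0 l)).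
    apply: ubd_sum => i; apply: ubd_mul; first exact: jctrl.
    apply: ubd_add; first exact: ubd_cst.
    by apply: ubd_mul; [exact: ujet_ubd (jC11 Cp (a_C11 i))|exact: ubd_cst].
  have [A A0 HA] := H1; exists A => // q Dq; rewrite /hvel summxE.
  rewrite (_ : \sum_i _ = \sum_i hctrl q.1.1.1 q.1.2 i * (b i l + a i q.1.1.1 * e 0 l)); first exact: HA.
  by apply: eq_bigr => i _; rewrite !mxE.
have /choice[A HA] l : exists A : R, 0 <= A /\ forall q, D Cp q -> `|hvel q.1.1.1 q.1.2 0 l| <= A.
  by have [A A0 HA] := H l; exists A.
exists (\sum_l A l); first by apply: sumr_ge0 => l _; case: (HA l).
move=> y p h1 h2; apply: mx_norm_le; first by apply: sumr_ge0 => l _; case: (HA l).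
move=> i l; rewrite ord1.
rewrite (le_trans ((HA l).2 (y, y, p, p) (And4 h1 h1 h2 h2)))// (bigD1 l)//= lerDl.
by apply: sumr_ge0 => k _; case: (HA k).
Qed.

Lemma hfrc_bounded Cp : 0 <= Cp -> exists2 C : R, 0 <= C & forall y p,
  `|y - y0| <= rho -> `|p| <= Cp -> `|\row_l hfrc y p l| <= C.
Proof.
move=> Cp0.
have bC f df l : (exists2 C : R, 0 <= C & C11 y0 rho C f df) -> ubd (D Cp) (fun q => df l q.1.1.1).
  by move=> [C C0 HC]; exists C => // q [h1 _ _ _]; have [_ + _ _ _] := HC _ _ h1 h1; exact.
have H l : ubd (D Cp) (fun q => hfrc q.1.1.1 q.1.2 l).
  apply: ubd_add; apply: ubd_mul; first exact: ubd_cst.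
  - apply: ubd_sum => i; apply: ubd_sum => j.
    apply: ubd_mul; last exact: ujet_ubd (jmom j Cp0).
    by apply: ubd_mul; [exact: bC (K_C11 i j)|exact: ujet_ubd (jmom i Cp0)].
  - exact: ujet_ubd (jdot e Cp0).
  - by apply: ubd_sum => j; apply: ubd_mul; [exact: jctrl|exact: bC (a_C11 j)].
have /choice[A HA] l : exists A : R, 0 <= A /\ forall q, D Cp q -> `|hfrc q.1.1.1 q.1.2 l| <= A.
  by have [A A0 HA] := H l; exists A.
exists (\sum_l A l); first by apply: sumr_ge0 => l _; case: (HA l).
move=> y p h1 h2; apply: mx_norm_le; first by apply: sumr_ge0 => l _; case: (HA l).
move=> i l; rewrite mxE.
rewrite (le_trans ((HA l).2 (y, y, p, p) (And4 h1 h1 h2 h2)))// (bigD1 l)//= lerDl.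
by apply: sumr_ge0 => k _; case: (HA k).
Qed.

(** Along a solution the first-order terms of [ham_taylor] cancel by the antisymmetry of Hamilton's
    equations, and the remainder is quadratic in time, so the derivative of [ham] vanishes. *)
Lemma ham_conserved (y p : R -> 'rV[R]_d) : ham_sol y p -> (forall t : R, 0 <= t <= 1 -> `|y t - y0| < rho) ->
  forall t : R, 0 <= t <= 1 -> ham (y t) (p t) = ham (y 0) (p 0).
Proof.
move=> sol yb.
have dH (t : R) : 0 <= t <= 1 -> is_derive t 1 (fun t => ham (y t) (p t)) 0.
  move=> t01; have [dy dp] := sol t t01.
  have [d1 d10 H1] := der_loc_lip dy; have [d2 d20 H2] := der_loc_lip dp.
  set v := hvel _ _ in dy H1; set f := \row_l _ in dp H2.
  pose Cp := `|p t| + (`|- f| + 1) * d2.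
  have Cp0 : 0 <= Cp by rewrite addr_ge0// mulr_ge0// ?addr_ge0// ltW.
  have [C C0 HC] := ham_taylor Cp0.
  have : nbhs t [set s | `|y s - y0| < rho].
    pose ep := rho - `|y t - y0|; have e0 : 0 < ep by rewrite subr_gt0 yb.
    move/cvgrPdist_lt: (is_derive_continuous dy) => /(_ ep e0); apply: filterS => s Hs /=.
    rewrite -[X in `|X|](subrKA (y t)) (le_lt_trans (ler_normD _ _))// -ltrBrDr.
    by rewrite distrC.
  move=> /nbhs_ballP[d3 /= d30 H3].
  pose rm s := ham (y s) (p s) - ham (y t) (p t) -
    (\sum_l hfrc (y t) (p t) l * (y s 0 l - y t 0 l) + dot (hvel (y t) (p t)) (p s - p t)).
  have drm : is_derive t 1 rm 0.
    have m0 : 0 < Num.min d1 (Num.min d2 d3) by rewrite !lt_min d10 d20.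
    apply: (@der_quadratic _ rm t (C * (`|v| + 1 + (`|- f| + 1)) ^+ 2) _ m0) => s.
    rewrite !lt_min => /and3P[s1 s2 s3].
    have ys : `|y s - y0| < rho by apply: H3; rewrite -ball_normE /= distrC.
    rewrite (le_trans (HC _ _ _ _ (ltW (yb t t01)) (ltW ys) _ _))//.
    - by rewrite lerDl mulr_ge0// ?addr_ge0// ltW.
    - rewrite -[X in `|X|](subrK (p t)) (le_trans (ler_normD _ _))// addrC lerD2l.
      by rewrite (le_trans (H2 _ s2))// ler_wpM2l// ltW.
    rewrite -mulrA ler_wpM2l// -(real_normK (num_real (s - t))) -exprMn.
    rewrite ler_sqr ?nnegrE ?addr_ge0// ?mulr_ge0// ?addr_ge0//.
    by rewrite mulrDl lerD ?H1 ?H2.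
  have -> : (fun s => ham (y s) (p s)) = fun s => rm s + (ham (y t) (p t) +
    (\sum_l hfrc (y t) (p t) l * (y s 0 l - y t 0 l) + \sum_l hvel (y t) (p t) 0 l * (p s 0 l - p t 0 l))).
    apply: funext => s; rewrite /rm.
    have -> : \sum_l hvel (y t) (p t) 0 l * (p s 0 l - p t 0 l) = dot (hvel (y t) (p t)) (p s - p t).
      by apply: eq_bigr => l _; rewrite !mxE.
    by ring.
  have D1 l := derMl (hfrc (y t) (p t) l) (derB (is_derive_rV_coord l dy) (dercst t (y t 0 l))).
  have D2 l := derMl (hvel (y t) (p t) 0 l) (derB (is_derive_rV_coord l dp) (dercst t (p t 0 l))).
  apply: (der_eq (derD drm (derD (dercst t (ham (y t) (p t))) (derD (dersum D1) (dersum D2))))).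
  rewrite !add0r -big_split big1// => l _ /=; rewrite !mxE !subr0 -/v.
  by rewrite mulrN mulrC subrr.
move=> t t01; have [t0 t1] := andP t01.
have [->//|tn0] := eqVneq t 0.
have t_gt0 : 0 < t by rewrite lt_neqAle eq_sym tn0.
have [||c _] := @MVT _ (fun t => ham (y t) (p t)) (fun=> 0) 0 t t_gt0.
- by move=> s; rewrite in_itv/= => /andP[s0 s1]; apply: dH; rewrite ltW//= (le_trans (ltW s1)).
- apply: derivable_within_continuous => s; rewrite in_itv/= => /andP[s0 s1].
  by have [] := dH s; rewrite ?s0 ?(le_trans s1).
by rewrite mul0r => /eqP; rewrite subr_eq0 => /eqP.
Qed.

End hamiltonian.

(** * Lipschitz functions: bounds from derivatives, sums and products *)

Section lip_of_der.
Context {R : realType}.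

Lemma lip_seg_der (f df : R -> R) (L : R) : (forall t : R, 0 <= t <= 1 -> is_derive t 1 f (df t)) ->
  (forall t : R, 0 <= t <= 1 -> `|df t| <= L) -> lip_seg L 0 1 f.
Proof.
move=> Df bd s t s0 st t1.
have [||c] := @MVT_segment _ f df s t st.
- move=> x; rewrite in_itv/= => /andP[x0 x1]; apply: Df.
  by rewrite (le_trans s0 (ltW x0)) (le_trans (ltW x1) t1).
- apply: derivable_within_continuous => x; rewrite in_itv/= => /andP[x0 x1].
  by have [] := Df x; rewrite ?(le_trans s0 x0) ?(le_trans x1 t1).
rewrite in_itv/= => /andP[x0 x1] ->; rewrite normrM (ger0_norm (_ : 0 <= t - s)) ?subr_ge0//.
by rewrite ler_wpM2r ?subr_ge0// bd// (le_trans s0 x0) (le_trans x1 t1).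
Qed.

Lemma lip_seg_der_rV m (f df : R -> 'rV[R]_m) (L : R) :
  (forall t : R, 0 <= t <= 1 -> is_derive t 1 f (df t)) ->
  (forall t : R, 0 <= t <= 1 -> `|df t| <= L) -> lip_seg L 0 1 f.
Proof.
move=> Df bd s t s0 st t1.
have L0 : 0 <= L by apply: le_trans (bd 0 _); rewrite // lexx ler01.
apply: mx_norm_le; first by rewrite mulr_ge0// subr_ge0.
move=> i j; rewrite ord1 !mxE; apply: (@lip_seg_der (fun t => f t 0 j) (fun t => df t 0 j)) => //.
  by move=> x x01; apply: is_derive_rV_coord; exact: Df.
by move=> x x01; rewrite (le_trans (ler_mx_norm _ _ _))// bd.
Qed.

Lemma lip_segD {V : normedModType R} (K L a b : R) (f g : R -> V) :
  lip_seg K a b f -> lip_seg L a b g -> lip_seg (K + L) a b (fun t => f t + g t).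
Proof.
move=> lf lg s t h1 h2 h3; rewrite opprD addrACA (le_trans (ler_normD _ _))// mulrDl lerD//.
- exact: lf.
- exact: lg.
Qed.

Lemma lip_segM (K L A B a b : R) (f g : R -> R) :
  (forall t, a <= t <= b -> `|f t| <= A) -> (forall t, a <= t <= b -> `|g t| <= B) ->
  lip_seg K a b f -> lip_seg L a b g -> lip_seg (K * B + A * L) a b (fun t => f t * g t).
Proof.
move=> fA gB lf lg s t h1 h2 h3.
have tab : a <= t <= b by rewrite (le_trans h1 h2).
have sab : a <= s <= b by rewrite h1 (le_trans h2 h3).
rewrite (_ : _ - _ = (f t - f s) * g s + f t * (g t - g s)); last by ring.
rewrite (le_trans (ler_normD _ _))// [leRHS]mulrDl lerD// normrM.
  by rewrite mulrAC ler_pM ?gB ?lf.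
by rewrite -mulrA ler_pM ?fA ?lg.
Qed.

Lemma lip_seg_sum m (L : 'I_m -> R) (a b : R) (f : 'I_m -> R -> R) :
  (forall i, lip_seg (L i) a b (f i)) -> lip_seg (\sum_i L i) a b (fun t => \sum_i f i t).
Proof.
move=> H s t h1 h2 h3; rewrite -sumrB mulr_suml (le_trans (ler_norm_sum _ _ _))//.
by apply: ler_sum => i _; exact: H.
Qed.

Definition exlip (a b : R) (f : R -> R) := exists2 K : R, 0 <= K & lip_seg K a b f.

Lemma exlip_cst a b c : exlip a b (fun=> c).
Proof. by exists 0 => // s t _ _ _; rewrite subrr normr0 mul0r. Qed.

Lemma exlip_id a b : exlip a b (fun t => t).
Proof. by exists 1 => // s t _ st _; rewrite mul1r ger0_norm// subr_ge0. Qed.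

Lemma exlip_add a b f g : exlip a b f -> exlip a b g -> exlip a b (fun t => f t + g t).
Proof.
by move=> [K K0 HK] [L L0 HL]; exists (K + L); [exact: addr_ge0|exact: lip_segD].
Qed.

Lemma exlip_bounded a b f : exlip a b f ->
  exists2 A : R, 0 <= A & forall t, a <= t <= b -> `|f t| <= A.
Proof.
move=> [K K0 HK]; exists (`|f a| + K * `|b - a|); first by rewrite addr_ge0// mulr_ge0.
move=> t /andP[a_t tb]; rewrite -[X in `|X|](subrK (f a)) (le_trans (ler_normD _ _))// addrC lerD2l.
rewrite (le_trans (HK _ _ _ _ _))// ler_wpM2l// ger0_norm ?subr_ge0 ?(le_trans a_t)//.
by rewrite lerD2r.
Qed.

Lemma exlip_mul a b f g : exlip a b f -> exlip a b g -> exlip a b (fun t => f t * g t).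
Proof.
move=> Hf Hg; have [A A0 HA] := exlip_bounded Hf; have [B B0 HB] := exlip_bounded Hg.
have [K K0 HK] := Hf; have [L L0 HL] := Hg.
by exists (K * B + A * L); [rewrite addr_ge0// mulr_ge0|exact: lip_segM].
Qed.

Lemma exlip_sum a b m (f : 'I_m -> R -> R) : (forall i, exlip a b (f i)) ->
  exlip a b (fun t => \sum_i f i t).
Proof.
move=> H.
have /choice[L HL] i : exists L : R, 0 <= L /\ lip_seg L a b (f i) by have [L] := H i; exists L.
exists (\sum_i L i); first by apply: sumr_ge0 => i _; case: (HL i).
by apply: lip_seg_sum => i; case: (HL i).
Qed.

Lemma der_dot d (u v : R -> 'rV[R]_d) (t : R) u' v' : is_derive t 1 u u' -> is_derive t 1 v v' ->
  is_derive t 1 (fun t => dot (u t) (v t)) (dot u' (v t) + dot (u t) v').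
Proof.
move=> du dv; have D l := derM (is_derive_rV_coord l du) (is_derive_rV_coord l dv).
by apply: (der_eq (dersum D)); rewrite -big_split.
Qed.

Lemma der_rVB d (u v : R -> 'rV[R]_d) (t : R) u' v' : is_derive t 1 u u' -> is_derive t 1 v v' ->
  is_derive t 1 (fun t => u t - v t) (u' - v').
Proof. by move=> du dv; exact: is_deriveB. Qed.

End lip_of_der.

(** * Curves read in charts: velocity, speed and continuity *)

Section charts_theory.
Context {R : realType} {d : nat} (M : contact_subriemannian_manifold R d).
Implicit Types (c : chart R d M) (h : R -> M).

Lemma cimgP c x : cimg c x -> cdom c (cinv c x) /\ cmap c (cinv c x) = x.
Proof. by move=> [p cp <-]; rewrite (cmapK cp). Qed.

Lemma C11_le y0 rho (C C' : R) (f : 'rV[R]_d -> R) df : C <= C' ->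
  C11 y0 rho C f df -> C11 y0 rho C' f df.
Proof.
move=> CC' H x y hx hy; have [h1 h2 h3 h4 h5] := H x y hx hy; split.
- exact: le_trans CC'.
- by move=> l; exact: le_trans CC'.
- by rewrite (le_trans h3)// ler_wpM2r.
- by move=> l; rewrite (le_trans (h4 l))// ler_wpM2r.
- by rewrite (le_trans h5)// ler_wpM2r// sqr_ge0.
Qed.

Lemma transition_box c c' (p : M) : cdom c p -> cdom c' p ->
  exists2 r : R, 0 < r & forall z, `|z - cmap c p| <= r ->
    (cmap c @` (cdom c `&` cdom c')) z.
Proof.
move=> cp c'p.
have n1 : nbhs (cmap c p) (cimg c).
  by apply: open_nbhs_nbhs; split; [exact: cimg_open|exists p].
have n2 : nbhs (cmap c p) (cinv c @^-1` cdom c').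
  have /= := @cinv_continuous _ _ _ c (cmap c p); apply; first by exists p.
  by rewrite (cmapK cp); apply: open_nbhs_nbhs; split => //; exact: cdom_open.
have /nbhs_ballP[e /= e0 He] := @filterI _ _ (nbhs_filter (cmap c p)) _ _ n1 n2.
exists (e / 2); first by rewrite divr_gt0.
move=> z zr; have [] : (cimg c `&` cinv c @^-1` cdom c') z.
  apply: He; rewrite -ball_normE /= distrC (le_lt_trans zr)//.
  by rewrite gtr_pMr // invf_lt1// ltr1n.
by move=> [p' cp' <-] /=; rewrite (cmapK cp') => c'p'; exists p'.
Qed.

Lemma transition_C11 c c' (p : M) : atlas c -> atlas c' -> cdom c p -> cdom c' p ->
  exists2 r : R, 0 < r & exists2 C : R, 0 <= C &
    (forall z, `|z - cmap c p| <= r -> (cmap c @` (cdom c `&` cdom c')) z) /\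
    forall i, C11 (cmap c p) r C (fun x => transition c c' x 0 i)
      (fun l => 'D_(delta_mx 0 l) (fun x => transition c c' x 0 i)).
Proof.
move=> ac ac' cp c'p; have [r r0 Hr] := transition_box cp c'p.
have [sm _] := atlas_compatible ac ac'.
have /choice[C HC] i : exists C : R, 0 <= C /\ C11 (cmap c p) r C (fun x => transition c c' x 0 i)
      (fun l => 'D_(delta_mx 0 l) (fun x => transition c c' x 0 i)).
  by have [C C0 HC] := class_C2_C11 Hr (sm i 2); exists C.
exists r => //; exists (\sum_i C i); first by apply: sumr_ge0 => i _; case: (HC i).
split => // i; apply: C11_le (HC i).2; rewrite (bigD1 i)//= lerDl.
by apply: sumr_ge0 => k _; case: (HC k).
Qed.

Lemma chart_velocity c c' h (t : R) v : atlas c -> atlas c' ->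
  (\forall s \near t, cdom c (h s)) -> cdom c' (h t) ->
  is_derive t 1 (cmap c \o h) v ->
  is_derive t 1 (cmap c' \o h) (change_coord c c' (h t) v).
Proof.
move=> ac ac' near_c c'h dx; have ch : cdom c (h t) := nbhs_singleton near_c.
have [r r0 [C C0 [Hr HC]]] := transition_C11 ac ac' ch c'h.
set F := transition c c' in HC *.
set y := cmap c (h t) in Hr HC.
pose w : 'rV[R]_d := \row_i \sum_l 'D_(delta_mx 0 l) (fun x => F x 0 i) y * v 0 l.
have yr : `|y - y| < r by rewrite subrr normr0.
have dF : is_derive y v F w.
  by apply: is_derive_rV => i; rewrite mxE; exact: C11_dir (HC i) yr.
have -> : change_coord c c' (h t) v = w by rewrite /change_coord -/F -/y; case: dF.
apply: (@near_eq_is_derive _ _ _ (F \o (cmap c \o h))); rewrite ?oner_eq0//.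
  by apply: filterS near_c => s cs /=; rewrite /F /transition /= (cmapK cs).
apply: is_derive_rV => i; rewrite mxE.
exact: (@C11_chain _ _ _ _ _ _ _ (cmap c \o h) t v (HC i) yr dx).
Qed.

Lemma sq_speedE c h (t : R) v : atlas c ->
  (\forall s \near t, cdom c (h s)) -> is_derive t 1 (cmap c \o h) v ->
  distr c (h t) v -> sq_speed h t = metric c (h t) v v.
Proof.
move=> ac near_c dx dv; have ch : cdom c (h t) := nbhs_singleton near_c.
rewrite /sq_speed; set A := [set e | _].
have AE e : A e -> e = metric c (h t) v v.
  move=> [c' [ac' c'h ->]].
  have dc := chart_velocity ac ac' near_c c'h dx.
  have -> : velocity c' h t = change_coord c c' (h t) v.
    by rewrite /velocity derive1E; case: dc.
  exact: metric_change_coord.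
apply: AE; apply: xgetPex; exists (metric c (h t) v v), c; split => //.
by have -> : velocity c h t = v; [rewrite /velocity derive1E; case: dx|].
Qed.

Lemma distr0 c (p : M) : atlas c -> cdom c p -> distr c p 0.
Proof.
move=> ac cp; have cx : cimg c (cmap c p) by exists p.
have [W [al [[_ Wx] WC _ H]]] := distr_contact ac cx.
have [_ + _] := H _ Wx; rewrite (cmapK cp) => ->.
by rewrite /form_app big1// => i _; rewrite mxE mulr0.
Qed.

Lemma metric_ge0 c (p : M) v : atlas c -> cdom c p -> distr c p v -> 0 <= metric c p v v.
Proof.
move=> ac cp dv; have [->|v0] := eqVneq v 0; last by rewrite ltW// metric_pos.
have d0 := distr0 ac cp.
have := metric_linear 1 ac cp d0 d0 d0; rewrite scaler0 addr0 mul1r.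
by move=> /eqP; rewrite -subr_eq0 opprD addrA subrr add0r oppr_eq0 => /eqP ->.
Qed.

Lemma lipschitz_curveP (a b : R) h c (t : R) : lipschitz_curve a b h -> atlas c ->
  a <= t <= b -> cdom c (h t) ->
  exists2 e : R, 0 < e & exists2 K : R, 0 <= K &
    (forall s, a <= s <= b -> `|s - t| < e -> cdom c (h s)) /\
    (forall s s', a <= s <= b -> a <= s' <= b -> `|s - t| < e -> `|s' - t| < e ->
      `|cmap c (h s') - cmap c (h s)| <= K * `|s' - s|).
Proof.
move=> lh ac tab ct; have [V [/nbhs_ballP[e /= e0 He] Vc [K [Kreal HK]]]] := lh c t ac tab ct.
(* The Lipschitz predicate only provides the constants strictly above the real number [K]; [|K| + 1]
   is one of them and is nonnegative. *)
exists e => //; exists (`|K| + 1); first by rewrite addr_ge0.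
have Vs s : `|s - t| < e -> V s by move=> st; apply: He; rewrite -ball_normE /= distrC.
split=> [s sab st|s s' sab s'ab st s't]; first by apply: Vc => //; exact: Vs.
have K1 : K < `|K| + 1 by rewrite (le_lt_trans (ler_norm _))// ltrDl.
apply: (HK _ K1 (s', s)); split => /=; split.
- exact: Vs.
- by rewrite /= in_itv.
- exact: Vs.
- by rewrite /= in_itv.
Qed.

Lemma curve_continuous_at (a b : R) h (t : R) (B : set M) : lipschitz_curve a b h ->
  a <= t <= b -> nbhs (h t) B ->
  exists2 e : R, 0 < e & forall s, a <= s <= b -> `|s - t| < e -> B (h s).
Proof.
move=> lh tab nB; have [c ac ct] := atlas_cover (h t).
have [e e0 [K K0 [Hc HK]]] := lipschitz_curveP lh ac tab ct.
have nB' : nbhs (cmap c (h t)) (cinv c @^-1` B).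
  have /= := @cinv_continuous _ _ _ c (cmap c (h t)); apply; first by exists (h t).
  by rewrite (cmapK ct).
have /nbhs_ballP[e2 /= e20 He2] := nB'.
have K1 : 0 < K + 1 by rewrite ltr_wpDl.
exists (Num.min e (e2 / (K + 1))); first by rewrite lt_min e0 divr_gt0.
move=> s sab; rewrite lt_min => /andP[st st2].
rewrite -(cmapK (Hc _ sab st)); apply: He2; rewrite -ball_normE /= distrC.
rewrite (le_lt_trans (HK _ _ tab sab _ st))// ?subrr ?normr0//.
move: st2; rewrite ltr_pdivlMr // => st2; rewrite (le_lt_trans _ st2)// mulrC.
by rewrite ler_wpM2l// lerDl.
Qed.

Lemma ae_neq (u : R) : {ae lebesgue_measure, forall t : R, t != u}.
Proof.
exists [set u]; split => //; first exact: lebesgue_measure_set1.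
by move=> t /= /negP; rewrite negbK => /eqP.
Qed.

Lemma ae_sq_speed_ge0 (a b : R) h : lipschitz_curve a b h -> horizontal a b h ->
  {ae lebesgue_measure, forall t : R, a <= t <= b -> 0 <= sq_speed h t}.
Proof.
move=> lh hh.
have F := ae_filter_ringOfSetsType (@lebesgue_measure R).
(* The endpoints are discarded because a derivative there involves values of [h] outside [[a, b]],
   about which nothing is known. *)
have H := @filterI _ _ F _ _ hh (@filterI _ _ F _ _ (ae_neq a) (ae_neq b)).
apply: (@filterS _ _ F _ _ _ H) => t [Ht [ta tb]] tab.
have [c ac ct] := atlas_cover (h t); have [dx dv] := Ht tab c ac ct.
have [e e0 [K K0 [Hc _]]] := lipschitz_curveP lh ac tab ct.
have nc : \forall s \near t, cdom c (h s).
  have tab' : t \in `]a, b[.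
    by rewrite in_itv/= !lt_neqAle eq_sym ta tb.
  have n1 := near_in_itvoo tab'.
  have n2 : \forall s \near t, `|s - t| < e.
    by have := nbhsx_ballx t _ e0; apply: filterS => s; rewrite -ball_normE /= distrC.
  apply: filterS2 n1 n2 => s; rewrite in_itv/= => /andP[s1 s2]; apply: Hc.
  by rewrite !ltW.
have -> : sq_speed h t = metric c (h t) (velocity c h t) (velocity c h t).
  apply: sq_speedE => //; rewrite /velocity derive1E; exact: derivableP.
exact: metric_ge0.
Qed.

End charts_theory.

(** * Normal extremals minimize the energy locally *)

Section normal_extremals.
Context {R : realType} {n d : nat} (M : contact_subriemannian_manifold R d).
Context (c : chart R d M) (c_atlas : atlas c).
Context (b : 'M[R]_(n, d)) (e : 'rV[R]_d).
Context (K : 'I_n -> 'I_n -> 'rV[R]_d -> R) (dK : 'I_n -> 'I_n -> 'I_d -> 'rV[R]_d -> R).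
Context (a : 'I_n -> 'rV[R]_d -> R) (da : 'I_n -> 'I_d -> 'rV[R]_d -> R).
Context (y0 : 'rV[R]_d) (rho : R) (rho_gt0 : 0 < rho).
Hypothesis K_C11 : forall i j, exists2 C : R, 0 <= C & C11 y0 rho C (K i j) (dK i j).
Hypothesis a_C11 : forall j, exists2 C : R, 0 <= C & C11 y0 rho C (a j) (da j).
Hypothesis K_sym : forall i j y, `|y - y0| <= rho -> K i j y = K j i y.
Hypothesis box_img : forall y, `|y - y0| <= rho -> cimg c y.
Hypothesis vel_distr : forall y p, `|y - y0| <= rho ->
  distr c (cinv c y) (hvel b e K a y p).
Hypothesis vel_metric : forall y p, `|y - y0| <= rho ->
  metric c (cinv c y) (hvel b e K a y p) (hvel b e K a y p) = 2 * ham b e K a y p.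
Hypothesis fenchel : forall y v p, `|y - y0| <= rho -> distr c (cinv c y) v ->
  dot p v <= 2^-1 * metric c (cinv c y) v v + ham b e K a y p.
Context (y p : R -> 'rV[R]_d) (sol : ham_sol b e K dK a da y p).
Hypothesis y_box : forall t : R, 0 <= t <= 1 -> `|y t - y0| < rho / 2.

Local Notation H := (ham b e K a).
Local Notation vel := (hvel b e K a).
Local Notation frc := (hfrc b e K dK a da).
Let g : R -> M := cinv c \o y.

Let rho2 : rho / 2 < rho.
Proof. by rewrite gtr_pMr // invf_lt1// ltr1n. Qed.

Let y_in (t : R) : 0 <= t <= 1 -> `|y t - y0| < rho.
Proof. by move=> /y_box /lt_trans; apply. Qed.

Let g_dom (t : R) : 0 <= t <= 1 -> cdom c (g t) /\ cmap c (g t) = y t.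
Proof. by move=> /y_in /ltW /box_img /cimgP. Qed.

Let y_near (t : R) : 0 <= t <= 1 -> \forall s \near t, `|y s - y0| < rho.
Proof.
move=> t01; have [dy _] := sol t01.
pose ep := rho - `|y t - y0|; have e0 : 0 < ep by rewrite subr_gt0 y_in.
move/cvgrPdist_lt: (is_derive_continuous dy) => /(_ ep e0); apply: filterS => s Hs /=.
rewrite -[X in `|X|](subrKA (y t)) (le_lt_trans (ler_normD _ _))// -ltrBrDr.
by rewrite distrC.
Qed.

Let g_near (t : R) : 0 <= t <= 1 -> \forall s \near t, cdom c (g s).
Proof. by move=> /y_near; apply: filterS => s /ltW/box_img/cimgP[]. Qed.

Let g_der (t : R) : 0 <= t <= 1 -> is_derive t 1 (cmap c \o g) (vel (y t) (p t)).
Proof.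
move=> t01; have [dy _] := sol t01.
apply: (@near_eq_is_derive _ _ _ y); rewrite ?oner_eq0//.
by apply: filterS (y_near t01) => s /ltW/box_img/cimgP[].
Qed.

Let g_distr (t : R) : 0 <= t <= 1 -> distr c (g t) (vel (y t) (p t)).
Proof. by move=> t01; apply: vel_distr; exact: ltW (y_in t01). Qed.

Let p_bounded : exists2 Cp : R, 0 <= Cp & forall t : R, 0 <= t <= 1 -> `|p t| <= Cp.
Proof.
have [|x _ Hx] := @EVT_max R (fun t => `|p t|) 0 1 ler01.
  apply: continuous_in_subspaceT => t; rewrite inE /= in_itv/= => t01.
  have [_ dp] := sol t01; have cp := is_derive_continuous dp.
  exact: (@cvg_norm _ _ _ _ _ p).
by exists `|p x| => // t t01; apply: Hx; rewrite in_itv.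
Qed.

Let y_lip : exists2 L : R, 0 <= L & lip_seg L 0 1 y.
Proof.
have [Cp Cp0 Hp] := p_bounded.
have [L L0 HL] := hvel_bounded b e K_C11 a_C11 Cp0.
exists L => //; apply: (@lip_seg_der_rV _ _ y (fun t => vel (y t) (p t))) => t t01.
  by have [] := sol t01.
by apply: HL; [exact: ltW (y_in t01)|exact: Hp].
Qed.

Let p_lip : exists2 L : R, 0 <= L & lip_seg L 0 1 p.
Proof.
have [Cp Cp0 Hp] := p_bounded.
have [L L0 HL] := hfrc_bounded b e K_C11 a_C11 Cp0.
exists L => //; apply: (@lip_seg_der_rV _ _ p (fun t => - \row_l frc (y t) (p t) l)) => t t01.
  by have [] := sol t01.
by rewrite normrN; apply: HL; [exact: ltW (y_in t01)|exact: Hp].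
Qed.

Let H_const (t : R) : 0 <= t <= 1 -> H (y t) (p t) = H (y 0) (p 0).
Proof. by move=> t01; exact: (ham_conserved K_C11 a_C11 K_sym sol y_in). Qed.

Let g_sq_speed (t : R) : 0 <= t <= 1 -> sq_speed g t = 2 * H (y 0) (p 0).
Proof.
move=> t01; rewrite (sq_speedE c_atlas (g_near t01) (g_der t01) (g_distr t01)).
by rewrite vel_metric ?H_const//; exact: ltW (y_in t01).
Qed.

Let H_ge0 : 0 <= H (y 0) (p 0).
Proof.
have o01 : 0 <= (0 : R) <= 1 by rewrite lexx ler01.
have := metric_ge0 c_atlas (g_dom o01).1 (g_distr o01).
by rewrite vel_metric ?(ltW (y_in o01))// pmulr_rge0.
Qed.

Let g_lipschitz : lipschitz_curve 0 1 g.
Proof.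
move=> c' t ac' t01 c't; have [ct yt] := g_dom t01.
have [r r0 [C C0 [Hr HC]]] := transition_C11 c_atlas ac' ct c't.
rewrite yt in Hr HC; have [L L0 HL] := y_lip.
have L1 : 0 < L + 1 by rewrite ltr_wpDl.
have rL : 0 < r / (L + 1) by rewrite divr_gt0.
exists (ball t (r / (L + 1))); have near s : ball t (r / (L + 1)) s -> 0 <= s <= 1 -> `|y s - y t| <= r.
  rewrite -ball_normE /= distrC ltr_pdivlMr // => st s01.
  rewrite (le_trans (lip_seg_sym HL t01 s01))// (le_trans _ (ltW st))// mulrC.
  by rewrite ler_wpM2l// lerDl.
split; first exact: nbhsx_ballx.
  move=> s st s01; have [p' [cp' c'p'] yp'] := Hr _ (near s st s01).
  by rewrite /g /= -yp' (cmapK cp').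
exists (C * L); split; first exact: num_real.
move=> L' LL' -[s s'] /= [[ss s01] [ss' s'01]].
apply: (@le_trans _ _ (C * L * `|s - s'|)); last by rewrite ler_wpM2r// ltW.
rewrite /= !in_itv/= in s01 s'01.
have ns := near s ss s01; have ns' := near s' ss' s'01.
apply: mx_norm_le; first by rewrite !mulr_ge0.
move=> i j; rewrite ord1 !mxE.
have [_ _ h3 _ _] := HC j _ _ ns' ns; rewrite (le_trans h3)// -mulrA ler_wpM2l//.
by rewrite (lip_seg_sym HL s'01 s01).
Qed.

Let g_horizontal : horizontal 0 1 g.
Proof.
apply: aeW => t t01 c' ac' c't.
have dv := chart_velocity c_atlas ac' (g_near t01) c't (g_der t01).
split; first by case: dv.
have -> : velocity c' g t = change_coord c c' (g t) (vel (y t) (p t)).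
  by rewrite /velocity derive1E; case: dv.
exact: (distr_change_coord _ c_atlas ac' (g_dom t01).1 c't).1 (g_distr t01).
Qed.

Let g_energy (s t : R) : 0 <= s -> s < t -> t <= 1 ->
  energy s t g = (H (y 0) (p 0) * (t - s))%:E.
Proof.
move=> s0 st t1; rewrite /energy.
rewrite (eq_integral (fun=> (2 * H (y 0) (p 0))%:E)); last first.
  move=> x; rewrite inE /= in_itv/= => /andP[x1 x2]; rewrite g_sq_speed//.
  by rewrite (le_trans s0 x1) (le_trans x2 t1).
rewrite (@integral_cst _ _ _ (@lebesgue_measure R) _ (measurable_itv `[s, t])).
have E : lebesgue_measure `[s, t]%classic = (t - s)%:E :> \bar R.
  by rewrite lebesgue_measure_itv/= lte_fin st EFinB.
transitivity (2^-1%:E * ((2 * H (y 0) (p 0))%:E * (t - s)%:E))%E.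
  by congr (_ * (_ * _))%E; exact: E.
transitivity (2^-1 * (2 * H (y 0) (p 0) * (t - s)))%:E; first by [].
by congr EFin; field.
Qed.

(** Competitors live in [M] and may leave the chart. Either some time [T] has the required
    properties with distance [rho1] reached, or real induction shows that the curve stays in the
    chart at distance less than [rho1] up to [t]. *)
Lemma exit_time (rho1 s t : R) h : 0 < rho1 -> rho1 <= rho / 2 -> 0 <= s -> s < t -> t <= 1 ->
  lipschitz_curve s t h -> h s = g s ->
  exists T : R, [/\ s < T, T <= t,
    (forall r, s <= r <= T -> cdom c (h r) /\ `|cmap c (h r) - y r| <= rho1) &
    T = t \/ rho1 <= `|cmap c (h T) - y T|].
Proof.
move=> r10 r1r s0 st t1 lh hs.
have in01 r : s <= r <= t -> 0 <= r <= 1.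
  by move=> /andP[r1 r2]; rewrite (le_trans s0 r1) (le_trans r2 t1).
have [[T [sT Tt H1 H2]]|noexit] := pselect (exists T : R, [/\ s < T, T <= t,
    (forall r, s <= r <= T -> cdom c (h r) /\ `|cmap c (h r) - y r| <= rho1) &
    rho1 <= `|cmap c (h T) - y T|]).
  by exists T; split => //; right.
pose P r := cdom c (h r) /\ `|cmap c (h r) - y r| < rho1.
have [L L0 HL] := y_lip.
have near_w r : s <= r <= t -> cdom c (h r) -> exists2 e1 : R, 0 < e1 &
    exists2 K1 : R, 0 <= K1 & forall r', s <= r' <= t -> `|r' - r| < e1 ->
      cdom c (h r') /\ `|(cmap c (h r') - y r') - (cmap c (h r) - y r)| <= K1 * `|r' - r|.
  move=> rst cr; have [e1 e10 [K1 K10 [Hc HK]]] := lipschitz_curveP lh c_atlas rst cr.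
  exists e1 => //; exists (K1 + L); first exact: addr_ge0.
  move=> r' r'st rr'; split; first exact: Hc.
  rewrite (_ : _ - _ - _ = (cmap c (h r') - cmap c (h r)) - (y r' - y r)); last first.
    by rewrite !opprD !opprK addrACA.
  rewrite (le_trans (ler_normB _ _))// mulrDl lerD//.
    by apply: HK => //; rewrite subrr normr0.
  exact: lip_seg_sym HL (in01 _ rst) (in01 _ r'st).
have allP r : s <= r <= t -> P r.
  apply: real_ind => {r}.
  - rewrite /P hs; have s01 : 0 <= s <= 1 by apply: in01; rewrite lexx ltW.
    by have [? ->] := g_dom s01; rewrite subrr normr0.
  - move=> r sr rt Hr; have [cr wr] : P r by apply: Hr; rewrite sr lexx.
    have rst : s <= r <= t by rewrite sr ltW.
    have [e1 e10 [K1 K10 HK]] := near_w r rst cr.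
    pose gap := rho1 - `|cmap c (h r) - y r|.
    have gap0 : 0 < gap by rewrite subr_gt0.
    have K11 : 0 < K1 + 1 by rewrite ltr_wpDl.
    pose dl := Num.min (e1 / 2) (gap / (K1 + 1)).
    have dl0 : 0 < dl by rewrite lt_min !divr_gt0.
    exists (r + dl); first by rewrite ltrDl.
    move=> r' rr' r'd r't.
    have dr' : `|r' - r| <= dl by rewrite ger0_norm ?subr_ge0 ?(ltW rr')// lerBlDl.
    have [||cr' wr'] := HK r'; first by rewrite r't (le_trans sr (ltW rr')).
      rewrite (le_lt_trans dr')// gt_min; apply/orP; left.
      by rewrite gtr_pMr // invf_lt1// ltr1n.
    split => //.
    rewrite -[X in `|X|](subrK (cmap c (h r) - y r)) (le_lt_trans (ler_normD _ _))// -ltrBrDr.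
    rewrite (le_lt_trans wr')// -/gap.
    apply: (@lt_le_trans _ _ ((K1 + 1) * dl)).
      have r'r0 : 0 < `|r' - r| by rewrite normr_gt0 subr_eq0 gt_eqF.
      rewrite (@lt_le_trans _ _ ((K1 + 1) * `|r' - r|))//; first by rewrite ltr_pM2r// ltrDl.
      by rewrite ler_wpM2l// ltW.
    by rewrite mulrC -ler_pdivlMr// ge_min lexx orbT.
  - move=> r sr rt Hr.
    have rst : s <= r <= t by rewrite ltW.
    (* In the limit the curve might leave the domain of the chart. The image of the closed box is
       compact, hence closed in the Hausdorff space [M], so [h r] still belongs to the chart. *)
    pose Kc := cinv c @` [set x | `|x - y0| <= rho].
    have cK : closed Kc.
      apply: compact_closed; first exact: manifold_hausdorff.
      apply: continuous_compact; last exact: closed_box_compact.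
      apply: continuous_in_subspaceT => x; rewrite inE /= => /box_img cx.
      exact: cinv_continuous.
    have hK r' : s <= r' -> r' < r -> Kc (h r').
      move=> sr' r'r; have [cr' wr'] := Hr r' sr' r'r.
      exists (cmap c (h r')); last exact: cmapK.
      have r'01 : 0 <= r' <= 1 by apply: in01; rewrite sr' (le_trans (ltW r'r)).
      rewrite /= -(subrKA (y r')) (le_trans (ler_normD _ _))// (splitr rho) lerD//.
        by rewrite (le_trans (ltW wr')).
      by rewrite ltW// y_box.
    have [x xb xh] : Kc (h r).
      apply: cK => B nB; have [e1 e10 He1] := curve_continuous_at lh rst nB.
      pose r' := Num.max s (r - e1 / 2).
      have e20 : 0 < e1 / 2 by rewrite divr_gt0.
      have r'r : r' < r by rewrite gt_max sr ltrBlDr ltrDl.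
      have sr' : s <= r' by rewrite le_max lexx.
      exists (h r'); split; first exact: hK.
      apply: He1; first by rewrite sr' (le_trans (ltW r'r)).
      rewrite ltr0_norm ?subr_lt0// opprB.
      have : r - e1 / 2 <= r' by rewrite le_max lexx orbT.
      by move: e10; lra.
    have [cr _] := cimgP (box_img xb); rewrite xh in cr.
    have wr : `|cmap c (h r) - y r| <= rho1.
      rewrite leNgt; apply/negP => wr.
      have [e1 e10 [K1 K10 HK]] := near_w r rst cr.
      pose gap := `|cmap c (h r) - y r| - rho1.
      have gap0 : 0 < gap by rewrite subr_gt0.
      have K11 : 0 < K1 + 1 by rewrite ltr_wpDl.
      pose dl := Num.min (e1 / 2) (gap / (K1 + 1)).
      have dl0 : 0 < dl by rewrite lt_min !divr_gt0.
      pose r' := Num.max s (r - dl).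
      have r'r : r' < r by rewrite gt_max sr ltrBlDr ltrDl.
      have sr' : s <= r' by rewrite le_max lexx.
      have dr' : `|r' - r| <= dl.
        rewrite ltr0_norm ?subr_lt0// opprB.
        by have : r - dl <= r' by [rewrite le_max lexx orbT]; lra.
      have [||cr' wr'] := HK r'; first by rewrite sr' (le_trans (ltW r'r)).
        rewrite (le_lt_trans dr')// gt_min; apply/orP; left.
        by rewrite gtr_pMr // invf_lt1// ltr1n.
      have [_ wr'2] := Hr r' sr' r'r.
      have : `|cmap c (h r) - y r| <= `|cmap c (h r') - y r'| + (K1 + 1) * dl.
        rewrite -[X in `|X| <= _](subKr (cmap c (h r') - y r')) (le_trans (ler_normB _ _))//.
        rewrite lerD2l (le_trans wr')// ler_pM//; by rewrite lerDl.
      have : (K1 + 1) * dl <= gap by rewrite mulrC -ler_pdivlMr// ge_min lexx orbT.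
      by rewrite /gap; move: wr'2; lra.
    split => //; rewrite lt_neqAle wr andbT; apply/eqP => wE.
    apply: noexit; exists r; split => //; last by rewrite wE.
    move=> r' /andP[sr']; rewrite le_eqVlt => /predU1P[->//|r'r].
    by have [? /ltW] := Hr r' sr' r'r.
exists t; split => //; last by left.
by move=> r /allP[? /ltW].
Qed.

(* [p . w + psi |w| ^ 2 + H (t - s)] is a subsolution of the Hamilton-Jacobi equation along
   every competitor, as soon as [psi] decreases fast enough; since [psi] may be taken large,
   it also beats the competitors that leave the chart. *)
Lemma local_minimizer : exists2 dl : R, 0 < dl & forall s t : R, 0 <= s -> s < t -> t <= 1 ->
  t - s <= dl -> energy_minimizer s t g.
Proof.
have [Cp Cp0 Hp] := p_bounded; set H0 := H (y 0) (p 0).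
pose rho1 := rho / 2.
have r10 : 0 < rho1 by rewrite divr_gt0.
(* Chosen so that [(mm - 1) rho1 ^ 2 = d Cp rho1 + H0]: at distance [rho1] the quadratic term beats
   both [p . w] and the energy [H0 (t - s)] of the extremal. *)
pose mm := 1 + (d%:R * Cp * rho1 + H0) / rho1 ^+ 2.
have mm1 : 1 <= mm.
  by rewrite lerDl divr_ge0 ?sqr_ge0// addr_ge0// !mulr_ge0// ltW.
have mm0 : 0 <= mm by rewrite (le_trans ler01).
(* Bounds the shifted momentum [p + 2 psi w] as long as [|w| <= rho1]. *)
pose Cq := Cp + 2 * mm * rho1.
have Cq0 : 0 <= Cq by rewrite addr_ge0// !mulr_ge0// ltW.
have [C C0 HC] := ham_taylor b e K_C11 a_C11 K_sym Cq0.
(* The decay rate of [psi]: with [|q - p| <= 2 mm |w|] the Taylor remainder is at most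
   [C (1 + 2 mm) ^ 2 |w| ^ 2]. The time span [C1^-1] chosen next lets [psi] lose at most 1. *)
pose C1 := C * (1 + 2 * mm) ^+ 2 + 1.
have C10 : 0 < C1 by rewrite ltr_wpDl// mulr_ge0// sqr_ge0.
exists C1^-1; first by rewrite invr_gt0.
move=> s t s0 st t1 ts h [lh hh] hs ht.
have [T [sT Tt dom_h exitT]] := exit_time r10 (lexx _) s0 st t1 lh hs.
have in01 r : s <= r <= T -> 0 <= r <= 1.
  by move=> /andP[r1 r2]; rewrite (le_trans s0 r1) (le_trans r2 (le_trans Tt t1)).
pose x := cmap c \o h; pose w r := x r - y r; pose psi r := mm - C1 * (r - s).
have psi_bd r : s <= r <= T -> mm - 1 <= psi r <= mm.
  move=> /andP[r1 r2].
  have c0 : 0 <= C1 * (r - s) by rewrite mulr_ge0 ?subr_ge0// ltW.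
  have c1 : C1 * (r - s) <= 1.
    rewrite -(@divff _ C1) ?gt_eqF// ler_wpM2l ?(ltW C10)// (le_trans _ ts)// lerD2r.
    exact: le_trans Tt.
  by rewrite /psi; apply/andP; split; lra.
(* The factor 2 is there because [sq_speed] is twice the energy density. *)
pose f r := 2 * (dot (p r) (w r) + psi r * dot (w r) (w r) + H0 * (r - s)).
have x_lip l : exlip s T (fun r => x r 0 l).
  have [Kx Kx0 HKx] : exists2 Kx : R, 0 <= Kx & lip_seg Kx s T x.
    apply: locally_lip_seg => r rsT.
    have rst : s <= r <= t by case/andP: rsT => -> /le_trans ->.
    have [e1 e10 [K1 K10 [_ HK]]] := lipschitz_curveP lh c_atlas rst (dom_h r rsT).1.
    exists e1 => //; exists K1 => r1 r2 h1 h2 h3 h4 h5.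
    rewrite (le_trans (HK r1 r2 _ _ h4 h5)) ?ger0_norm ?subr_ge0//.
      by rewrite h1 (le_trans h2)// (le_trans h3).
    by rewrite (le_trans h1)//= (le_trans h3).
  exists Kx => // r1 r2 h1 h2 h3; apply: le_trans (HKx r1 r2 h1 h2 h3).
  by have := ler_mx_norm (x r2 - x r1) 0 l; rewrite !mxE.
have y_lip' l : exlip s T (fun r => y r 0 l).
  have [Ky Ky0 HKy] := y_lip; exists Ky => //.
  move=> r1 r2 h1 h2 h3; apply: le_trans (HKy r1 r2 _ h2 _); rewrite ?(le_trans s0)//.
    by have := ler_mx_norm (y r2 - y r1) 0 l; rewrite !mxE.
  by rewrite (le_trans h3)// (le_trans Tt).
have p_lip' l : exlip s T (fun r => p r 0 l).
  have [Ky Ky0 HKy] := p_lip; exists Ky => //.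
  move=> r1 r2 h1 h2 h3; apply: le_trans (HKy r1 r2 _ h2 _); rewrite ?(le_trans s0)//.
    by have := ler_mx_norm (p r2 - p r1) 0 l; rewrite !mxE.
  by rewrite (le_trans h3)// (le_trans Tt).
have f_lip : exlip s T f.
  have w_lip l : exlip s T (fun r => w r 0 l).
    have -> : (fun r => w r 0 l) = (fun r => x r 0 l + (-1) * y r 0 l).
      by apply: funext => r; rewrite !mxE mulN1r.
    by apply: exlip_add => //; apply: exlip_mul => //; exact: exlip_cst.
  have lin_lip : exlip s T (fun r => r - s) by apply: exlip_add; [exact: exlip_id|exact: exlip_cst].
  apply: exlip_mul; first exact: exlip_cst.
  apply: exlip_add; last by apply: exlip_mul => //; exact: exlip_cst.
  apply: exlip_add; first by apply: exlip_sum => l; apply: exlip_mul.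
  apply: exlip_mul; last by apply: exlip_sum => l; apply: exlip_mul.
  have -> : psi = (fun r => mm + (- C1) * (r - s)) by apply: funext => r; rewrite mulNr.
  by apply: exlip_add; [exact: exlip_cst|apply: exlip_mul => //; exact: exlip_cst].
have df r : s < r < T -> derivable x r 1 -> distr c (h r) (velocity c h r) ->
    derivable f r 1 /\ derive1 f r <= sq_speed h r.
  move=> /andP[r1 r2] dx dv.
  have rsT : s <= r <= T by rewrite !ltW.
  have r01 := in01 r rsT.
  have [cr wr] := dom_h r rsT.
  have nc : \forall r' \near r, cdom c (h r').
    have r_in : r \in `]s, T[ by rewrite in_itv/= r1.
    apply: filterS (near_in_itvoo r_in) => r'; rewrite in_itv/= => /andP[h1 h2].
    by apply: (proj1 (dom_h r' _)); rewrite !ltW.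
  set v := velocity c h r in dv.
  have dxv : is_derive r 1 x v by rewrite /v /velocity derive1E; exact: derivableP.
  rewrite (sq_speedE c_atlas nc dxv dv).
  have [dy dp] := sol r01.
  have dw : is_derive r 1 w (v - vel (y r) (p r)) by exact: der_rVB.
  have dpsi : is_derive r 1 psi (- C1).
    apply: (der_eq (derB (dercst r mm) (derMl C1 (derB (derid r) (dercst r s))))).
    by rewrite subr0 mulr1 sub0r.
  have dlin : is_derive r 1 (fun r => H0 * (r - s)) H0.
    by apply: (der_eq (derMl H0 (derB (derid r) (dercst r s)))); rewrite subr0 mulr1.
  have dF := derMl 2 (derD (derD (der_dot dp dw) (derM dpsi (der_dot dw dw))) dlin).
  split; first by case: dF.
  rewrite derive1E; have -> := derive_val (is_derive := dF).
  have hr : h r = cinv c (x r) by rewrite /x /= (cmapK cr).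
  have xr : `|x r - y0| <= rho.
    by rewrite -(subrKA (y r)) (le_trans (ler_normD _ _))// (splitr rho) lerD// ltW// y_box.
  have /andP[ps1 ps2] := psi_bd r rsT.
  have ps0 : 0 <= psi r by apply: le_trans ps1; rewrite subr_ge0.
  (* The gradient in [w] of [p . w + psi |w| ^ 2], hence the momentum at which Fenchel's inequality
     controls the growth along the velocity [v] of the competitor. *)
  pose q := p r + (2 * psi r) *: w r.
  have wn : `|w r| <= rho1 by [].
  have qn : `|q - p r| <= 2 * mm * `|w r|.
    rewrite /q addrAC subrr add0r normrZ ger0_norm ?mulr_ge0//.
    by rewrite ler_wpM2r// ler_wpM2l.
  have qb : `|q| <= Cq.
    rewrite /q (le_trans (ler_normD _ _))// lerD ?Hp// normrZ ger0_norm ?mulr_ge0//.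
    by rewrite ler_pM ?mulr_ge0// ler_wpM2l.
  have pb : `|p r| <= Cq by rewrite (le_trans (Hp r r01))// lerDl !mulr_ge0// ltW.
  have dv' : distr c (cinv c (x r)) v by rewrite -hr.
  have := fenchel q xr dv'; rewrite -hr => fen.
  have := HC _ _ _ _ (ltW (y_in r01)) xr pb qb.
  move=> /(le_trans (ler_norm _)); rewrite -/(H _ _) H_const// -/H0.
  have -> : \sum_l frc (y r) (p r) l * (x r 0 l - y r 0 l) = dot (\row_l frc (y r) (p r) l) (w r).
    by apply: eq_bigr => l _; rewrite !mxE.
  have -> : dot (vel (y r) (p r)) (q - p r) = 2 * psi r * dot (vel (y r) (p r)) (w r).
    by rewrite /q [p r + _]addrC addrK dotZr.
  move=> tay.
  have wb : C * (`|x r - y r| + `|q - p r|) ^+ 2 <= C1 * dot (w r) (w r).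
    apply: (@le_trans _ _ (C * ((1 + 2 * mm) * `|w r|) ^+ 2)).
      rewrite ler_wpM2l// ler_sqr ?nnegrE ?addr_ge0 ?mulr_ge0// ?addr_ge0 ?mulr_ge0//.
      by rewrite mulrDl mul1r lerD2l.
    rewrite exprMn mulrA (@le_trans _ _ (C1 * `|w r| ^+ 2))//.
      by rewrite ler_wpM2r ?sqr_ge0// lerDl.
    by rewrite ler_wpM2l ?(ltW C10)// dot_norm.
  have qv : dot q v = dot (p r) v + 2 * psi r * dot (w r) v by rewrite /q dotDl dotZl.
  have pv := dot_hvel b e K a (y r) (p r); rewrite H_const// -/H0 in pv.
  rewrite qv in fen.
  rewrite (dotC (v - vel _ _)) dotNl.
  have -> : dot (w r) (v - vel (y r) (p r)) = dot (w r) v - dot (w r) (vel (y r) (p r)) by exact: dotBr.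
  have -> : dot (p r) (v - vel (y r) (p r)) = dot (p r) v - 2 * H0 by rewrite -pv; exact: dotBr.
  rewrite (dotC (vel _ _) (w r)) in tay.
  (* What remains is linear: Fenchel at [q], the expansion of [H (x, q)] around [(y, p)], the
     identity [p . vel = 2 H0] and the remainder absorbed by [C1 |w| ^ 2] add up to the claim. *)
  move: fen tay wb; set X1 := dot (p r) v; set X2 := dot (w r) v; set X3 := metric _ _ _ _.
  set X4 := dot (\row_l _) _; set X5 := dot (w r) (vel _ _); set X6 := dot (w r) (w r).
  set X7 := C * _; set X8 := ham _ _ _ _ _ _; set X9 := psi r.
  by lra.
have ae1 : {ae lebesgue_measure, forall r : R, s < r < T -> derivable f r 1 /\ derive1 f r <= sq_speed h r}.
  have F := ae_filter_ringOfSetsType (@lebesgue_measure R).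
  apply: (@filterS _ _ F _ _ _ hh) => r Hr rsT; have /andP[r1 r2] := rsT.
  have [||dx dv] := Hr _ c c_atlas; first by rewrite ltW//= (le_trans (ltW r2)).
    by apply: (proj1 (dom_h r _)); rewrite !ltW.
  exact: df.
have ae2 := ae_sq_speed_ge0 lh hh.
have [Kf Kf0 HKf] := f_lip.
have := lip_ftc_le sT Tt HKf ae1 ae2.
have fs : f s = 0.
  have s01 : 0 <= s <= 1 by apply: in01; rewrite lexx ltW.
  have ws : w s = 0 by rewrite /w /x /= hs (g_dom s01).2 subrr.
  by rewrite /f ws -(scale0r (0 : 'rV[R]_d)) !dotZr !mul0r mulr0 subrr !mulr0 !addr0 mulr0.
(* Either the competitor reaches [t], where [w = 0], or it has gone [rho1] away, and then the choice
   of [mm] pays for the whole energy because [t - s <= 1]. *)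
have fT : 2 * (H0 * (t - s)) <= f T.
  rewrite ler_wpM2l//; have [TE|wT] := exitT.
    have T01 : 0 <= t <= 1 by rewrite (le_trans s0 (ltW st)).
    have wT : w T = 0 by rewrite /w /x /= TE ht (g_dom T01).2 subrr.
    by rewrite wT -(scale0r (0 : 'rV[R]_d)) !dotZr !mul0r mulr0 !add0r TE.
  have TsT : s <= T <= T by rewrite lexx ltW.
  have [_ wT2] := dom_h T TsT; have /andP[ps1 _] := psi_bd T TsT.
  have wTE : `|w T| = rho1 by apply/le_anti; rewrite wT2 wT.
  have h1 : - (d%:R * Cp * rho1) <= dot (p T) (w T).
    rewrite lerNl (le_trans (ler_norm _))// normrN (le_trans (norm_dot _ _))//.
    by rewrite -mulrA ler_wpM2l// wTE ler_wpM2r ?(ltW r10)// Hp// in01.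
  have h2 : (d%:R * Cp * rho1 + H0) <= psi T * dot (w T) (w T).
    apply: (@le_trans _ _ ((mm - 1) * rho1 ^+ 2)).
      by rewrite /mm addrAC subrr add0r divfK// expf_neq0// gt_eqF.
    apply: ler_pM => //; [by rewrite subr_ge0|exact: sqr_ge0|].
    by rewrite -wTE dot_norm.
  have h3 : 0 <= H0 * (T - s) by rewrite mulr_ge0// subr_ge0 ltW.
  have h4 : H0 * (t - s) <= H0.
    rewrite ler_piMr// (le_trans _ (_ : 1 - 0 <= 1)) ?subr0//.
    by move: s0 t1; lra.
  by move: h1 h2 h3 h4; lra.
rewrite fs subr0 => fI; rewrite g_energy// -/H0 /energy.
have -> : (H0 * (t - s))%:E = (2^-1%:E * (2 * (H0 * (t - s)))%:E)%E.
  by rewrite -EFinM; congr EFin; field.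
by rewrite lee_wpmul2l ?lee_fin// (le_trans _ fI)// lee_fin.
Qed.

Theorem normal_geodesic : y 1 != y 0 -> geodesic g.
Proof.
move=> y10; split.
- by split; [exact: g_lipschitz|exact: g_horizontal].
- exists 1; first by rewrite lexx ler01.
  move=> /(congr1 (cmap c)); have [_ ->] := @g_dom 1 (introT andP (conj ler01 (lexx _))).
  have [_ ->] := @g_dom 0 (introT andP (conj (lexx _) ler01)).
  exact/eqP.
have [dl dl0 Hdl] := local_minimizer.
move=> t t01; exists (dl / 2); first by rewrite divr_gt0.
move=> s1 s2 h1 h2 h3 h4 h5; apply: Hdl => //.
move: (ler_norm (t - s1)) (ler_norm (s2 - t)); rewrite (distrC t s1).
by move: h4 h5; lra.
Qed.

End normal_extremals.

(** * Primitives of functions continuous on the unit interval *)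

Section clamp01.
Context {R : realType}.

Definition clamp01 (t : R) : R := Num.max 0 (Num.min 1 t).

Lemma clamp01_bd t : 0 <= clamp01 t <= 1.
Proof. by rewrite /clamp01 le_max lexx/= ge_max ler01/= ge_min lexx. Qed.

Lemma clamp01_id t : 0 <= t <= 1 -> clamp01 t = t.
Proof. by move=> /andP[t0 t1]; rewrite /clamp01 (min_idPr t1) (max_idPr t0). Qed.

Lemma clamp01_lip s t : `|clamp01 t - clamp01 s| <= `|t - s|.
Proof.
have := ler_norm (t - s); have := ler_norm (s - t); rewrite (distrC s) => ts1 ts2.
rewrite /clamp01 !maxEle !minEle.
case: (leP 1 t) => ? ; case: (leP 1 s) => ?; repeat (case: ifPn; rewrite -?ltNge => ?);
  apply/ler_normlP; split; lra.
Qed.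

Lemma clamp01_continuous : continuous clamp01.
Proof.
move=> t; apply: (@lip_for_continuous _ _ _ 1 1) => // s _.
by rewrite mul1r clamp01_lip.
Qed.

Definition cont01 (f : R -> R) := forall t : R, 0 <= t <= 1 -> {for t, continuous f}.

Lemma cont01_clamp f : cont01 f -> continuous (f \o clamp01).
Proof.
move=> cf t; apply: continuous_comp; first exact: clamp01_continuous.
by apply: cf; exact: clamp01_bd.
Qed.

(** [xget] picks a primitive, to the right of [-1], of the extension of [f] by its end values, so
    the derivative is two-sided at 0 and 1 as well. The definition is total and can be used before
    continuity is established. *)
Definition prim (f : R -> R) (t : R) : R :=
  let F := xget (fun=> 0) [set F | forall x : R, -1 < x -> is_derive x 1 F (f (clamp01 x))] in
  F t - F 0.

Lemma prim0 f : prim f 0 = 0.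
Proof. by rewrite /prim subrr. Qed.

Lemma prim_der f (t : R) : cont01 f -> 0 <= t <= 1 -> is_derive t 1 (prim f) (f t).
Proof.
move=> cf t01; rewrite /prim; set A := [set F | _]; set F := xget _ _.
have AF : A F.
  apply: xgetPex; have [G HG] := antiderivative (-1) (cont01_clamp cf).
  by exists G => x /HG.
have t1 : -1 < t by case/andP: t01 => t0 _; rewrite (lt_le_trans _ t0)// ltrN10.
apply: (der_eq (derB (AF t t1) (dercst t (F 0)))).
by rewrite subr0 clamp01_id.
Qed.

Lemma prim_cont01 f : cont01 f -> cont01 (prim f).
Proof. by move=> cf t t01; apply: is_derive_continuous; exact: prim_der. Qed.

Lemma prim_dist f g (delta t : R) : cont01 f -> cont01 g ->
  (forall t : R, 0 <= t <= 1 -> `|f t - g t| <= delta) -> 0 <= t <= 1 ->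
  `|prim f t - prim g t| <= delta.
Proof.
move=> cf cg fg t01; have [t0 t1] := andP t01.
have d0 : 0 <= delta by apply: le_trans (fg t t01).
have H := @lip_seg_der _ (fun t => prim f t - prim g t) (fun t => f t - g t) delta
  (fun t t01 => derB (prim_der cf t01) (prim_der cg t01)) fg 0 t (lexx _) t0 t1.
rewrite /= !prim0 !subr0 in H; apply: (le_trans H).
by rewrite ler_piMr.
Qed.

Lemma prim_uniq f F (t : R) : cont01 f -> (forall t : R, 0 <= t <= 1 -> is_derive t 1 F (f t)) ->
  0 <= t <= 1 -> prim f t = F t - F 0.
Proof.
move=> cf dF t01; have [t0 t1] := andP t01.
have H := @lip_seg_der _ (fun t => prim f t - F t) (fun t => f t - f t) 0
  (fun t t01 => derB (prim_der cf t01) (dF t t01)) _ 0 t (lexx _) t0 t1.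
have /= := H _; rewrite mul0r prim0 sub0r opprK normr_le0 => /(_ _)/eqP E.
have /E : forall t : R, 0 <= t <= 1 -> `|f t - f t| <= 0 by move=> ? _; rewrite subrr normr0.
by move=> E'; apply/eqP; rewrite -subr_eq0 opprB addrA addrAC E'.
Qed.

Lemma norm_sin_sub (x y : R) : `|sin x - sin y| <= `|x - y|.
Proof.
wlog xy : x y / x <= y.
  by move=> H; case: (leP x y) => [|/ltW] /H //; rewrite distrC (distrC y).
have [|c _] := @MVT_segment _ sin cos x y xy.
  by apply: continuous_subspaceT => z; exact: continuous_sin.
by rewrite distrC => ->; rewrite normrM (distrC x) ler_piMl// cos_max.
Qed.

Lemma norm_cos_sub (x y : R) : `|cos x - cos y| <= `|x - y|.
Proof.
wlog xy : x y / x <= y.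
  by move=> H; case: (leP x y) => [|/ltW] /H //; rewrite distrC (distrC y).
have [|c _] := @MVT_segment _ cos (fun z => - sin z) x y xy.
  by apply: continuous_subspaceT => z; exact: continuous_cos.
by rewrite distrC => ->; rewrite normrM normrN (distrC x) ler_piMl// sin_max.
Qed.

End clamp01.

(** * Algebra of time-dependent families that are Lipschitz in a parameter *)

Section TL_algebra.
Context {R : realType} {Th : Type} (Dom : Th -> Prop) (dst : Th -> Th -> R -> Prop).
Hypothesis dst_ge0 : forall th th' de, dst th th' de -> 0 <= de.

(* Families of functions of time, bounded and Lipschitz in the parameter uniformly in
   time. *)
Definition TL (phi : R -> Th -> R) :=
  (forall th, Dom th -> cont01 (phi ^~ th)) /\
  exists2 C : R, 0 <= C & forall t th, 0 <= t <= 1 -> Dom th -> `|phi t th| <= C /\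
    forall th' de, Dom th' -> dst th th' de -> `|phi t th - phi t th'| <= C * de.

Lemma TL_cst c : TL (fun _ _ => c).
Proof.
split=> [th _ t _|]; first exact: cst_continuous.
exists `|c| => // t th _ _; split => // th' de _ /dst_ge0 de0.
by rewrite subrr normr0 mulr_ge0.
Qed.

Lemma TL_add phi psi : TL phi -> TL psi -> TL (fun t th => phi t th + psi t th).
Proof.
move=> [c1 [A A0 HA]] [c2 [B B0 HB]]; split=> [th Dth t t01|].
  exact: continuousD (c1 th Dth t t01) (c2 th Dth t t01).
exists (A + B); first exact: addr_ge0.
move=> t th t01 Dth; have [a1 a2] := HA t th t01 Dth; have [b1 b2] := HB t th t01 Dth; split.
  by rewrite (le_trans (ler_normD _ _))// lerD.
move=> th' de Dth' dth; rewrite opprD addrACA (le_trans (ler_normD _ _))// mulrDl.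
by rewrite lerD// ?a2 ?b2.
Qed.

Lemma TL_mul phi psi : TL phi -> TL psi -> TL (fun t th => phi t th * psi t th).
Proof.
move=> [c1 [A A0 HA]] [c2 [B B0 HB]]; split=> [th Dth t t01|].
  exact: continuousM (c1 th Dth t t01) (c2 th Dth t t01).
exists (A * B + A * B); first by rewrite addr_ge0// mulr_ge0.
move=> t th t01 Dth; have [a1 a2] := HA t th t01 Dth; have [b1 b2] := HB t th t01 Dth; split.
  by rewrite normrM (le_trans (ler_pM _ _ a1 b1))// lerDl mulr_ge0.
move=> th' de Dth' dth; have [b1' _] := HB t th' t01 Dth'.
rewrite (_ : _ - _ = (phi t th - phi t th') * psi t th' + phi t th * (psi t th - psi t th')); last by ring.
rewrite (le_trans (ler_normD _ _))// [leRHS]mulrDl lerD// normrM.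
  by rewrite mulrAC ler_pM// a2.
by rewrite -mulrA ler_pM// b2.
Qed.

Lemma TL_sum m (phi : 'I_m -> R -> Th -> R) : (forall i, TL (phi i)) ->
  TL (fun t th => \sum_i phi i t th).
Proof.
elim: m phi => [|m IH] phi H.
  by rewrite (_ : (fun t th => _) = fun _ _ => 0); [exact: TL_cst|apply: funext => t; apply: funext => th; rewrite big_ord0].
rewrite (_ : (fun t th => _) = (fun t th => (\sum_(i < m) phi (widen_ord (leqnSn m) i) t th) + phi ord_max t th)).
  by apply: TL_add => //; apply: IH => i; exact: H.
by apply: funext => t; apply: funext => th; rewrite big_ord_recr.
Qed.

Lemma TL_opp phi : TL phi -> TL (fun t th => - phi t th).
Proof.
move=> H; rewrite (_ : (fun t th => _) = (fun t th => (-1) * phi t th)).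
  by apply: TL_mul => //; exact: TL_cst.
by apply: funext => t; apply: funext => th; rewrite mulN1r.
Qed.

Lemma TL_inv phi m : 0 < m -> (forall t th, 0 <= t <= 1 -> Dom th -> m <= phi t th) ->
  TL phi -> TL (fun t th => (phi t th)^-1).
Proof.
move=> m0 Hm [c1 [A A0 HA]]; split=> [th Dth t t01|].
  apply: continuousV (c1 th Dth t t01).
  by rewrite gt_eqF// (lt_le_trans m0)// Hm.
have inv t th : 0 <= t <= 1 -> Dom th -> `|(phi t th)^-1| <= m^-1.
  move=> t01 Dth; have h := Hm t th t01 Dth; rewrite ger0_norm ?invr_ge0 ?(le_trans (ltW m0))//.
  by rewrite lef_pV2// posrE (lt_le_trans m0).
exists (m^-1 + m^-1 * m^-1 * A).
  by rewrite addr_ge0 ?invr_ge0 ?mulr_ge0 ?invr_ge0 ?(ltW m0).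
move=> t th t01 Dth; have [a1 a2] := HA t th t01 Dth; split.
  by rewrite (le_trans (inv t th t01 Dth))// lerDl ?mulr_ge0 ?invr_ge0 ?(ltW m0).
move=> th' de Dth' dth; have de0 := dst_ge0 dth.
have n1 : phi t th != 0 by rewrite gt_eqF// (lt_le_trans m0)// Hm.
have n2 : phi t th' != 0 by rewrite gt_eqF// (lt_le_trans m0)// Hm.
rewrite (_ : _ - _ = (phi t th)^-1 * (phi t th')^-1 * (phi t th' - phi t th)); last first.
  by rewrite mulrBr mulrVK ?unitfE// mulrAC mulVf// mul1r.
rewrite normrM normrM distrC (@le_trans _ _ (m^-1 * m^-1 * (A * de)))//.
  by rewrite ler_pM// ?a2// ler_pM// inv.
by rewrite mulrA ler_wpM2r// lerDr invr_ge0 ltW.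
Qed.

Lemma TL_prim phi : TL phi -> TL (fun t th => prim (phi ^~ th) t).
Proof.
move=> [c1 [A A0 HA]]; split=> [th Dth|]; first exact: prim_cont01 (c1 th Dth).
exists A => // t th t01 Dth; split.
  have := @prim_dist _ (phi ^~ th) (fun=> 0) A t (c1 th Dth).
  have c0 : cont01 (fun=> 0 : R) by move=> ? _; exact: cst_continuous.
  have -> : prim (fun=> 0) t = 0 :> R.
    by rewrite (@prim_uniq _ _ (fun=> 0))// ?subrr// => s _; exact: dercst.
  rewrite subr0; apply => // s s01; rewrite subr0.
  by have [] := HA s th s01 Dth.
move=> th' de Dth' dth; apply: prim_dist => //; [exact: c1|exact: c1|].
by move=> s s01; have [_] := HA s th s01 Dth; exact.
Qed.

Lemma TL_at1 phi : TL phi -> TL (fun _ th => phi 1 th).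
Proof.
move=> [c1 [A A0 HA]]; split=> [th Dth t t01|]; first exact: cst_continuous.
by exists A => // t th _ Dth; apply: HA => //; rewrite ler01 lexx.
Qed.

Lemma TL_eq (phi psi : R -> Th -> R) :
  (forall t th, Dom th -> phi t th = psi t th) -> TL phi -> TL psi.
Proof.
move=> E [c [A A0 HA]]; split=> [th Dth|].
  by rewrite (_ : psi^~ th = phi^~ th); [exact: c|apply: funext => t; rewrite E].
exists A => // t th t01 Dth; have [h1 h2] := HA t th t01 Dth; rewrite -E//; split => //.
by move=> th' de Dth' D; rewrite -E//; exact: h2.
Qed.

End TL_algebra.

(** * Contractions on classes of functions *)

Section fixpoint.
Context {R : realType} {S : Type}.
Implicit Types (f g : R -> S -> R) (E : (R -> S -> R) -> Prop).

Lemma geometric_cvg (u : nat -> R) (c k : R) : 0 <= k -> k < 1 ->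
  (forall m, `|u m.+1 - u m| <= c * k ^+ m) ->
  exists l : R, forall m, `|u m - l| <= c * k ^+ m / (1 - k).
Proof.
move=> k0 k1 H.
have k1' : 0 < 1 - k by rewrite subr_gt0.
have c0 : 0 <= c by have := le_trans (normr_ge0 _) (H 0%N); rewrite expr0 mulr1.
have Hd m j : `|u (m + j)%N - u m| <= c * k ^+ m * (1 - k ^+ j) / (1 - k).
  elim: j => [|j IH]; first by rewrite addn0 !subrr normr0 mulr0 mul0r.
  rewrite addnS -(subrKA (u (m + j)%N)) (le_trans (ler_normD _ _))//.
  apply: (le_trans (lerD (H _) IH)).
  rewrite exprD exprS le_eqVlt; apply/orP; left; apply/eqP; field.
  by rewrite gt_eqF.
have Hd' m j : (m <= j)%N -> `|u j - u m| <= c * k ^+ m / (1 - k).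
  move=> mj; rewrite -(subnKC mj) (le_trans (Hd _ _))// ler_wpM2r ?invr_ge0 ?(ltW k1')//.
  by rewrite ler_piMr ?mulr_ge0 ?exprn_ge0// gerBl exprn_ge0.
have cvu : cvgn u.
  apply/cauchy_cvgP; apply: cauchy_exP => e e0.
  have := @cvg_geometric R (c / (1 - k)) k; rewrite ger0_norm// => /(_ k1)/cvgrPdist_lt.
  move=> /(_ _ e0)[N _ HN]; exists (u N); exists N => // j Nj /=.
  rewrite -ball_normE /= distrC (le_lt_trans (Hd' _ _ Nj))//.
  have := HN N (leqnn _).
  by rewrite /geometric /= sub0r normrN; apply: le_lt_trans; rewrite mulrAC ler_norm.
exists (limn u) => m; rewrite distrC.
have cv : `|u j - u m| @[j --> \oo] --> `|limn u - u m|.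
  by apply: cvg_norm; apply: cvgB => //; exact: cvg_cst.
rewrite -(cvg_lim _ cv)//; apply: limr_le; first by apply/cvg_ex; eexists; exact: cv.
by exists m => // j /= mj; exact: Hd'.
Qed.

(** Banach's fixed point theorem for the sup distance: the complete space is a class [E] closed
    under uniform limits, and the common bound [B] makes the distance of the first two iterates
    finite. *)
Lemma contraction_fixpoint E (T : (R -> S -> R) -> R -> S -> R) (k B : R) f0 : 0 <= k -> k < 1 ->
  E f0 -> (forall f, E f -> E (T f)) -> (forall f, E f -> forall t i, `|f t i| <= B) ->
  (forall f g de, E f -> E g -> (forall t i, `|f t i - g t i| <= de) ->
    forall t i, `|T f t i - T g t i| <= k * de) ->
  (forall (F : nat -> R -> S -> R) f, (forall m, E (F m)) ->
    (forall e, 0 < e -> exists m, forall t i, `|F m t i - f t i| <= e) -> E f) ->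
  exists2 f, E f & forall t i, T f t i = f t i.
Proof.
move=> k0 k1 E0 ET EB Tk Ecl; pose F m := iter m T f0.
have EF m : E (F m) by elim: m => //= m; exact: ET.
have k1' : 0 < 1 - k by rewrite subr_gt0.
have step m t i : `|F m.+1 t i - F m t i| <= (2 * B) * k ^+ m.
  elim: m t i => [|m IH] t i.
    rewrite expr0 mulr1 mulr_natl mulr2n (le_trans (ler_normB _ _))// lerD//.
      exact: EB (EF 1%N) _ _.
    exact: EB (EF 0%N) _ _.
  have := Tk _ _ _ (EF m.+1) (EF m) IH t i.
  by rewrite exprS mulrCA.
have /choice[f Hf] t : exists f : S -> R, forall i m, `|F m t i - f i| <= 2 * B * k ^+ m / (1 - k).
  have /choice[f Hf] i := @geometric_cvg (fun m => F m t i) (2 * B) k k0 k1 (fun m => step m t i).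
  by exists f => i m; exact: Hf.
have near e : 0 < e -> exists m, forall t i, `|F m t i - f t i| <= e.
  move=> e0.
  have := @cvg_geometric R (2 * B / (1 - k)) k; rewrite ger0_norm// => /(_ k1)/cvgrPdist_lt.
  move=> /(_ _ e0)[N _ HN]; exists N => t i; rewrite (le_trans (Hf t i N))//.
  have := HN N (leqnn _); rewrite /geometric /= sub0r normrN => /ltW; apply: le_trans.
  by rewrite mulrAC ler_norm.
have Ef : E f by exact: Ecl EF near.
exists f => // t i; apply/eqP; rewrite -subr_eq0 -normr_le0; apply/ler_addgt0Pr => e e0.
rewrite add0r.
have e20 : 0 < e / 2 by rewrite divr_gt0.
have [m Hm] : exists m, (forall t i, `|F m t i - f t i| <= e / 2) /\ `|F m.+1 t i - f t i| <= e / 2.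
  have := @cvg_geometric R (2 * B / (1 - k)) k; rewrite ger0_norm// => /(_ k1)/cvgrPdist_lt.
  move=> /(_ _ e20)[N _ HN]; exists N.
  have bd j : (N <= j)%N -> forall t i, `|F j t i - f t i| <= e / 2.
    move=> Nj t' i'; rewrite (le_trans (Hf t' i' j))//.
    have := HN j Nj; rewrite /geometric /= sub0r normrN => /ltW; apply: le_trans.
    by rewrite mulrAC ler_norm.
  by split; [exact: bd|apply: bd].
rewrite -(subrKA (F m.+1 t i)) (le_trans (ler_normD _ _))// (splitr e) lerD ?Hm.2//.
have := Tk _ _ _ Ef (EF m) (fun t i => _ : `|f t i - F m t i| <= e / 2) t i.
move=> H; apply: le_trans (H _) _; first by move=> t' i'; rewrite distrC; exact: Hm.1.
by rewrite ler_piMl ?(ltW e20)// ltW.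
Qed.

(** The supremum [x] of the distances, finite thanks to [B], satisfies [x <= k x + c]. This turns a
    contraction into Lipschitz dependence of its fixed point on a parameter. *)
Lemma fixpoint_dist f g (k c B : R) : 0 <= k -> k < 1 -> 0 <= c ->
  (forall t i, `|f t i - g t i| <= B) ->
  (forall de, (forall t i, `|f t i - g t i| <= de) -> forall t i, `|f t i - g t i| <= k * de + c) ->
  forall t i, `|f t i - g t i| <= c / (1 - k).
Proof.
move=> k0 k1 c0 HB H t i; have k1' : 0 < 1 - k by rewrite subr_gt0.
pose A := [set x | exists t i, x = `|f t i - g t i|].
have supA : has_sup A.
  by split; [exists `|f t i - g t i|, t, i|exists B => _ [t' [i' ->]]].
have ub t' i' : `|f t' i' - g t' i'| <= sup A by apply: sup_upper_bound => //; exists t', i'.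
have : sup A <= k * sup A + c.
  apply: ge_sup; first exact: supA.1.
  by move=> _ [t' [i' ->]]; exact: H.
move=> h; rewrite (le_trans (ub t i))// ler_pdivlMr// mulrBr mulr1.
by move: h; rewrite mulrC; lra.
Qed.

End fixpoint.

(** * Matrices acting on families of coordinates *)

Section matrix_action.
Context {R : realType} {n : nat}.

Definition mv (A : 'M[R]_n) (u : 'I_n -> R) (i : 'I_n) : R := \sum_j A i j * u j.

Lemma mvD A u v i : mv A (fun j => u j + v j) i = mv A u i + mv A v i.
Proof. by rewrite -big_split; apply: eq_bigr => j _; rewrite mulrDr. Qed.

Lemma mvZ A c u i : mv A (fun j => c * u j) i = c * mv A u i.
Proof. by rewrite mulr_sumr; apply: eq_bigr => j _; rewrite mulrCA. Qed.

Lemma mvN A u i : mv A (fun j => - u j) i = - mv A u i.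
Proof. by rewrite -sumrN; apply: eq_bigr => j _; rewrite mulrN. Qed.

Lemma mvB A u v i : mv A (fun j => u j - v j) i = mv A u i - mv A v i.
Proof. by rewrite mvD mvN. Qed.

Lemma eq_mv A u v i : (forall j, u j = v j) -> mv A u i = mv A v i.
Proof. by move=> uv; apply: eq_bigr => j _; rewrite uv. Qed.

Lemma mv0 A i : mv A (fun=> 0) i = 0.
Proof. by rewrite /mv big1// => j _; rewrite mulr0. Qed.

Lemma mv_mul A B u i : mv A (mv B u) i = mv (A *m B) u i.
Proof.
rewrite /mv; under eq_bigr => j _ do rewrite mulr_sumr.
rewrite exchange_big; apply: eq_bigr => k _ /=; rewrite mxE mulr_suml.
by apply: eq_bigr => j _; rewrite mulrA.
Qed.

Lemma der_mv (A : 'M[R]_n) (u : 'I_n -> R -> R) (u' : 'I_n -> R) (t : R) i :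
  (forall j, is_derive t 1 (u j) (u' j)) ->
  is_derive t 1 (fun t => mv A (fun j => u j t) i) (mv A u' i).
Proof. by move=> du; apply: dersum => j; exact: derMl. Qed.

Lemma TL_mv {Th : Type} (Dom : Th -> Prop) (dst : Th -> Th -> R -> Prop) (A : 'M[R]_n)
    (u : 'I_n -> R -> Th -> R) i : (forall th th' de, dst th th' de -> 0 <= de) ->
  (forall j, TL Dom dst (u j)) -> TL Dom dst (fun t th => mv A (fun j => u j t th) i).
Proof. by move=> d0 Hu; apply: TL_sum => // j; apply: TL_mul => //; exact: TL_cst. Qed.

End matrix_action.

(** * The linear boundary value problem with forcing *)

Section forced_system.
Context {R : realType} {n : nat} (J : 'M[R]_n) (alf : 'I_n -> R).
Hypothesis alf_gt0 : forall i, 0 < alf i.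
Hypothesis J2 : J *m J = - diag_mx (\row_i alf i ^+ 2).

Lemma mvJJ u i : mv J (mv J u) i = - (alf i ^+ 2 * u i).
Proof.
rewrite mv_mul J2 /mv (bigD1 i)//= big1 ?addr0; first by rewrite !mxE eqxx mulr1n mulNr.
by move=> j ji; rewrite !mxE eq_sym (negbTE ji) mulr0n oppr0 mul0r.
Qed.

Lemma alf_neq0 i : alf i != 0. Proof. by rewrite gt_eqF. Qed.

(** [J] commutes with its own square, which is diagonal, so it only couples indices with equal
    frequencies. *)
Lemma J_comm i j : J i j != 0 -> alf i = alf j.
Proof.
move=> Jij; have /matrixP/(_ i j) : J *m (J *m J) = (J *m J) *m J by rewrite mulmxA.
rewrite J2 mulmxN mulNmx mul_mx_diag mul_diag_mx !mxE => /oppr_inj/eqP.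
rewrite mulrC -subr_eq0 -mulrBl mulf_eq0 (negbTE Jij) orbF subr_eq0.
by rewrite eqrXn2 ?ltW// => /eqP ->.
Qed.

(** Functions of the frequencies commute with [J]; this gives closed formulas without decomposing
    [J] into blocks. *)
Lemma mvJ_diag (phi : R -> R) u i : mv J (fun j => phi (alf j) * u j) i = phi (alf i) * mv J u i.
Proof.
rewrite mulr_sumr; apply: eq_bigr => j _; have [->|/J_comm ->] := eqVneq (J i j) 0.
  by rewrite !mul0r mulr0.
by rewrite mulrCA.
Qed.

(** The exponential of [s t J], since [J / alf] squares to [- 1]; [rotn] is its inverse, the
    exponential of [- s t J]. *)
Definition rot (s t : R) u i :=
  cos (s * t * alf i) * u i + sin (s * t * alf i) / alf i * mv J u i.
Definition rotn (s t : R) u i :=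
  cos (s * t * alf i) * u i - sin (s * t * alf i) / alf i * mv J u i.

Lemma rotD s t u v i : rot s t (fun j => u j + v j) i = rot s t u i + rot s t v i.
Proof. by rewrite /rot mvD; ring. Qed.

Lemma mvJ_rot s t u i : mv J (rot s t u) i =
  cos (s * t * alf i) * mv J u i - alf i * sin (s * t * alf i) * u i.
Proof.
rewrite /rot mvD (mvJ_diag (fun x => cos (s * t * x))).
rewrite (mvJ_diag (fun x => sin (s * t * x) / x)) mvJJ.
by field; exact: alf_neq0.
Qed.

Lemma rotK s t u i : rot s t (rotn s t u) i = u i.
Proof.
have E : mv J (rotn s t u) i = cos (s * t * alf i) * mv J u i + alf i * sin (s * t * alf i) * u i.
  rewrite /rotn mvB (mvJ_diag (fun x => cos (s * t * x))).
  rewrite (mvJ_diag (fun x => sin (s * t * x) / x)) mvJJ.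
  by field; exact: alf_neq0.
rewrite /rot E /rotn; have := cos2Dsin2 (s * t * alf i).
set c := cos _; set sn := sin _ => cs.
transitivity ((c ^+ 2 + sn ^+ 2) * u i); last by rewrite cs mul1r.
by field; exact: alf_neq0.
Qed.

Local Notation S := ('I_n + 'I_n + bool)%type.
Implicit Types (s : R) (f : R -> S -> R) (xi : 'I_n -> R).

Definition frcX f (t : R) (j : 'I_n) := f t (inl (inl j)).
Definition frcU f (t : R) (j : 'I_n) := f t (inl (inr j)).

(** Variation of constants: [U t = rot s t (U0 + fI t)]. *)
Definition fI s f i : R -> R := prim (fun t => rotn s t (frcU f t) i).
(** Integrating [U' - s J X' = f_U - s J f_X] gives [U - U0 - s J X = fQ], which ties the endpoint
    of [X] to that of [U]. *)
Definition fQ s f i : R -> R := prim (fun t => frcU f t i - s * mv J (frcX f t) i).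
Definition fG xi s f i := s * mv J xi i + (fQ s f i 1 - rot s 1 (fun j => fI s f j 1) i).
(** In other terms [cot (s alf / 2) / (2 alf)]; the inverse of [rot s 1 - 1] is
    [- 1 / 2 - sig J]. *)
Definition sig s i := sin (s * alf i) * (alf i * (2 - 2 * cos (s * alf i)))^-1.
(* The solution of [X' = U + f_X, U' = s J U + f_U, X 0 = 0, X 1 = xi]: the initial velocity
   [fU0] solves [rot s 1 U0 - U0 = fG], which is possible off the resonances. *)
Definition fU0 xi s f i := - (2^-1 * fG xi s f i) - sig s i * mv J (fG xi s f) i.
Definition fU xi s f i t := rot s t (fun j => fU0 xi s f j + fI s f j t) i.
(** Solves [s J X = U - U0 - fQ] for [X], the inverse of [J] being [- alf ^ -2 J]. *)
Definition fX xi s f i t :=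
  - ((s * alf i ^+ 2)^-1 * mv J (fun j => fU xi s f j t - fU0 xi s f j - fQ s f j t) i).

(** [2 - 2 cos x] is the squared modulus of [exp (i x) - 1]: the condition says that [rot s 1] fixes
    no nonzero vector. *)
Definition nonresonant s := forall i, 2 - 2 * cos (s * alf i) != 0.

Lemma rot_fU0 xi s f i : nonresonant s -> rot s 1 (fU0 xi s f) i - fU0 xi s f i = fG xi s f i.
Proof.
move=> nr; set G := fG xi s f.
have E : mv J (fU0 xi s f) i = - (2^-1 * mv J G i) + sig s i * (alf i ^+ 2 * G i).
  rewrite /fU0 -/G mvB mvN mvZ (mvJ_diag (fun x => sin (s * x) * (x * (2 - 2 * cos (s * x)))^-1)).
  by rewrite mvJJ mulrN opprK.
rewrite /rot E mulr1 /fU0 -/G /sig; have := cos2Dsin2 (s * alf i); have := nr i.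
set c := cos _; set sn := sin _ => dn cs.
have sn2 : sn ^+ 2 = 1 - c ^+ 2 by rewrite -cs addrC addKr.
transitivity ((1 - c) / 2 * G i + sn ^+ 2 / (2 - 2 * c) * G i).
  by field; rewrite dn alf_neq0.
by rewrite sn2; field.
Qed.

Definition cont_frc f := forall i, cont01 (fun t => f t i).

Lemma cont01_cos (s a : R) : cont01 (fun t => cos (s * t * a)).
Proof.
move=> t _; apply: (@lip_for_continuous _ _ _ (`|s| * `|a|) 1) => // r _.
by rewrite (le_trans (norm_cos_sub _ _))// -mulrBl -mulrBr !normrM mulrAC.
Qed.

Lemma cont01_sin (s a : R) : cont01 (fun t => sin (s * t * a)).
Proof.
move=> t _; apply: (@lip_for_continuous _ _ _ (`|s| * `|a|) 1) => // r _.
by rewrite (le_trans (norm_sin_sub _ _))// -mulrBl -mulrBr !normrM mulrAC.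
Qed.

Lemma cont01_add (f g : R -> R) : cont01 f -> cont01 g -> cont01 (fun t => f t + g t).
Proof. by move=> cf cg t t01; exact: continuousD (cf t t01) (cg t t01). Qed.

Lemma cont01_mul (f g : R -> R) : cont01 f -> cont01 g -> cont01 (fun t => f t * g t).
Proof. by move=> cf cg t t01; exact: continuousM (cf t t01) (cg t t01). Qed.

Lemma cont01_cst (c : R) : cont01 (fun=> c).
Proof. by move=> t _; exact: cst_continuous. Qed.

Lemma cont01_opp (f : R -> R) : cont01 f -> cont01 (fun t => - f t).
Proof. by move=> cf t t01; exact: continuousN (cf t t01). Qed.

Lemma cont01_sum m (f : 'I_m -> R -> R) : (forall i, cont01 (f i)) -> cont01 (fun t => \sum_i f i t).
Proof.
elim: m f => [|m IH] f H.
  by rewrite (_ : (fun t => _) = fun=> 0); [exact: cont01_cst|apply: funext => t; rewrite big_ord0].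
rewrite (_ : (fun t => _) = (fun t => (\sum_(i < m) f (widen_ord (leqnSn m) i) t) + f ord_max t)).
  by apply: cont01_add => //; apply: IH => i; exact: H.
by apply: funext => t; rewrite big_ord_recr.
Qed.

Lemma cont_rotn s f i : cont_frc f -> cont01 (fun t => rotn s t (frcU f t) i).
Proof.
move=> cf; apply: cont01_add.
  by apply: cont01_mul; [exact: cont01_cos|exact: cf].
apply: cont01_opp; apply: cont01_mul.
  by apply: cont01_mul; [exact: cont01_sin|exact: cont01_cst].
by apply: cont01_sum => j; apply: cont01_mul; [exact: cont01_cst|exact: cf].
Qed.

Lemma cont_fQ s f i : cont_frc f -> cont01 (fun t => frcU f t i - s * mv J (frcX f t) i).
Proof.
move=> cf; apply: cont01_add; first exact: cf.
apply: cont01_opp; apply: cont01_mul; first exact: cont01_cst.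
by apply: cont01_sum => j; apply: cont01_mul; [exact: cont01_cst|exact: cf].
Qed.

Lemma der_cos_st s (a t : R) : is_derive t 1 (fun t => cos (s * t * a)) (- (s * a * sin (s * t * a))).
Proof.
have dl : is_derive t 1 (fun t : R => s * t * a) (s * a).
  apply: (der_eq (derM (derMl s (derid t)) (dercst t a))).
  by rewrite mulr1 mulr0 addr0.
have := @is_derive1_comp _ cos (fun t => s * t * a) t _ _ (is_derive_cos _) dl.
by move/der_eq; apply; rewrite mulNr mulrC.
Qed.

Lemma der_sin_st s (a t : R) : is_derive t 1 (fun t => sin (s * t * a)) (s * a * cos (s * t * a)).
Proof.
have dl : is_derive t 1 (fun t : R => s * t * a) (s * a).
  apply: (der_eq (derM (derMl s (derid t)) (dercst t a))).
  by rewrite mulr1 mulr0 addr0.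
have := @is_derive1_comp _ sin (fun t => s * t * a) t _ _ (is_derive_sin _) dl.
by move/der_eq; apply; rewrite mulrC.
Qed.

Lemma fU_der xi s f i (t : R) : cont_frc f -> 0 <= t <= 1 ->
  is_derive t 1 (fU xi s f i) (s * mv J (fun j => fU xi s f j t) i + frcU f t i).
Proof.
move=> cf t01; pose u j t := fU0 xi s f j + fI s f j t.
have du j : is_derive t 1 (u j) (rotn s t (frcU f t) j).
  apply: (der_eq (derD (dercst t _) (prim_der (@cont_rotn s f j cf) t01))).
  by rewrite add0r.
have dU := derD (derM (der_cos_st s (alf i) t) (du i))
  (derM (derM (der_sin_st s (alf i) t) (dercst t (alf i)^-1)) (der_mv J i du)).
apply: (der_eq dU).
rewrite -[in RHS](rotK s t (frcU f t) i) /rot.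
rewrite (_ : mv J (fun j => fU xi s f j t) i = mv J (rot s t (u ^~ t)) i)// mvJ_rot.
by field; exact: alf_neq0.
Qed.

Lemma fX_der xi s f i (t : R) : s != 0 -> cont_frc f -> 0 <= t <= 1 ->
  is_derive t 1 (fX xi s f i) (fU xi s f i t + frcX f t i).
Proof.
move=> s0 cf t01.
have d1 j := derB (derB (@fU_der xi s f j t cf t01) (dercst t (fU0 xi s f j)))
  (prim_der (@cont_fQ s f j cf) t01).
apply: (der_eq (derN (derMl (s * alf i ^+ 2)^-1 (der_mv J i d1)))).
rewrite (@eq_mv _ _ _ _ (fun j => s * mv J (fun k => fU xi s f k t + frcX f t k) j)); last first.
  by move=> j; rewrite [in RHS](mvD J ((fU xi s f)^~ t) (frcX f t)); ring.
rewrite mvZ mvJJ; field.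
by rewrite s0 alf_neq0.
Qed.

Lemma fU_0 xi s f i : fU xi s f i 0 = fU0 xi s f i.
Proof.
rewrite /fU /rot mulr0 mul0r cos0 sin0 mul0r mul0r addr0 mul1r.
by rewrite /fI prim0 addr0.
Qed.

Lemma fX_0 xi s f i : fX xi s f i 0 = 0.
Proof.
rewrite /fX (@eq_mv _ _ _ _ (fun=> 0)) ?mv0 ?mulr0 ?oppr0//.
by move=> j; rewrite fU_0 subrr sub0r /fQ prim0 oppr0.
Qed.

Lemma fX_1 xi s f i : s != 0 -> nonresonant s -> fX xi s f i 1 = xi i.
Proof.
move=> s0 nr; rewrite /fX (@eq_mv _ _ _ _ (fun j => s * mv J xi j)); last first.
  move=> j; rewrite /fU rotD; have := rot_fU0 xi f j nr; rewrite /fG => /eqP.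
  by rewrite subr_eq => /eqP ->; ring.
by rewrite mvZ mvJJ; field; rewrite s0 alf_neq0.
Qed.

Variables (s1 s2 Cf : R).
Hypotheses (s1_gt0 : 0 < s1) (s12 : s1 <= s2) (Cf_ge0 : 0 <= Cf).
Hypothesis nonres : forall s, s1 <= s <= s2 -> nonresonant s.

Local Notation Th := (R * (R -> S -> R))%type.

Definition DomF (th : Th) :=
  [/\ s1 <= th.1 <= s2, cont_frc th.2 & forall t i, `|th.2 t i| <= Cf].
(** A bound for the distance instead of the distance itself: no supremum over times and coordinates
    has to be formed. *)
Definition dstF (th th' : Th) (de : R) :=
  [/\ 0 <= de, `|th.1 - th'.1| <= de & forall t i, `|th.2 t i - th'.2 t i| <= de].

Lemma dstF_ge0 th th' de : dstF th th' de -> 0 <= de. Proof. by case. Qed.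

Local Notation TLF := (TL DomF dstF).
Local Notation tl_cst := (TL_cst DomF dstF_ge0).
Local Notation tl_mv := (TL_mv _ _ dstF_ge0).
Local Notation tl_opp := (TL_opp dstF_ge0).

Lemma TL_frc i : TLF (fun t th => th.2 t i).
Proof.
split=> [th [_ cf _]|]; first exact: cf.
exists (Cf + 1); first exact: addr_ge0.
move=> t th t01 [_ _ b]; split; first by rewrite (le_trans (b t i))// lerDl.
by move=> th' de _ [de0 _ d]; rewrite (le_trans (d t i))// ler_peMl// lerDr.
Qed.

Lemma TL_s : TLF (fun t th => th.1).
Proof.
split=> [th _|]; first exact: cont01_cst.
exists (s2 + 1); first by rewrite addr_ge0// (le_trans (ltW s1_gt0)).
move=> t th t01 [/andP[h1 h2] _ _]; split.
  by rewrite ger0_norm ?(le_trans (ltW s1_gt0))// (le_trans h2)// lerDl.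
move=> th' de _ [de0 d _]; rewrite (le_trans d)// ler_peMl// lerDr.
by rewrite (le_trans (ltW s1_gt0)).
Qed.

Lemma TL_cos (a : R) : TLF (fun t th => cos (th.1 * t * a)).
Proof.
split=> [th _|]; first exact: cont01_cos.
exists (1 + `|a|); first by rewrite addr_ge0.
move=> t th t01 _; split; first by rewrite (le_trans (cos_max _))// lerDl.
move=> th' de _ [de0 d _]; rewrite (le_trans (norm_cos_sub _ _))// -mulrBl -mulrBl !normrM.
have /andP[t0 t1] := t01; rewrite (ger0_norm t0) mulrC (@le_trans _ _ (`|a| * de))//.
  by rewrite ler_wpM2l// (le_trans _ d)// ler_piMr.
by rewrite ler_wpM2r// lerDr.
Qed.

Lemma TL_sin (a : R) : TLF (fun t th => sin (th.1 * t * a)).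
Proof.
split=> [th _|]; first exact: cont01_sin.
exists (1 + `|a|); first by rewrite addr_ge0.
move=> t th t01 _; split; first by rewrite (le_trans (sin_max _))// lerDl.
move=> th' de _ [de0 d _]; rewrite (le_trans (norm_sin_sub _ _))// -mulrBl -mulrBl !normrM.
have /andP[t0 t1] := t01; rewrite (ger0_norm t0) mulrC (@le_trans _ _ (`|a| * de))//.
  by rewrite ler_wpM2l// (le_trans _ d)// ler_piMr.
by rewrite ler_wpM2r// lerDr.
Qed.

Lemma TL_rot (u : 'I_n -> R -> Th -> R) i : (forall j, TLF (u j)) ->
  TLF (fun t th => rot th.1 t (fun j => u j t th) i).
Proof.
move=> Hu; apply: TL_add; first by apply: TL_mul => //; exact: TL_cos.
apply: TL_mul; last exact: tl_mv.
by apply: TL_mul; [exact: TL_sin|exact: tl_cst].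
Qed.

Lemma TL_fI i : TLF (fun t th => fI th.1 th.2 i t).
Proof.
apply: (@TL_prim _ _ _ _ (fun t th => rotn th.1 t (frcU th.2 t) i)).
apply: TL_add; first by apply: TL_mul; [exact: TL_cos|exact: TL_frc].
apply: tl_opp; apply: TL_mul; last by apply: tl_mv => j; exact: TL_frc.
by apply: TL_mul; [exact: TL_sin|exact: tl_cst].
Qed.

Lemma TL_fQ i : TLF (fun t th => fQ th.1 th.2 i t).
Proof.
apply: (@TL_prim _ _ _ _ (fun t th => frcU th.2 t i - th.1 * mv J (frcX th.2 t) i)).
apply: TL_add; first exact: TL_frc.
by apply: tl_opp; apply: TL_mul; [exact: TL_s|apply: tl_mv => j; exact: TL_frc].
Qed.

Lemma TL_fG xi i : TLF (fun t th => fG xi th.1 th.2 i).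
Proof.
apply: TL_add; first by apply: TL_mul; [exact: TL_s|exact: tl_cst].
apply: TL_add; first exact: (TL_at1 (TL_fQ i)).
apply: tl_opp.
exact: (TL_at1 (@TL_rot (fun j t th => fI th.1 th.2 j t) i (fun j => TL_fI j))).
Qed.

Lemma TL_sig i : TLF (fun t th => sig th.1 i).
Proof.
have c1 : TLF (fun t th => cos (th.1 * alf i)).
  by apply: TL_eq (TL_at1 (TL_cos (alf i))) => t th _; rewrite mulr1.
have n1 : TLF (fun t th => sin (th.1 * alf i)).
  by apply: TL_eq (TL_at1 (TL_sin (alf i))) => t th _; rewrite mulr1.
apply: TL_mul => //.
(* The denominator is continuous and positive on the compact interval [[s1, s2]], so its minimum is
   a lower bound uniform in the parameter. *)
have [|c cs Hc] := @EVT_min R (fun s => alf i * (2 - 2 * cos (s * alf i))) s1 s2 s12.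
  apply: continuous_subspaceT => s.
  apply: (@lip_for_continuous _ _ _ (alf i * (2 * alf i)) 1) => // r _.
  rewrite -mulrBr opprD addrACA subrr add0r opprK addrC -mulrBr !normrM.
  rewrite -[leRHS]mulrA -[X in _ <= _ * X]mulrA (gtr0_norm (alf_gt0 i)) ler_wpM2l ?(ltW (alf_gt0 i))//.
  rewrite ger0_norm// ler_wpM2l// (le_trans (norm_cos_sub _ _))// -mulrBl normrM.
  by rewrite (gtr0_norm (alf_gt0 i)) mulrC distrC.
have cs' : s1 <= c <= s2 by move: cs; rewrite in_itv.
apply: (@TL_inv _ _ _ _ dstF_ge0 _ (alf i * (2 - 2 * cos (c * alf i)))).
- apply: mulr_gt0 => //; have := nonres cs' i; rewrite lt_neqAle eq_sym => ->.
  by have /ler_normlP[_ h] := cos_max (c * alf i); rewrite subr_ge0 ler_piMr.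
- by move=> t th _ [hs _ _]; apply: Hc; rewrite in_itv.
apply: TL_mul; first exact: tl_cst.
by apply: TL_add; [exact: tl_cst|apply: tl_opp; apply: TL_mul => //; exact: tl_cst].
Qed.

Lemma TL_fU0 xi i : TLF (fun t th => fU0 xi th.1 th.2 i).
Proof.
apply: TL_add; apply: tl_opp; apply: TL_mul; [exact: tl_cst|exact: TL_fG|exact: TL_sig|].
by apply: tl_mv => j; exact: TL_fG.
Qed.

Lemma TL_fU xi i : TLF (fun t th => fU xi th.1 th.2 i t).
Proof.
apply: (@TL_rot (fun j t th => fU0 xi th.1 th.2 j + fI th.1 th.2 j t)) => j.
by apply: TL_add; [exact: TL_fU0|exact: TL_fI].
Qed.

Lemma TL_fX xi i : TLF (fun t th => fX xi th.1 th.2 i t).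
Proof.
apply: tl_opp; apply: TL_mul.
  have a0 : 0 < alf i ^+ 2 by rewrite exprn_gt0.
  apply: (@TL_inv _ _ _ _ dstF_ge0 _ (s1 * alf i ^+ 2)); first exact: mulr_gt0.
    by move=> t th _ [/andP[h _] _ _]; rewrite ler_wpM2r// ltW.
  by apply: TL_mul; [exact: TL_s|exact: tl_cst].
apply: (TL_mv (u := fun j t th => fU xi th.1 th.2 j t - fU0 xi th.1 th.2 j - fQ th.1 th.2 j t) _ _ dstF_ge0) => j.
apply: TL_add; last by apply: tl_opp; exact: TL_fQ.
by apply: TL_add; [exact: TL_fU|apply: tl_opp; exact: TL_fU0].
Qed.

(** [Z] and [mu] have no unperturbed dynamics and start at 0, so they are the primitives of their
    forcing. *)
Definition st xi s f (i : S) : R -> R :=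
  match i with
  | inl (inl j) => fX xi s f j
  | inl (inr j) => fU xi s f j
  | inr b => prim (fun t => f t (inr b))
  end.

Lemma TL_st xi i : TLF (fun t th => st xi th.1 th.2 i t).
Proof.
case: i => [[j|j]|b]; [exact: TL_fX|exact: TL_fU|].
by apply: (@TL_prim _ _ _ _ (fun t th => th.2 t (inr b))); exact: TL_frc.
Qed.

End forced_system.

(** * Increments of smooth functions divided by powers of [eta] *)

Section TL_nonlinear.
Context {R : realType} {d : nat} {Th : Type} (Dom : Th -> Prop) (dst : Th -> Th -> R -> Prop).
Hypothesis dst_ge0 : forall th th' de, dst th th' de -> 0 <= de.

Lemma TL_proj {Th' : Type} (Dom' : Th' -> Prop) (dst' : Th' -> Th' -> R -> Prop) (pr : Th' -> Th)
    (phi : R -> Th -> R) :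
  (forall th, Dom' th -> Dom (pr th)) ->
  (forall th th' de, dst' th th' de -> dst (pr th) (pr th') de) ->
  TL Dom dst phi -> TL Dom' dst' (fun t th => phi t (pr th)).
Proof.
move=> HD Hd [c1 [A A0 HA]]; split=> [th /HD/c1//|].
exists A => // t th t01 /HD Dth; have [h1 h2] := HA t _ t01 Dth; split => // th' de /HD Dth' /Hd.
exact: h2.
Qed.

Variable eta : Th -> R.
Hypothesis eta_dom : forall th, Dom th -> 0 < eta th <= 1.
Hypothesis eta_dst : forall th th' de, dst th th' de -> eta th = eta th'.

Local Notation TLn := (TL Dom dst).

Lemma TL_eta : TLn (fun _ th => eta th).
Proof.
split=> [th _ t _|]; first exact: cst_continuous.
exists 1 => // t th _ /eta_dom/andP[h0 h1]; split; first by rewrite gtr0_norm.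
by move=> th' de _ D; rewrite (eta_dst D) subrr normr0 mul1r (dst_ge0 D).
Qed.

Variables (y1 : R -> Th -> 'rV[R]_d).
Hypothesis y1_TL : forall l, TLn (fun t th => y1 t th 0 l).

Lemma TL_vec : exists2 C : R, 0 <= C & forall t th, 0 <= t <= 1 -> Dom th -> `|y1 t th| <= C /\
    forall th' de, Dom th' -> dst th th' de -> `|y1 t th - y1 t th'| <= C * de.
Proof.
have /choice[C HC] l : exists C : R, 0 <= C /\ forall t th, 0 <= t <= 1 -> Dom th ->
    `|y1 t th 0 l| <= C /\
    forall th' de, Dom th' -> dst th th' de -> `|y1 t th 0 l - y1 t th' 0 l| <= C * de.
  by have [_ [C C0 HC]] := y1_TL l; exists C.
have Cl l : C l <= \sum_l C l.
  by rewrite (bigD1 l)//= lerDl sumr_ge0// => k _; case: (HC k).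
have S0 : 0 <= \sum_l C l by apply: sumr_ge0 => k _; case: (HC k).
exists (\sum_l C l) => // t th t01 Dth; split.
  apply: mx_norm_le => // i l; rewrite ord1.
  by have [_ /(_ t th t01 Dth)[h _]] := HC l; rewrite (le_trans h).
move=> th' de Dth' D; have de0 := dst_ge0 D; apply: mx_norm_le; first exact: mulr_ge0.
move=> i l; rewrite ord1 !mxE; have [_ /(_ t th t01 Dth)[_ h]] := HC l.
by rewrite (le_trans (h _ _ Dth' D))// ler_wpM2r.
Qed.

Variables (y0 : 'rV[R]_d) (rho : R).
Let yv t th := y0 + (eta th ^+ 2) *: y1 t th.
Hypothesis y_box : forall t th, 0 <= t <= 1 -> Dom th -> `|yv t th - y0| < rho.

Lemma TL_yv_cont f (C : R) : 0 <= C ->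
  (forall x y, `|x - y0| <= rho -> `|y - y0| <= rho -> `|f y - f x| <= C * `|y - x|) ->
  forall th, Dom th -> cont01 (fun t => f (yv t th)).
Proof.
move=> C0 Hf th Dth t t01; apply/cvgrPdist_le => e e0.
have C1 : 0 < C + 1 by rewrite ltr_wpDl.
pose r := Num.min (rho - `|yv t th - y0|) (e / (C + 1)).
have r0 : 0 < r by rewrite lt_min subr_gt0 y_box//= divr_gt0.
have N : \forall s \near t, forall l, `|y1 t th 0 l - y1 s th 0 l| < r.
  apply: (@filter_forall R 'I_d (fun l s => `|y1 t th 0 l - y1 s th 0 l| < r) (nbhs t)
    (nbhs_filter t)) => l; have [c _] := y1_TL l.
  by have /cvgrPdist_lt := c th Dth t t01; apply.
have et := eta_dom Dth.
apply: filterS N => s N.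
have Hs : `|yv t th - yv s th| <= r.
  rewrite /yv opprD addrACA subrr add0r -scalerBr normrZ.
  have -> : `|eta th ^+ 2| = eta th ^+ 2 by rewrite ger0_norm// sqr_ge0.
  have e1 : eta th ^+ 2 <= 1 by case/andP: et => h0 h1; rewrite expr_le1// ltW.
  apply: (@le_trans _ _ `|y1 t th - y1 s th|); first by rewrite ler_piMl.
  apply: mx_norm_le; first exact: ltW.
  by move=> i l; rewrite ord1 !mxE ltW.
have yt := y_box t01 Dth.
have ys : `|yv s th - y0| <= rho.
  rewrite -(subrKA (yv t th)) (le_trans (ler_normD _ _))// distrC.
  by rewrite -lerBrDr (le_trans Hs)// ge_min lexx.
rewrite (le_trans (Hf _ _ ys (ltW yt)))//.
apply: (@le_trans _ _ ((C + 1) * r)).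
  by rewrite ler_pM// lerDl.
by rewrite -ler_pdivlMl// mulrC ge_min lexx orbT.
Qed.

(** [yv - y0] is of order [eta ^ 2], so the increment of [f] can be divided by [eta], with a factor
    [eta <= 1] to spare. *)
Lemma TL_quot1 f (C : R) : 0 <= C ->
  (forall x y, `|x - y0| <= rho -> `|y - y0| <= rho -> `|f y - f x| <= C * `|y - x|) ->
  TLn (fun t th => (f (yv t th) - f y0) / eta th).
Proof.
move=> C0 Hf; split=> [th Dth t t01|].
  apply: cvgM; last exact: cvg_cst.
  by apply: cvgB; [exact: (TL_yv_cont C0 Hf Dth)|exact: cvg_cst].
have [C1 C10 HC1] := TL_vec; exists (C * C1); first exact: mulr_ge0.
move=> t th t01 Dth; have [h1 h2] := HC1 t th t01 Dth; have /andP[e0 e1] := eta_dom Dth.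
have yt := ltW (y_box t01 Dth).
have r0 : 0 <= rho by apply: le_trans yt.
have y00 : `|y0 - y0| <= rho by rewrite subrr normr0.
split.
  rewrite normrM normfV (gtr0_norm e0) ler_pdivrMr// (le_trans (Hf _ _ y00 yt))//.
  rewrite /yv addrAC subrr add0r normrZ -mulrA ler_wpM2l//.
  rewrite ger0_norm ?sqr_ge0// mulrC ler_pM ?sqr_ge0//.
  by rewrite expr2 ler_piMl// ltW.
move=> th' de Dth' D; have de0 := dst_ge0 D; have yt' := ltW (y_box t01 Dth').
rewrite -(eta_dst D) -mulrBl opprB addrA subrK normrM normfV (gtr0_norm e0) ler_pdivrMr//.
rewrite (le_trans (Hf _ _ yt' yt))// /yv -(eta_dst D) opprD addrACA subrr add0r -scalerBr normrZ.
rewrite -!mulrA ler_wpM2l// ger0_norm ?sqr_ge0// mulrA mulrC ler_pM ?sqr_ge0 ?h2//.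
by rewrite expr2 ler_piMl// ltW.
Qed.

Lemma TL_lipcomp f (C : R) : 0 <= C ->
  (forall x y, `|x - y0| <= rho -> `|y - y0| <= rho -> `|f y - f x| <= C * `|y - x|) ->
  TLn (fun t th => f (yv t th)).
Proof.
move=> C0 Hf; have Q := TL_quot1 C0 Hf.
have := TL_add (TL_cst _ dst_ge0 (f y0)) (TL_mul TL_eta Q) => -[_ HQ]; split.
  by move=> th Dth; exact: TL_yv_cont C0 Hf _ Dth.
case: HQ => A A0 HA; exists A => // t th t01 Dth.
have E t' th' : Dom th' -> f y0 + eta th' * ((f (yv t' th') - f y0) / eta th') = f (yv t' th').
  by move=> /eta_dom/andP[h _]; rewrite mulrCA divff ?gt_eqF// mulr1 addrC subrK.
have [h1 h2] := HA t th t01 Dth; rewrite E// in h1 h2; split => // th' de Dth' D.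
by have := h2 _ _ Dth' D; rewrite E.
Qed.

(** Without its linear part the increment is of order [eta ^ 4], so division by [eta ^ 3] keeps the
    bound and the Lipschitz constant uniform in [eta]. *)
Lemma TL_quot2 f df (C : R) : 0 <= C -> C11 y0 rho C f df ->
  TLn (fun t th => (f (yv t th) - f y0 - eta th ^+ 2 * \sum_l df l y0 * y1 t th 0 l) / eta th ^+ 3).
Proof.
move=> C0 Hf; have Lf x y : `|x - y0| <= rho -> `|y - y0| <= rho -> `|f y - f x| <= C * `|y - x|.
  by move=> hx hy; have [] := Hf x y hx hy.
have TS : TLn (fun t th => \sum_l df l y0 * y1 t th 0 l).
  by apply: TL_sum => // l; apply: TL_mul => //; exact: TL_cst.
split=> [th Dth t t01|].
  apply: cvgM; last exact: cvg_cst.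
  apply: cvgB.
    by apply: cvgB; [exact: (TL_yv_cont C0 Lf Dth)|exact: cvg_cst].
  by apply: cvgM; [exact: cvg_cst|have [c _] := TS; exact: c].
have [C1 C10 HC1] := TL_vec.
have dC : 0 <= d%:R * C * C1 * C1 by rewrite !mulr_ge0.
exists (2 * C * C1 * C1 + C * C1 * C1 + d%:R * C * C1 * C1).
  by rewrite !addr_ge0 ?mulr_ge0.
move=> t th t01 Dth; have [h1 h2] := HC1 t th t01 Dth; have /andP[e0 e1] := eta_dom Dth.
have yt := ltW (y_box t01 Dth).
have r0 : 0 <= rho by apply: le_trans yt.
have y00 : `|y0 - y0| <= rho by rewrite subrr normr0.
have sub0 th' : eta th' = eta th -> yv t th' - y0 = eta th ^+ 2 *: y1 t th'.
  by move=> E; rewrite /yv E addrAC subrr add0r.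
have e2 : 0 <= eta th ^+ 2 by apply: sqr_ge0.
have e3 : 0 < eta th ^+ 3 by rewrite exprn_gt0.
have e43 (x : R) : 0 <= x -> eta th ^+ 4 * x <= x * eta th ^+ 3.
  by move=> x0; rewrite mulrC ler_wpM2l// exprS ler_piMl// ltW.
split.
  rewrite normrM normfV (gtr0_norm e3) ler_pdivrMr//.
  have [_ _ _ _] := Hf _ _ y00 yt; rewrite sub0// normrZ (ger0_norm e2) exprMn -exprM => H.
  rewrite (_ : _ * \sum_l _ = \sum_l df l y0 * (yv t th 0 l - y0 0 l)); last first.
    rewrite mulr_sumr; apply: eq_bigr => l _.
    by have := congr1 (fun v : 'rV_d => v 0 l) (sub0 th erefl); rewrite !mxE => ->; ring.
  rewrite (le_trans H)// mulrCA.
  apply: (@le_trans _ _ (C * C1 * C1 * eta th ^+ 3)).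
    apply: le_trans (e43 _ _); last by rewrite !mulr_ge0.
    by rewrite ler_wpM2l ?exprn_ge0 ?(ltW e0)// -mulrA ler_wpM2l// expr2 ler_pM.
  rewrite ler_wpM2r ?(ltW e3)// -addrA addrCA lerDl addr_ge0// !mulr_ge0//.
move=> th' de Dth' D; have de0 := dst_ge0 D; have yt' := ltW (y_box t01 Dth').
have E := esym (eta_dst D); have [h1' _] := HC1 t th' t01 Dth'.
rewrite E -mulrBl normrM normfV (gtr0_norm e3) ler_pdivrMr//.
have sub1 : yv t th - yv t th' = eta th ^+ 2 *: (y1 t th - y1 t th').
  by rewrite /yv E opprD addrACA subrr add0r -scalerBr.
have dlt := h2 _ _ Dth' D.
have [_ _ _ _] := Hf _ _ yt' yt; rewrite sub1 normrZ (ger0_norm e2) exprMn -exprM => H.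
have S1 : `|\sum_l (df l (yv t th') - df l y0) * (yv t th 0 l - yv t th' 0 l)| <=
    d%:R * C * C1 * C1 * de * eta th ^+ 4.
  rewrite (le_trans (ler_norm_sum _ _ _))//.
  rewrite -!mulrA mulr_natl -[X in _ *+ X]card_ord -sumr_const; apply: ler_sum => l _.
  have [_ _ _ /(_ l) g _] := Hf _ _ y00 yt'; rewrite sub0// normrZ (ger0_norm e2) in g.
  have g' : `|df l (yv t th') - df l y0| <= C * (eta th ^+ 2 * C1).
    by rewrite (le_trans g)// ler_wpM2l// ler_wpM2l.
  have k : `|yv t th 0 l - yv t th' 0 l| <= eta th ^+ 2 * (C1 * de).
    have := ler_mx_norm (yv t th - yv t th') 0 l; rewrite !mxE => /le_trans -> //.
    by rewrite sub1 normrZ (ger0_norm e2) ler_wpM2l.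
  rewrite normrM (le_trans (ler_pM _ _ g' k))// le_eqVlt; apply/orP; left; apply/eqP; ring.
have S2 : C * (eta th ^+ (2 * 2) * `|y1 t th - y1 t th'| ^+ 2) <= 2 * C * C1 * C1 * de * eta th ^+ 4.
  have b2 : `|y1 t th - y1 t th'| <= 2 * C1.
    by rewrite (le_trans (ler_normB _ _))// mulr_natl mulr2n lerD.
  have : `|y1 t th - y1 t th'| ^+ 2 <= 2 * C1 * (C1 * de) by rewrite expr2 ler_pM.
  move=> /(ler_wpM2l (exprn_ge0 4 (ltW e0)))/(ler_wpM2l C0)/le_trans; apply.
  by rewrite le_eqVlt; apply/orP; left; apply/eqP; ring.
(* The difference of two Taylor remainders at [y0] is the remainder between the two points plus the
   variation of [df] from [y0] times the increment; both are [O(eta ^ 4 de)]. *)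
rewrite (_ : _ - _ = (f (yv t th) - f (yv t th') - \sum_l df l (yv t th') * (yv t th 0 l - yv t th' 0 l))
   + \sum_l (df l (yv t th') - df l y0) * (yv t th 0 l - yv t th' 0 l)); last first.
  rewrite -[RHS]addrA -[X in _ = _ + X]addrC.
  have -> : \sum_l (df l (yv t th') - df l y0) * (yv t th 0 l - yv t th' 0 l) =
     \sum_l df l (yv t th') * (yv t th 0 l - yv t th' 0 l) -
     (eta th ^+ 2 * \sum_l df l y0 * y1 t th 0 l - eta th ^+ 2 * \sum_l df l y0 * y1 t th' 0 l).
    rewrite !mulr_sumr -!sumrB; apply: eq_bigr => l _.
    have := congr1 (fun v : 'rV_d => v 0 l) sub1; rewrite !mxE => ->; ring.
  ring.
rewrite (le_trans (ler_normD _ _))// (le_trans (lerD (le_trans H S2) S1))//.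
rewrite -mulrDl mulrC (le_trans (e43 _ _))//.
  by rewrite addr_ge0// !mulr_ge0.
rewrite ler_wpM2r ?(ltW e3)// -mulrDl ler_wpM2r// lerD2r lerDl !mulr_ge0//.
Qed.

End TL_nonlinear.

(** * The blown-up Hamiltonian system *)

Section rescaled.
Context {R : realType} {n d : nat} (b : 'M[R]_(n, d)) (e : 'rV[R]_d).
Context (bs : 'M[R]_(n, d)) (es : 'rV[R]_d).
Context (K : 'I_n -> 'I_n -> 'rV[R]_d -> R) (dK : 'I_n -> 'I_n -> 'I_d -> 'rV[R]_d -> R).
Context (a : 'I_n -> 'rV[R]_d -> R) (da : 'I_n -> 'I_d -> 'rV[R]_d -> R).
Context (y0 : 'rV[R]_d) (g0 : 'M[R]_n).

Definition metric_inv0 : 'M[R]_n := \matrix_(i, j) K i j y0.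
Definition jac0 : 'M[R]_n := \matrix_(i, j) dot (\row_l da i l y0) (row j b).
Definition curv0 : 'M[R]_n := jac0 - jac0^T.
Local Notation K0 := metric_inv0.
Local Notation B := jac0.
Local Notation J := (K0 *m curv0).
Local Notation S := ('I_n + 'I_n + bool)%type.

(* Blow-up of the Hamiltonian system at [y0]:
   [y = y0 + eta ^ 2 X . b + eta ^ 3 Z e], [p . e = s + eta mu], [p . b = eta ^ 2 Pi] and
   [U = K0 (Pi + s B X)], where [B] is the Jacobian of [a] at [y0] and [J = K0 (B - B^T)]. It
   becomes [X' = U + eta F1, U' = s J U + eta F2, Z' = eta F3, mu' = eta F4] with [F] bounded
   and Lipschitz uniformly in [eta]. The state [x] lists [X], [U], [Z] (true), [mu] (false). *)
Section pointwise.
Variables (eta s : R) (x : S -> R).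
Let X j := x (inl (inl j)).
Let U j := x (inl (inr j)).
Let Z := x (inr true).
Let mu := x (inr false).

Definition resc_y1 : 'rV[R]_d := (\sum_j X j *: row j b) + (eta * Z) *: e.
Definition resc_y : 'rV[R]_d := y0 + eta ^+ 2 *: resc_y1.
Definition resc_lam : R := s + eta * mu.
Definition resc_Pi j : R := mv g0 U j - s * mv B X j.
Definition resc_p : 'rV[R]_d := resc_lam *: es + eta ^+ 2 *: \sum_j resc_Pi j *: row j bs.
(** The part of [a] beyond its linearization along the [b_j]. The direction [e] contributes to it
    through [Z], because [eta ^ 3 Z] has exactly this order. *)
Definition resc_a i : R := (a i resc_y - eta ^+ 2 * mv B X i) / eta ^+ 3.
Definition resc_Ph i : R := resc_Pi i + resc_lam * (mv B X i + eta * resc_a i).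
Definition resc_K i j : R := (K i j resc_y - K i j y0) / eta.
Definition resc_F1 i : R := (\sum_j resc_K i j * resc_Ph j) +
  mv K0 (fun j => mu * mv B X j + resc_lam * resc_a j) i.
Definition resc_V i : R := U i + eta * resc_F1 i.
Definition resc_dK (v : 'rV[R]_d) : R :=
  \sum_i \sum_j dot (\row_l dK i j l resc_y) v * resc_Ph i * resc_Ph j.
Definition resc_da i j : R := (dot (\row_l da i l resc_y) (row j b) - B i j) / eta.
(** The perturbation in [Pi' = - s B^T V + eta w], where [V = X'] is the rescaled control. *)
Definition resc_w j : R := - (2^-1 * (eta * resc_dK (row j b)))
  - resc_lam * (\sum_k resc_da k j * resc_V k) - mu * (\sum_k B k j * resc_V k).
(** Comes from [U' = K0 (Pi' + s B X')], which is [s J V + eta K0 w]; since [V = U + eta F1], the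
    term [s J F1] is part of the perturbation. *)
Definition resc_F2 i : R := s * mv J resc_F1 i + mv K0 resc_w i.
Definition resc_F3 : R := \sum_i resc_V i * (mv B X i + eta * resc_a i).
Definition resc_F4 : R := - (2^-1 * (eta ^+ 2 * resc_dK e) +
  resc_lam * \sum_i resc_V i * dot (\row_l da i l resc_y) e).

Definition resc_F (i : S) : R :=
  match i with
  | inl (inl j) => resc_F1 j
  | inl (inr j) => resc_F2 j
  | inr true => resc_F3
  | inr false => resc_F4
  end.

Hypothesis b_bs : forall i j, dot (row i b) (row j bs) = (i == j)%:R.
Hypothesis b_es : forall i, dot (row i b) es = 0.
Hypothesis e_bs : forall j, dot e (row j bs) = 0.
Hypothesis e_es : dot e es = 1.
Hypothesis K0g0 : K0 *m g0 = 1%:M.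
Hypothesis eta0 : eta != 0.

Lemma resc_p_e : dot resc_p e = resc_lam.
Proof.
rewrite /resc_p dotDl !dotZl dotC e_es mulr1 dotC dot_sumr big1 ?mulr0 ?addr0//.
by move=> j _; rewrite dotZr e_bs mulr0.
Qed.

Lemma resc_p_b j : dot resc_p (row j b) = eta ^+ 2 * resc_Pi j.
Proof.
rewrite /resc_p dotDl !dotZl dotC b_es mulr0 add0r dotC dot_sumr (bigD1 j)//=.
rewrite dotZr b_bs eqxx mulr1 big1 ?addr0// => k kj.
by rewrite dotZr b_bs eq_sym (negbTE kj) mulr0.
Qed.

Lemma resc_aE j : a j resc_y = eta ^+ 2 * (mv B X j + eta * resc_a j).
Proof. by rewrite /resc_a; field. Qed.

Lemma resc_hmom j : hmom b e a resc_y resc_p j = eta ^+ 2 * resc_Ph j.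
Proof. by rewrite /hmom resc_p_e resc_p_b resc_aE /resc_Ph; ring. Qed.

Lemma resc_hctrl i : hctrl b e K a resc_y resc_p i = eta ^+ 2 * resc_V i.
Proof.
rewrite /hctrl; under eq_bigr => j _ do rewrite resc_hmom.
have KU : mv K0 (mv g0 U) i = U i.
  rewrite mv_mul K0g0 /mv (bigD1 i)//= mxE eqxx mul1r big1 ?addr0// => j ji.
  by rewrite mxE eq_sym (negbTE ji) mul0r.
have E : mv K0 resc_Ph i = U i + eta * mv K0 (fun j => mu * mv B X j + resc_lam * resc_a j) i.
  rewrite -mvZ -[in RHS]KU -mvD; apply: eq_mv => j.
  by rewrite /resc_Ph /resc_Pi /resc_lam -/mu; ring.
transitivity (eta ^+ 2 * (mv K0 resc_Ph i + eta * \sum_j resc_K i j * resc_Ph j)); last first.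
  by rewrite E /resc_V /resc_F1; ring.
rewrite /mv !mulrDr !mulr_sumr -big_split; apply: eq_bigr => j _ /=; rewrite mxE /resc_K.
by field.
Qed.

Lemma resc_hvel : hvel b e K a resc_y resc_p =
  eta ^+ 2 *: ((\sum_j resc_V j *: row j b) + (eta * (eta * resc_F3)) *: e).
Proof.
rewrite /hvel; under eq_bigr => i _ do
  rewrite resc_hctrl /hframe resc_aE -scalerA scalerDr scalerA.
rewrite -scaler_sumr big_split /= -scaler_suml; congr (_ *: (_ + _ *: _)).
by rewrite /resc_F3 !mulr_sumr; apply: eq_bigr => i _; ring.
Qed.

Lemma resc_hfrc v : dot (\row_l hfrc b e K dK a da resc_y resc_p l) v =
  2^-1 * (eta ^+ 4 * resc_dK v) + resc_lam * (eta ^+ 2 * \sum_j resc_V j * dot (\row_l da j l resc_y) v).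
Proof.
have E l : hfrc b e K dK a da resc_y resc_p l =
   2^-1 * (eta ^+ 4 * \sum_i \sum_j (dK i j l resc_y * resc_Ph i * resc_Ph j)) +
   resc_lam * (eta ^+ 2 * \sum_j resc_V j * da j l resc_y).
  rewrite /hfrc resc_p_e; congr (_ * _ + _ * _).
    rewrite mulr_sumr; apply: eq_bigr => i _; rewrite mulr_sumr; apply: eq_bigr => j _.
    by rewrite !resc_hmom; ring.
  by rewrite mulr_sumr; apply: eq_bigr => j _; rewrite resc_hctrl mulrA.
rewrite {1}/dot; under eq_bigr => l _ do rewrite mxE E mulrDl.
rewrite big_split /=; congr (_ + _).
  under eq_bigr => l _ do rewrite -[_ * v 0 l]mulrA -[_ * v 0 l]mulrA.
  rewrite -[LHS]mulr_sumr -mulr_sumr; congr (_ * _); congr (_ * _); rewrite /resc_dK.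
  under eq_bigr => l _ do rewrite mulr_suml.
  rewrite exchange_big; apply: eq_bigr => i _ /=.
  under eq_bigr => l _ do rewrite mulr_suml.
  rewrite exchange_big; apply: eq_bigr => j _ /=; rewrite /dot !mulr_suml.
  by apply: eq_bigr => l _; rewrite mxE; ring.
under eq_bigr => l _ do rewrite -[_ * v 0 l]mulrA -[_ * v 0 l]mulrA.
rewrite -[LHS]mulr_sumr -mulr_sumr; congr (_ * _); congr (_ * _).
under [LHS]eq_bigr => l _ do rewrite mulr_suml.
rewrite exchange_big; apply: eq_bigr => j _ /=; rewrite /dot mulr_sumr.
by apply: eq_bigr => l _; rewrite mxE mulrA.
Qed.

End pointwise.

Hypothesis b_bs : forall i j, dot (row i b) (row j bs) = (i == j)%:R.
Hypothesis b_es : forall i, dot (row i b) es = 0.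
Hypothesis e_bs : forall j, dot e (row j bs) = 0.
Hypothesis e_es : dot e es = 1.
Hypothesis dual_span : forall v, v = dot v e *: es + \sum_j dot v (row j b) *: row j bs.
Hypothesis K0g0 : K0 *m g0 = 1%:M.

Lemma mv_curv0 u i : mv curv0 u i = mv B u i - \sum_k B k i * u k.
Proof.
rewrite /mv /curv0 -sumrB; apply: eq_bigr => k _.
by rewrite !mxE mulrBl.
Qed.

(** The momentum equation is split by [dual_span]: its component along [e] is the equation of [mu],
    and its components along the [b_j] are those of [Pi]. *)
Lemma resc_ham_sol (eta s : R) (x : R -> S -> R) : eta != 0 ->
  (forall t : R, 0 <= t <= 1 ->
    [/\ forall j, is_derive t 1 (fun t => x t (inl (inl j))) (x t (inl (inr j)) + eta * resc_F1 eta s (x t) j),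
        forall j, is_derive t 1 (fun t => x t (inl (inr j)))
          (s * mv J (fun k => x t (inl (inr k))) j + eta * resc_F2 eta s (x t) j),
        is_derive t 1 (fun t => x t (inr true)) (eta * resc_F3 eta s (x t)) &
        is_derive t 1 (fun t => x t (inr false)) (eta * resc_F4 eta s (x t))]) ->
  ham_sol b e K dK a da (fun t => resc_y eta (x t)) (fun t => resc_p eta s (x t)).
Proof.
move=> eta0 H t t01; have [dX dU dZ dm] := H t t01.
have g0K0 : g0 *m K0 = 1%:M by apply: mulmx1C.
have gK u j : mv g0 (mv K0 u) j = u j.
  rewrite mv_mul g0K0 /mv (bigD1 j)//= mxE eqxx mul1r big1 ?addr0// => k kj.
  by rewrite mxE eq_sym (negbTE kj) mul0r.
split.
  rewrite (resc_hvel (eta := eta) s (x t) b_bs b_es e_bs e_es K0g0 eta0).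
  apply: is_derive_rV => l.
  have D1 : is_derive t 1 (fun t => \sum_j x t (inl (inl j)) * b j l)
      (\sum_j resc_V eta s (x t) j * b j l).
    apply: dersum => j; apply: (der_eq (derM (dX j) (dercst t (b j l)))).
    by rewrite mulr0 addr0 /resc_V.
  have D2 := derM (derMl eta dZ) (dercst t (e 0 l)).
  have D3 := derD (dercst t (y0 0 l)) (derMl (eta ^+ 2) (derD D1 D2)).
  rewrite (_ : (fun t => _) = (fun t => y0 0 l +
     eta ^+ 2 * ((\sum_j x t (inl (inl j)) * b j l) + eta * x t (inr true) * e 0 l))); last first.
    apply: funext => r; rewrite /resc_y /resc_y1 !mxE summxE; congr (_ + _ * (_ + _)).
    by apply: eq_bigr => j _; rewrite !mxE.
  apply: (der_eq D3); rewrite !mxE summxE add0r mulr0 addr0; congr (_ * (_ + _)).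
  by apply: eq_bigr => j _; rewrite !mxE.
set f := \row_l _; rewrite (dual_span (- f)).
have fe : dot (- f) e = eta * (eta * resc_F4 eta s (x t)).
  rewrite dotNl (resc_hfrc (eta := eta) s (x t) b_bs b_es e_bs e_es K0g0 eta0) /resc_F4; ring.
have Pid j : is_derive t 1 (fun t => resc_Pi s (x t) j)
    (- (s * \sum_k B k j * resc_V eta s (x t) k) + eta * resc_w eta s (x t) j).
  have D1 := der_mv g0 j dU; have D2 := der_mv B j dX.
  apply: (der_eq (derB D1 (derMl s D2))).
  transitivity (mv g0 (mv K0 (fun i => s * mv curv0 (resc_V eta s (x t)) i + eta * resc_w eta s (x t) i)) j
     - s * mv B (resc_V eta s (x t)) j); last first.
    by rewrite gK mv_curv0; ring.
  congr (_ - _); apply: eq_mv => i.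
  by rewrite mvD !mvZ mv_mul /resc_F2 /resc_V mvD mvZ; ring.
have fb j : dot (- f) (row j b) = eta ^+ 2 *
   (- (s * \sum_k B k j * resc_V eta s (x t) k) + eta * resc_w eta s (x t) j).
  rewrite dotNl (resc_hfrc (eta := eta) s (x t) b_bs b_es e_bs e_es K0g0 eta0) /resc_w.
  rewrite (_ : \sum_k resc_V _ _ _ k * dot _ _ = (\sum_k B k j * resc_V eta s (x t) k) +
    eta * \sum_k resc_da eta (x t) k j * resc_V eta s (x t) k); last first.
    rewrite mulr_sumr -big_split; apply: eq_bigr => k _ /=.
    by rewrite /resc_da; field.
  by rewrite /resc_lam; ring.
under eq_bigr => j _ do rewrite fb.
rewrite fe; apply: is_derive_rV => l.
have D1 : is_derive t 1 (fun t => resc_lam eta s (x t)) (eta * (eta * resc_F4 eta s (x t))).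
  by apply: (der_eq (derD (dercst t s) (derMl eta dm))); rewrite add0r.
have D2 : is_derive t 1 (fun t => \sum_j resc_Pi s (x t) j * bs j l)
   (\sum_j ((- (s * \sum_k B k j * resc_V eta s (x t) k) + eta * resc_w eta s (x t) j) * bs j l +
     resc_Pi s (x t) j * 0)).
  by apply: dersum => j; exact: (derM (Pid j) (dercst t (bs j l))).
have D3 := derD (derM D1 (dercst t (es 0 l))) (derMl (eta ^+ 2) D2).
rewrite (_ : (fun t => _) = (fun t => resc_lam eta s (x t) * es 0 l +
   eta ^+ 2 * (\sum_j resc_Pi s (x t) j * bs j l))); last first.
  apply: funext => r; rewrite /resc_p !mxE summxE; congr (_ + _ * _).
  by apply: eq_bigr => j _; rewrite !mxE.
apply: (der_eq D3); rewrite !mxE summxE mulr0 addr0; congr (_ + _); rewrite mulr_sumr.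
by apply: eq_bigr => j _; rewrite !mxE mulr0 addr0 mulrA.
Qed.

End rescaled.

(** * Bounds for the perturbation, uniform in [eta] *)

Section rescaled_TL.
Context {R : realType} {n d : nat} (b : 'M[R]_(n, d)) (e : 'rV[R]_d).
Context (K : 'I_n -> 'I_n -> 'rV[R]_d -> R) (dK : 'I_n -> 'I_n -> 'I_d -> 'rV[R]_d -> R).
Context (a : 'I_n -> 'rV[R]_d -> R) (da : 'I_n -> 'I_d -> 'rV[R]_d -> R).
Context (y0 : 'rV[R]_d) (g0 : 'M[R]_n) (rho : R).
Hypothesis K_C11 : forall i j, exists2 C : R, 0 <= C & C11 y0 rho C (K i j) (dK i j).
Hypothesis a_C11 : forall j, exists2 C : R, 0 <= C & C11 y0 rho C (a j) (da j).
Hypothesis a_y0 : forall j, a j y0 = 0.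
Local Notation S := ('I_n + 'I_n + bool)%type.

Context {Th : Type} (Dom : Th -> Prop) (dst : Th -> Th -> R -> Prop).
Hypothesis dst_ge0 : forall th th' de, dst th th' de -> 0 <= de.
Variables (eta sg : Th -> R) (x : R -> Th -> S -> R).
Hypothesis eta_dom : forall th, Dom th -> 0 < eta th <= 1.
Hypothesis eta_dst : forall th th' de, dst th th' de -> eta th = eta th'.
Local Notation TLn := (TL Dom dst).
Hypothesis sg_TL : TLn (fun _ th => sg th).
Hypothesis x_TL : forall i, TLn (fun t th => x t th i).

Local Notation tl_cst := (TL_cst Dom dst_ge0).
Local Notation tl_sum := (TL_sum dst_ge0).
Local Notation tl_opp := (TL_opp dst_ge0).
Local Notation tl_mv := (TL_mv _ _ dst_ge0).
Local Notation tl_eta := (TL_eta dst_ge0 eta_dom eta_dst).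

Lemma TL_resc_y1 l : TLn (fun t th => resc_y1 b e (eta th) (x t th) 0 l).
Proof.
apply: (@TL_eq _ _ _ _ (fun t th => (\sum_j x t th (inl (inl j)) * b j l) + eta th * x t th (inr true) * e 0 l)).
  move=> t th _; rewrite !mxE summxE; congr (_ + _).
  by apply: eq_bigr => j _; rewrite !mxE.
apply: TL_add; first by apply: tl_sum => j; apply: TL_mul => //; exact: tl_cst.
by apply: TL_mul; [apply: TL_mul => //; exact: tl_eta|exact: tl_cst].
Qed.

Hypothesis y_box : forall t th, 0 <= t <= 1 -> Dom th ->
  `|resc_y b e y0 (eta th) (x t th) - y0| < rho.

Let lip_f f df C : C11 y0 rho C f df ->
  forall z y, `|z - y0| <= rho -> `|y - y0| <= rho -> `|f y - f z| <= C * `|y - z|.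
Proof. by move=> H z y hz hy; have [] := H z y hz hy. Qed.

Let lip_dir (df : 'I_d -> 'rV[R]_d -> R) f (v : 'rV[R]_d) : (exists2 C : R, 0 <= C & C11 y0 rho C f df) ->
  exists2 C : R, 0 <= C & forall z y, `|z - y0| <= rho -> `|y - y0| <= rho ->
    `|dot (\row_l df l y) v - dot (\row_l df l z) v| <= C * `|y - z|.
Proof.
move=> [C C0 H]; exists (d%:R * (C * `|v|)); first by rewrite !mulr_ge0.
move=> z y hz hy; have [_ _ _ h _] := H z y hz hy.
rewrite -dotBl (le_trans (norm_dot _ _))// -!mulrA ler_wpM2l// mulrA mulrAC ler_wpM2r//.
by apply: mx_norm_le => [|i l]; rewrite ?mulr_ge0// !mxE.
Qed.

Lemma TL_resc_lam : TLn (fun t th => resc_lam (eta th) (sg th) (x t th)).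
Proof. by apply: TL_add => //; apply: TL_mul => //; exact: tl_eta. Qed.

Lemma TL_resc_BX i : TLn (fun t th => mv (jac0 b da y0) (fun j => x t th (inl (inl j))) i).
Proof. exact: (TL_mv (u := fun j t th => x t th (inl (inl j))) _ _ dst_ge0). Qed.

Lemma TL_resc_Pi i : TLn (fun t th => resc_Pi b da y0 g0 (sg th) (x t th) i).
Proof.
apply: TL_add; first exact: (TL_mv (u := fun j t th => x t th (inl (inr j))) _ _ dst_ge0).
by apply: tl_opp; apply: TL_mul => //; exact: TL_resc_BX.
Qed.

Lemma TL_resc_K i j : TLn (fun t th => resc_K b e K y0 (eta th) (x t th) i j).
Proof.
have [C C0 HC] := K_C11 i j.
exact: (TL_quot1 dst_ge0 eta_dom eta_dst TL_resc_y1 y_box C0 (lip_f HC)).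
Qed.

Lemma TL_resc_da i j : TLn (fun t th => resc_da b e da y0 (eta th) (x t th) i j).
Proof.
have [C C0 HC] := lip_dir (row j b) (a_C11 i).
have := TL_quot1 dst_ge0 eta_dom eta_dst TL_resc_y1 y_box C0 HC.
by apply: TL_eq => t th _; rewrite /resc_da mxE.
Qed.

Lemma TL_resc_dir df f v : (exists2 C : R, 0 <= C & C11 y0 rho C f df) ->
  TLn (fun t th => dot (\row_l df l (resc_y b e y0 (eta th) (x t th))) v).
Proof.
move=> /(lip_dir v)[C C0 HC].
exact: (TL_lipcomp dst_ge0 eta_dom eta_dst TL_resc_y1 y_box C0 HC).
Qed.

Lemma TL_resc_a i : TLn (fun t th => resc_a b e a da y0 (eta th) (x t th) i).
Proof.
have [C C0 HC] := a_C11 i.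
have T1 := TL_quot2 dst_ge0 eta_dom eta_dst TL_resc_y1 y_box C0 HC.
have T2 : TLn (fun t th => x t th (inr true) * dot (\row_l da i l y0) e).
  by apply: TL_mul => //; exact: tl_cst.
apply: TL_eq (TL_add T1 T2) => t th Dth; have /andP[e0 _] := eta_dom Dth.
have et : eta th != 0 by rewrite gt_eqF.
have -> : \sum_l da i l y0 * resc_y1 b e (eta th) (x t th) 0 l =
  mv (jac0 b da y0) (fun j => x t th (inl (inl j))) i +
  eta th * x t th (inr true) * dot (\row_l da i l y0) e.
  transitivity (dot (\row_l da i l y0) (resc_y1 b e (eta th) (x t th))).
    by apply: eq_bigr => l _; rewrite mxE.
  rewrite /resc_y1 dotDr dotZr dot_sumr; congr (_ + _); apply: eq_bigr => j _.
  by rewrite dotZr mxE mulrC.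
by rewrite a_y0 subr0 /resc_a /resc_y; field.
Qed.

Lemma TL_resc_Ph i : TLn (fun t th => resc_Ph b e a da y0 g0 (eta th) (sg th) (x t th) i).
Proof.
apply: TL_add; first exact: TL_resc_Pi.
apply: TL_mul; first exact: TL_resc_lam.
apply: TL_add; first exact: TL_resc_BX.
by apply: TL_mul; [exact: tl_eta|exact: TL_resc_a].
Qed.

Lemma TL_resc_F1 i : TLn (fun t th => resc_F1 b e K a da y0 g0 (eta th) (sg th) (x t th) i).
Proof.
apply: TL_add.
  by apply: tl_sum => j; apply: TL_mul; [exact: TL_resc_K|exact: TL_resc_Ph].
apply: (TL_mv (u := fun j t th => x t th (inr false) * mv (jac0 b da y0) (fun j => x t th (inl (inl j))) j +
   resc_lam (eta th) (sg th) (x t th) * resc_a b e a da y0 (eta th) (x t th) j) _ _ dst_ge0) => j.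
apply: TL_add; first by apply: TL_mul => //; exact: TL_resc_BX.
by apply: TL_mul; [exact: TL_resc_lam|exact: TL_resc_a].
Qed.

Lemma TL_resc_V i : TLn (fun t th => resc_V b e K a da y0 g0 (eta th) (sg th) (x t th) i).
Proof. by apply: TL_add => //; apply: TL_mul; [exact: tl_eta|exact: TL_resc_F1]. Qed.

Lemma TL_resc_dK v : TLn (fun t th => resc_dK b e dK a da y0 g0 (eta th) (sg th) (x t th) v).
Proof.
apply: tl_sum => i; apply: tl_sum => j; apply: TL_mul; last exact: TL_resc_Ph.
by apply: TL_mul; [exact: TL_resc_dir (K_C11 i j)|exact: TL_resc_Ph].
Qed.

Lemma TL_resc_w i : TLn (fun t th => resc_w b e K dK a da y0 g0 (eta th) (sg th) (x t th) i).
Proof.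
apply: TL_add; last first.
  apply: tl_opp; apply: TL_mul => //; apply: tl_sum => k.
  by apply: TL_mul; [exact: tl_cst|exact: TL_resc_V].
apply: TL_add; apply: tl_opp; apply: TL_mul; [exact: tl_cst| |exact: TL_resc_lam|].
  by apply: TL_mul; [exact: tl_eta|exact: TL_resc_dK].
by apply: tl_sum => k; apply: TL_mul; [exact: TL_resc_da|exact: TL_resc_V].
Qed.

Lemma TL_resc_F i : TLn (fun t th => resc_F b e K dK a da y0 g0 (eta th) (sg th) (x t th) i).
Proof.
case: i => [[i|i]|[]]; first exact: TL_resc_F1.
- apply: TL_add; last by apply: tl_mv => j; exact: TL_resc_w.
  by apply: TL_mul => //; apply: tl_mv => j; exact: TL_resc_F1.
- apply: tl_sum => i; apply: TL_mul; first exact: TL_resc_V.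
  by apply: TL_add; [exact: TL_resc_BX|apply: TL_mul; [exact: tl_eta|exact: TL_resc_a]].
- apply: tl_opp; apply: TL_add.
    apply: TL_mul; first exact: tl_cst.
    by apply: TL_mul; [apply: TL_mul; exact: tl_eta|exact: TL_resc_dK].
  apply: TL_mul; first exact: TL_resc_lam.
  apply: tl_sum => i; apply: TL_mul; first exact: TL_resc_V.
  exact: TL_resc_dir (a_C11 i).
Qed.

(** As [eta] goes to 0 the rescaled vertical velocity becomes the area integrand [U . B X]; this
    rate makes the heights reached converge to [zeta0]. *)
Lemma resc_F3_leading : exists2 C : R, 0 <= C & forall t th, 0 <= t <= 1 -> Dom th ->
  `|resc_F3 b e K a da y0 g0 (eta th) (sg th) (x t th) -
    \sum_i x t th (inl (inr i)) * mv (jac0 b da y0) (fun j => x t th (inl (inl j))) i| <= C * eta th.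
Proof.
have T : TLn (fun t th => \sum_i (resc_F1 b e K a da y0 g0 (eta th) (sg th) (x t th) i *
    (mv (jac0 b da y0) (fun j => x t th (inl (inl j))) i + eta th * resc_a b e a da y0 (eta th) (x t th) i) +
    x t th (inl (inr i)) * resc_a b e a da y0 (eta th) (x t th) i)).
  apply: tl_sum => i; apply: TL_add; last by apply: TL_mul => //; exact: TL_resc_a.
  apply: TL_mul; first exact: TL_resc_F1.
  by apply: TL_add; [exact: TL_resc_BX|apply: TL_mul; [exact: tl_eta|exact: TL_resc_a]].
have [_ [C C0 HC]] := T; exists C => // t th t01 Dth; have [h _] := HC t th t01 Dth.
have /andP[e0 _] := eta_dom Dth.
rewrite -ler_pdivrMr// -[X in _ / X](gtr0_norm e0) -normfV -normrM.
apply: le_trans h; rewrite le_eqVlt; apply/orP; left; apply/eqP; congr (`| _ |).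
rewrite /resc_F3 -sumrB mulr_suml; apply: eq_bigr => i _; rewrite /resc_V; field.
by rewrite gt_eqF.
Qed.

End rescaled_TL.

(** * Uniform limits, scaled primitives and an intermediate value lemma *)

Section cont01_limit.
Context {R : realType}.

Lemma cont01_unif (f : R -> R) : (forall eps : R, 0 < eps -> exists2 g, cont01 g &
  forall t : R, `|g t - f t| <= eps) -> cont01 f.
Proof.
move=> H t t01; apply/cvgrPdist_le => eps e0.
have e3 : 0 < eps / 3 by rewrite divr_gt0.
have [g cg Hg] := H _ e3; have /cvgrPdist_le/(_ _ e3) := cg t t01.
apply: filterS => s Hs.
have h1 := Hg t; have h2 := Hg s.
rewrite (_ : f t - f s = (g t - g s) - (g t - f t) + (g s - f s)); last by ring.
rewrite (le_trans (ler_normD _ _))// (_ : eps = eps / 3 + eps / 3 + eps / 3); last by field.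
by rewrite lerD// (le_trans (ler_normB _ _))// lerD.
Qed.

Lemma prim_scale (c : R) f : cont01 f -> prim (fun t => c * f t) 1 = c * prim f 1.
Proof.
move=> cf.
have c1 : cont01 (fun t => c * f t).
  by move=> t t01; apply: continuousM (cf t t01); exact: cst_continuous.
have d1 (t : R) : 0 <= t <= 1 -> is_derive t 1 (fun t => c * prim f t) (c * f t).
  by move=> t01; apply: derMl; exact: prim_der.
by rewrite (prim_uniq c1 d1) ?prim0 ?mulr0 ?subr0 ?lexx ?ler01.
Qed.

Lemma eq_prim f g : (forall t : R, 0 <= t <= 1 -> f t = g t) -> prim f = prim g.
Proof.
move=> fg; apply: funext => t; rewrite /prim.
have -> // : [set F | forall x : R, -1 < x -> is_derive x 1 F (f (clamp01 x))] =
  [set F | forall x : R, -1 < x -> is_derive x 1 F (g (clamp01 x))].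
by apply: funext => F; apply: propext; split => H x /H; rewrite fg// clamp01_bd.
Qed.

Lemma bracket_le (z1 z2 w1 w2 v : R) : `|z2 - w2| <= 1 -> `|z1 - w1| <= 1 ->
  w2 + 1 <= v <= w1 - 1 -> z2 <= v <= z1.
Proof. by move=> /ler_normlP[? ?] /ler_normlP[? ?] /andP[? ?]; apply/andP; split; lra. Qed.

Lemma lipschitz_IVT (f : R -> R) (C s1 s2 v : R) : s1 <= s2 ->
  (forall s s', s1 <= s <= s2 -> s1 <= s' <= s2 -> `|f s - f s'| <= C * `|s - s'|) ->
  f s2 <= v <= f s1 -> exists2 s, s1 <= s <= s2 & f s = v.
Proof.
move=> s12 Lf /andP[h2 h1].
pose cl s := Num.max s1 (Num.min s2 s).
have clb s : s1 <= cl s <= s2 by rewrite /cl le_max lexx/= ge_max s12/= ge_min lexx.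
have clid s : s1 <= s <= s2 -> cl s = s.
  by move=> /andP[a1 a2]; rewrite /cl (min_idPr a2) (max_idPr a1).
have cll s t : `|cl t - cl s| <= `|t - s|.
  have := ler_norm (t - s); have := ler_norm (s - t); rewrite (distrC s) => ts1 ts2.
  rewrite /cl !maxEle !minEle.
  by case: (leP s2 t) => ? ; case: (leP s2 s) => ?; repeat (case: ifPn; rewrite -?ltNge => ?);
    apply/ler_normlP; split; lra.
have C0 : 0 <= `|C| by [].
have [| |s] := @IVT R (f \o cl) s1 s2 v s12.
- apply: continuous_subspaceT => t; apply: (@lip_for_continuous _ _ _ `|C| 1) => // s _ /=.
  apply: le_trans (Lf _ _ (clb _) (clb _)) _.
  by rewrite (le_trans (ler_wpM2r _ (ler_norm C)))// ler_wpM2l// cll.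
- rewrite /= !clid ?lexx ?s12//.
  by rewrite ge_min h2 orbT/= le_max h1.
by rewrite in_itv/= => sb fs; exists s => //; rewrite -fs /= clid.
Qed.

End cont01_limit.

(** * The shooting argument on one interval of multipliers *)

Section shooting.
Context {R : realType} {n d : nat} (b : 'M[R]_(n, d)) (e : 'rV[R]_d).
Context (bs : 'M[R]_(n, d)) (es : 'rV[R]_d).
Context (K : 'I_n -> 'I_n -> 'rV[R]_d -> R) (dK : 'I_n -> 'I_n -> 'I_d -> 'rV[R]_d -> R).
Context (a : 'I_n -> 'rV[R]_d -> R) (da : 'I_n -> 'I_d -> 'rV[R]_d -> R).
Context (y0 : 'rV[R]_d) (g0 : 'M[R]_n) (rho : R).
Hypothesis rho_gt0 : 0 < rho.
Hypothesis K_C11 : forall i j, exists2 C : R, 0 <= C & C11 y0 rho C (K i j) (dK i j).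
Hypothesis a_C11 : forall j, exists2 C : R, 0 <= C & C11 y0 rho C (a j) (da j).
Hypothesis a_y0 : forall j, a j y0 = 0.
Hypothesis b_bs : forall i j, dot (row i b) (row j bs) = (i == j)%:R.
Hypothesis b_es : forall i, dot (row i b) es = 0.
Hypothesis e_bs : forall j, dot e (row j bs) = 0.
Hypothesis e_es : dot e es = 1.
Hypothesis dual_span : forall v, v = dot v e *: es + \sum_j dot v (row j b) *: row j bs.
Hypothesis K0g0 : metric_inv0 K y0 *m g0 = 1%:M.
Local Notation J := (metric_inv0 K y0 *m curv0 b da y0).
Local Notation B := (jac0 b da y0).
Context (alf : 'I_n -> R) (xi : 'I_n -> R).
Hypothesis alf_gt0 : forall i, 0 < alf i.
Hypothesis J2 : J *m J = - diag_mx (\row_i alf i ^+ 2).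
Context (s1 s2 : R).
Hypotheses (s1_gt0 : 0 < s1) (s12 : s1 <= s2).
Hypothesis nonres : forall s, s1 <= s <= s2 -> nonresonant alf s.
Local Notation S := ('I_n + 'I_n + bool)%type.
Local Notation Th := (R * (R * (R -> S -> R)))%type.

(* At order [eta ^ 4] the endpoint moves along [e] by [zeta0 s], so that an intermediate value
   argument in the multiplier [s] selects the extremal reaching the target. *)
Definition area (x : S -> R) : R :=
  \sum_i x (inl (inr i)) * mv B (fun j => x (inl (inl j))) i.
Definition zeta0 (s : R) : R := prim (fun t => area (fun i => st J alf xi s (fun _ _ => 0) i t)) 1.

Let DomE (eta0 : R) (th : Th) := 0 < th.1 <= eta0 /\ DomF s1 s2 1 th.2.
(** [eta] is frozen: only parameters with the same [eta] are compared, and the Lipschitz constants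
    in [(s, f)] come out uniform in [eta]. *)
Let dstE (th th' : Th) (de : R) := th.1 = th'.1 /\ dstF th.2 th'.2 de.
Let xs (t : R) (th : Th) (i : S) : R := st J alf xi th.2.1 th.2.2 i t.

Let dstE_ge0 th th' de : dstE th th' de -> 0 <= de. Proof. by move=> [_ /dstF_ge0]. Qed.
Let etaE_dst (th th' : Th) de : dstE th th' de -> th.1 = th'.1. Proof. by case. Qed.

Let TL_E eta0 phi : TL (DomF s1 s2 1) dstF phi -> TL (DomE eta0) dstE (fun t th => phi t th.2).
Proof. by apply: TL_proj => [th []|th th' de []]. Qed.

Let TL_xs eta0 i : TL (DomE eta0) dstE (fun t th => xs t th i).
Proof. exact: (TL_E _ (TL_st J alf_gt0 s1_gt0 s12 ler01 nonres xi i)). Qed.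

Let TL_sg eta0 : TL (DomE eta0) dstE (fun _ th => th.2.1).
Proof. by apply: (TL_E _ (phi := fun _ th => th.1)); apply: TL_s. Qed.

Let small : exists2 eta0 : R, 0 < eta0 <= 1 & forall t th, 0 <= t <= 1 -> DomE eta0 th ->
  `|resc_y b e y0 th.1 (xs t th) - y0| < rho.
Proof.
have dom1 th : DomE 1 th -> 0 < th.1 <= 1 by case.
have [C C0 HC] := TL_vec dstE_ge0 (TL_resc_y1 b e dstE_ge0 dom1 etaE_dst (@TL_xs 1)).
have C1 : 0 < C + 1 by rewrite ltr_wpDl.
pose eta0 := Num.min 1 (rho / (C + 1)).
have e0 : 0 < eta0 by rewrite lt_min ltr01 divr_gt0.
have e1 : eta0 <= 1 by rewrite ge_min lexx.
exists eta0; first by rewrite e0.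
move=> t th t01 [/andP[h0 h1] D]; have D1 : DomE 1 th by split; rewrite // h0 (le_trans h1).
have [H _] := HC t th t01 D1.
rewrite /resc_y addrAC subrr add0r normrZ ger0_norm ?sqr_ge0//.
apply: (@le_lt_trans _ _ (th.1 * C)).
  by rewrite ler_pM ?sqr_ge0// expr2 ler_piMl ?(le_trans h1)// ltW.
apply: (@lt_le_trans _ _ (th.1 * (C + 1))); first by rewrite ltr_pM2l// ltrDl.
by rewrite -ler_pdivlMr// (le_trans h1)// ge_min lexx orbT.
Qed.

Section at_eta0.
Variable eta0 : R.
Hypothesis eta0_bd : 0 < eta0 <= 1.
Hypothesis y_box : forall t th, 0 <= t <= 1 -> DomE eta0 th ->
  `|resc_y b e y0 th.1 (xs t th) - y0| < rho.

Let etaE_dom th : DomE eta0 th -> 0 < th.1 <= 1.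
Proof. by move=> [/andP[h0 h1] _]; rewrite h0 (le_trans h1)//; case/andP: eta0_bd. Qed.

Let F t (th : Th) i := resc_F b e K dK a da y0 g0 th.1 th.2.1 (xs t th) i.

Let TL_F i : TL (DomE eta0) dstE (fun t th => F t th i).
Proof.
exact: (TL_resc_F g0 K_C11 a_C11 a_y0 dstE_ge0 etaE_dom etaE_dst (@TL_sg eta0) (@TL_xs eta0) y_box).
Qed.

Lemma shoot_F_bound : exists2 C : R, 0 <= C & forall t th i, 0 <= t <= 1 -> DomE eta0 th ->
  `|F t th i| <= C /\
  forall th' de, DomE eta0 th' -> dstE th th' de -> `|F t th i - F t th' i| <= C * de.
Proof.
have /choice[C HC] i : exists C : R, 0 <= C /\ forall t th, 0 <= t <= 1 -> DomE eta0 th ->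
    `|F t th i| <= C /\
    forall th' de, DomE eta0 th' -> dstE th th' de -> `|F t th i - F t th' i| <= C * de.
  by have [_ [C C0 HC]] := TL_F i; exists C.
have Cl l : C l <= \sum_l C l.
  by rewrite (bigD1 l)//= lerDl sumr_ge0// => k _; case: (HC k).
exists (\sum_l C l); first by apply: sumr_ge0 => k _; case: (HC k).
move=> t th i t01 Dth; have [_ /(_ t th t01 Dth)[h1 h2]] := HC i.
split; first exact: le_trans h1 _.
move=> th' de Dth' D; have de0 := dstE_ge0 D.
by rewrite (le_trans (h2 _ _ Dth' D))// ler_wpM2r.
Qed.

Variables (CF : R).
Hypothesis CF_ge0 : 0 <= CF.
Hypothesis HF : forall t th i, 0 <= t <= 1 -> DomE eta0 th ->
  `|F t th i| <= CF /\
  forall th' de, DomE eta0 th' -> dstE th th' de -> `|F t th i - F t th' i| <= CF * de.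
Variable eta : R.
Hypotheses (eta_gt0 : 0 < eta) (eta_le : eta <= eta0) (eta_CF : eta * CF <= 2^-1).

Let admissible_frc (f : R -> S -> R) := cont_frc f /\ forall t i, `|f t i| <= 1.

Let domE s f : s1 <= s <= s2 -> admissible_frc f -> DomE eta0 (eta, (s, f)).
Proof. by move=> sb [cf bf]; split; [rewrite eta_gt0|split]. Qed.

Let half_lt1 : (2^-1 : R) < 1. Proof. by rewrite invf_lt1// ltr1n. Qed.

(** A forcing that equals [eta F] along its own response [xs] gives a solution of the full nonlinear
    system. As [eta * CF <= 1 / 2], the map halves sup distances and preserves the unit ball;
    clamping the time keeps the forcing bounded on the whole line. *)
Let shoot_fix s : s1 <= s <= s2 -> exists2 f, admissible_frc f &
  forall t i, eta * F (clamp01 t) (eta, (s, f)) i = f t i.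
Proof.
move=> sb.
pose T f t i := eta * F (clamp01 t) (eta, (s, f)) i.
apply: (@contraction_fixpoint R S admissible_frc T (2^-1) 1 (fun _ _ => 0)) => //.
- by split=> [i|t i]; [exact: cont01_cst|rewrite normr0].
- move=> f Ef; have D := domE sb Ef; split.
    move=> i t t01; have [c _] := TL_F i.
    apply: cvgM; first exact: cvg_cst.
    exact: (cont01_clamp (c _ D)).
  move=> t i; have [h _] := HF i (clamp01_bd t) D.
  rewrite /T normrM (gtr0_norm eta_gt0) (le_trans _ (ltW half_lt1))//.
  by rewrite (le_trans _ eta_CF)// ler_wpM2l// ltW.
- by move=> f [_].
- move=> f g de Ef Eg fg t i; have de0 : 0 <= de by apply: le_trans (fg 0 (inr true)).
  have [_ h] := HF i (clamp01_bd t) (domE sb Ef).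
  rewrite /T -mulrBr normrM (gtr0_norm eta_gt0).
  apply: (@le_trans _ _ (eta * (CF * de))); last by rewrite mulrA ler_wpM2r.
  rewrite ler_wpM2l ?(ltW eta_gt0)// h//; first exact: domE.
  by split => //; split => //=; rewrite subrr normr0.
- move=> G f EG H; split.
    move=> i; apply: cont01_unif => eps /H[m Hm].
    by exists (fun t => G m t i) => [|t]; [have [cG _] := EG m; exact: cG|exact: Hm].
  move=> t i; apply/ler_addgt0Pr => eps /H[m Hm].
  rewrite -[f t i](subrK (G m t i)) addrC (le_trans (ler_normD _ _))// lerD//.
    by have [_] := EG m; exact.
  by rewrite distrC.
Qed.

(** Changing [s] and the forcing together moves [eta F] by at most half of [de + |s - s'|], and
    [fixpoint_dist] turns the two halves into the constant 1. *)
Let shoot_fix_lip s s' f f' : s1 <= s <= s2 -> s1 <= s' <= s2 ->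
  admissible_frc f -> admissible_frc f' ->
  (forall t i, eta * F (clamp01 t) (eta, (s, f)) i = f t i) ->
  (forall t i, eta * F (clamp01 t) (eta, (s', f')) i = f' t i) ->
  forall t i, `|f t i - f' t i| <= `|s - s'|.
Proof.
move=> sb sb' Ef Ef' Hf Hf'.
have H := @fixpoint_dist R S f f' (2^-1) (2^-1 * `|s - s'|) 2.
have E : 2^-1 * `|s - s'| / (1 - 2^-1) = `|s - s'|.
  rewrite (_ : 1 - 2^-1 = 2^-1 :> R); last by field.
  by field.
rewrite E in H; apply: H => //.
- move=> t i; rewrite (le_trans (ler_normB _ _))// (_ : 2 = 1 + 1 :> R)// lerD//.
    by have [_] := Ef; exact.
  by have [_] := Ef'; exact.
- move=> de Hde t i; have de0 : 0 <= de by apply: le_trans (Hde 0 (inr true)).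
  have [_ h] := HF i (clamp01_bd t) (domE sb Ef).
  rewrite -Hf -Hf' -mulrBr normrM (gtr0_norm eta_gt0) -mulrDr.
  apply: (@le_trans _ _ (eta * (CF * (de + `|s - s'|)))); last first.
    by rewrite mulrA ler_wpM2r// addr_ge0.
  rewrite ler_wpM2l ?(ltW eta_gt0)// h//; first exact: domE.
  split => //; split => //=; first by rewrite addr_ge0.
    by rewrite lerDr.
  by move=> t' i'; rewrite (le_trans (Hde _ _))// lerDl.
Qed.

Variables (CL CA CU eps Zh : R).
Hypothesis HL : forall t th, 0 <= t <= 1 -> DomE eta0 th ->
  `|F t th (inr true) - area (xs t th)| <= CL * th.1.
Hypothesis HA : forall t th, 0 <= t <= 1 -> DomF s1 s2 1 th -> forall th' de,
  DomF s1 s2 1 th' -> dstF th th' de ->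
  `|area (fun i => st J alf xi th.1 th.2 i t) - area (fun i => st J alf xi th'.1 th'.2 i t)| <= CA * de.
Hypothesis cont_area : forall th, DomF s1 s2 1 th -> cont01 (fun t => area (fun i => st J alf xi th.1 th.2 i t)).
Hypothesis HU : forall i th th' de, DomF s1 s2 1 th -> DomF s1 s2 1 th' -> dstF th th' de ->
  `|fU0 J alf xi th.1 th.2 i - fU0 J alf xi th'.1 th'.2 i| <= CU * de.
Hypothesis eta_LA : CL * eta + CA * (eta * CF) <= 1.
Hypothesis eta_U : CU * (eta * CF) + eta * CF <= eps.
Hypothesis Zh_bd : zeta0 s2 + 1 <= Zh <= zeta0 s1 - 1.

Let zero_adm : admissible_frc (fun _ _ => 0).
Proof. by split=> [i|t i]; [exact: cont01_cst|rewrite normr0]. Qed.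

(** The height [zeta s] is Lipschitz in [s] and, by [eta_LA], within 1 of [zeta0 s]; the margin 1 in
    [Zh_bd] therefore forces it to cross [Zh]. *)
Let shoot_target : exists s f, [/\ s1 <= s <= s2, admissible_frc f,
  forall t i, eta * F (clamp01 t) (eta, (s, f)) i = f t i &
  prim (fun t => F t (eta, (s, f)) (inr true)) 1 = Zh].
Proof.
have /choice[G HG] s : exists f, s1 <= s <= s2 -> admissible_frc f /\
    forall t i, eta * F (clamp01 t) (eta, (s, f)) i = f t i.
  have [/shoot_fix[f Ef Hf]|ns] := pselect (s1 <= s <= s2); first by exists f.
  by exists (fun _ _ => 0).
pose zeta s := prim (fun t => F t (eta, (s, G s)) (inr true)) 1.
have i1 : 0 <= (1 : R) <= 1 by rewrite ler01 lexx.
have cF s : s1 <= s <= s2 -> cont01 (fun t => F t (eta, (s, G s)) (inr true)).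
  move=> sb; have [c _] := TL_F (inr true); apply: c.
  by apply: domE => //; case: (HG _ sb).
have fsmall s t i : s1 <= s <= s2 -> `|G s t i| <= eta * CF.
  move=> sb; have [Ef Hf] := HG _ sb; rewrite -Hf normrM (gtr0_norm eta_gt0) ler_wpM2l ?(ltW eta_gt0)//.
  by have [] := HF i (clamp01_bd t) (domE sb Ef).
have near0 s : s1 <= s <= s2 -> `|zeta s - zeta0 s| <= 1.
  move=> sb; have [Ef Hf] := HG _ sb; apply: le_trans eta_LA; apply: prim_dist => //.
  - exact: cF.
  - by apply: (@cont_area (s, fun _ _ => 0)); case: zero_adm.
  move=> t t01; rewrite -(subrKA (area (xs t (eta, (s, G s))))) (le_trans (ler_normD _ _))// lerD//.
    exact: (@HL t (eta, (s, G s)) t01 (domE sb Ef)).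
  apply: (@HA t (s, G s) t01 _ (s, fun _ _ => 0)); first by case: Ef.
    by case: zero_adm.
  split; rewrite /= ?mulr_ge0 ?(ltW eta_gt0)//.
    by rewrite subrr normr0 mulr_ge0// ltW.
  by move=> t' i'; rewrite subr0 fsmall.
have [||s sb zs] := @lipschitz_IVT R zeta CF s1 s2 Zh s12.
- move=> s s' sb sb'; have [Ef Hf] := HG _ sb; have [Ef' Hf'] := HG _ sb'.
  apply: prim_dist; [exact: cF|exact: cF| |by []].
  move=> t t01; have [_ h] := HF (inr true) t01 (domE sb Ef).
  apply: h; first exact: domE.
  split => //; split => //=.
  exact: shoot_fix_lip Hf Hf'.
- have h1 := near0 s1; have h2 := near0 s2.
  apply: (bracket_le (h2 _) (h1 _) Zh_bd); first by rewrite lexx s12.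
  by rewrite lexx s12.
by have [Ef Hf] := HG _ sb; exists s, (G s).
Qed.

(** The last clause compares the initial velocity with that of the model: it will tell apart the
    extremals coming from different intervals of multipliers. *)
Lemma shoot_eta : exists (s : R) (y p : R -> 'rV[R]_d), [/\ s1 <= s <= s2, ham_sol b e K dK a da y p,
  y 0 = y0 /\ y 1 = y0 + eta ^+ 2 *: ((\sum_j xi j *: row j b) + (eta * (eta * Zh)) *: e),
  forall t : R, 0 <= t <= 1 -> `|y t - y0| < rho &
  exists2 v : 'rV[R]_d, is_derive (0 : R) 1 y v &
    forall i, `|dot v (row i bs) / eta ^+ 2 - fU0 J alf xi s (fun _ _ => 0) i| <= eps].
Proof.
have [s [f [sb Ef Hf Hz]]] := shoot_target; have [cf bf] := Ef.
have D := domE sb Ef; pose th : Th := (eta, (s, f)).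
have s0 : s != 0 by rewrite gt_eqF// (lt_le_trans s1_gt0)//; case/andP: sb.
have et0 : eta != 0 by rewrite gt_eqF.
have Hf' (t : R) i : 0 <= t <= 1 -> f t i = eta * F t th i by move=> /clamp01_id t01; rewrite -Hf t01.
have sol : ham_sol b e K dK a da (fun t => resc_y b e y0 eta (xs t th))
    (fun t => resc_p b bs es da y0 g0 eta s (xs t th)).
  apply: (resc_ham_sol b_bs b_es e_bs e_es dual_span K0g0 et0 (x := fun t => xs t th)).
  move=> t t01; split.
  - move=> j; apply: (der_eq (fX_der alf_gt0 J2 xi j s0 cf t01)).
    by rewrite /frcX (Hf' _ _ t01).
  - move=> j; apply: (der_eq (fU_der alf_gt0 J2 xi s j cf t01)).
    by rewrite /frcU (Hf' _ _ t01).
  - by apply: (der_eq (prim_der (cf (inr true)) t01)); rewrite (Hf' _ _ t01).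
  - by apply: (der_eq (prim_der (cf (inr false)) t01)); rewrite (Hf' _ _ t01).
have i1 : 0 <= (1 : R) <= 1 by rewrite ler01 lexx.
have i0 : 0 <= (0 : R) <= 1 by rewrite ler01 lexx.
have X0 j : xs 0 th (inl (inl j)) = 0 by exact: fX_0.
have Z0 c : xs 0 th (inr c) = 0 by exact: prim0.
have y00 : resc_y b e y0 eta (xs 0 th) = y0.
  rewrite /resc_y /resc_y1 Z0 mulr0 scale0r addr0 big1 ?scaler0 ?addr0// => j _.
  by rewrite X0 scale0r.
exists s, (fun t => resc_y b e y0 eta (xs t th)), (fun t => resc_p b bs es da y0 g0 eta s (xs t th)).
split => //.
- split => //; rewrite /resc_y /resc_y1; congr (_ + _ *: (_ + (_ * _) *: _)).
    by apply: eq_bigr => j _; congr (_ *: _); apply: fX_1 => //; exact: nonres.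
  rewrite /xs /= (@eq_prim _ _ (fun t => eta * F t th (inr true))); last first.
    by move=> t t01; exact: Hf'.
  rewrite prim_scale ?Hz//; have [c _] := TL_F (inr true); exact: c.
- by move=> t t01; exact: (y_box t01 D).
have [dy _] := sol 0 i0; eexists; first exact: dy.
move=> i; rewrite (resc_hvel a da (eta := eta) s (xs 0 th) b_bs b_es e_bs e_es K0g0 et0).
rewrite dotZl dotDl dotZl e_bs mulr0 addr0 dotC dot_sumr (bigD1 i)//= dotZr dotC b_bs eqxx mulr1.
rewrite big1 ?addr0; last by move=> j ji; rewrite dotZr dotC b_bs (negbTE ji) mulr0.
rewrite mulrC mulrA mulVf ?expf_neq0// mul1r /resc_V; apply: le_trans eta_U.
have -> : xs 0 th (inl (inr i)) = fU0 J alf xi s f i by exact: fU_0.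
rewrite addrAC (le_trans (ler_normD _ _))// lerD//.
  apply: (@HU i (s, f) (s, fun _ _ => 0)); [by []|by case: zero_adm|].
  split; rewrite /= ?mulr_ge0 ?(ltW eta_gt0)//.
    by rewrite subrr normr0 mulr_ge0// ltW.
  move=> t' i'; rewrite subr0 -Hf normrM (gtr0_norm eta_gt0) ler_wpM2l ?(ltW eta_gt0)//.
  by have [] := HF i' (clamp01_bd t') D.
rewrite normrM (gtr0_norm eta_gt0) ler_wpM2l ?(ltW eta_gt0)//.
by have [] := HF (inl (inl i)) i0 D.
Qed.

End at_eta0.

Theorem shooting (eps Zh : R) : 0 < eps -> zeta0 s2 + 1 <= Zh <= zeta0 s1 - 1 ->
  exists2 eta1 : R, 0 < eta1 & forall eta, 0 < eta <= eta1 ->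
  exists (s : R) (y p : R -> 'rV[R]_d), [/\ s1 <= s <= s2, ham_sol b e K dK a da y p,
  y 0 = y0 /\ y 1 = y0 + eta ^+ 2 *: ((\sum_j xi j *: row j b) + (eta * (eta * Zh)) *: e),
  forall t : R, 0 <= t <= 1 -> `|y t - y0| < rho &
  exists2 v : 'rV[R]_d, is_derive (0 : R) 1 y v &
    forall i, `|dot v (row i bs) / eta ^+ 2 - fU0 J alf xi s (fun _ _ => 0) i| <= eps].
Proof.
move=> eps0 Zhb; have [eta0 eta0b y_box] := small.
have [CF CF0 HF] := shoot_F_bound eta0b y_box.
have etaE_dom th : DomE eta0 th -> 0 < th.1 <= 1.
  by move=> [/andP[h0 h1] _]; rewrite h0 (le_trans h1)//; case/andP: eta0b.
have [CL CL0 HL] := resc_F3_leading g0 K_C11 a_C11 a_y0 dstE_ge0 etaE_dom etaE_dst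
  (@TL_sg eta0) (@TL_xs eta0) y_box.
have TLA : TL (DomF s1 s2 1) dstF (fun t th => area (fun i => st J alf xi th.1 th.2 i t)).
  apply: (TL_sum (@dstF_ge0 _ _)) => i; apply: TL_mul; first exact: TL_st.
  apply: (TL_sum (@dstF_ge0 _ _)) => j; apply: TL_mul; last exact: TL_st.
  exact: TL_cst (@dstF_ge0 _ _) _.
have [cA [CA CA0 HA]] := TLA.
have /choice[CU HU] i : exists C : R, 0 <= C /\ forall th th' de, DomF s1 s2 1 th -> DomF s1 s2 1 th' ->
    dstF th th' de -> `|fU0 J alf xi th.1 th.2 i - fU0 J alf xi th'.1 th'.2 i| <= C * de.
  have [_ [C C0 HC]] := TL_fU0 J alf_gt0 s1_gt0 s12 ler01 nonres xi i.
  exists C; split => // th th' de Dth Dth' D; have [_] := HC 0 th (introT andP (conj (lexx _) ler01)) Dth.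
  exact.
have CUl l : CU l <= \sum_l CU l.
  by rewrite (bigD1 l)//= lerDl sumr_ge0// => k _; case: (HU k).
have CU0 : 0 <= \sum_l CU l by apply: sumr_ge0 => k _; case: (HU k).
set CUs := \sum_l CU l in CUl CU0.
have p1 : 0 < CF + 1 by rewrite ltr_wpDl.
have p2 : 0 < CL + CA * CF + 1 by rewrite ltr_wpDl// addr_ge0// mulr_ge0.
have p3 : 0 < CUs * CF + CF + 1 by rewrite ltr_wpDl// addr_ge0// mulr_ge0.
have /andP[eta00 _] := eta0b.
(* One threshold for the box and one for each smallness condition of [shoot_eta]: contraction,
   closeness of the heights, closeness of the initial velocities. The added 1 keeps the denominators
   positive. *)
exists (Num.min eta0 (Num.min (2^-1 / (CF + 1)) (Num.min (1 / (CL + CA * CF + 1)) (eps / (CUs * CF + CF + 1))))).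
  by rewrite !lt_min eta00 !divr_gt0// invr_gt0.
move=> eta /andP[eta_gt0]; rewrite !le_min => /and4P[h1 h2 h3 h4].
rewrite ler_pdivlMr// in h2; rewrite ler_pdivlMr// in h3; rewrite ler_pdivlMr// in h4.
apply: (@shoot_eta eta0 eta0b y_box CF CF0 HF eta eta_gt0 h1 _ CL CA CUs eps Zh) => //.
- by rewrite (le_trans _ h2)// ler_wpM2l ?(ltW eta_gt0)// lerDl.
- by move=> t th t01 Dth th' de Dth' D; have [_] := HA t th t01 Dth; exact.
- move=> i th th' de Dth Dth' D; have [_ h] := HU i; have de0 := dstF_ge0 D.
  by rewrite (le_trans (h _ _ _ Dth Dth' D))// ler_wpM2r.
- by rewrite mulrCA [CL * _]mulrC -mulrDr (le_trans _ h3)// ler_wpM2l ?(ltW eta_gt0)// lerDl.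
- by rewrite mulrCA -mulrDr (le_trans _ h4)// ler_wpM2l ?(ltW eta_gt0)// lerDl.
Qed.

End shooting.

(** * The area swept by the model extremals *)

Section enclosed_area.
Context {R : realType} {n : nat} (J B g0 : 'M[R]_n) (alf : 'I_n -> R) (i0 : 'I_n).
Hypothesis alf_gt0 : forall i, 0 < alf i.
Hypothesis J2 : J *m J = - diag_mx (\row_i alf i ^+ 2).
Hypothesis g0_sym : g0^T = g0.
Hypothesis g0J : g0 *m J = B - B^T.
Implicit Types (u v : 'I_n -> R).

Definition gdot u v : R := \sum_i u i * mv g0 v i.
Definition bdot u v : R := \sum_i u i * mv B v i.
(** The horizontal target is a basis vector, hence an eigenvector of [J ^ 2]: the frequency [alf i0]
    alone enters the area. *)
Definition unit_fam (i : 'I_n) : R := (i == i0)%:R.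
Local Notation xi := unit_fam.
Local Notation z0 := (fun _ _ => 0).

Lemma sum_mvT (A : 'M[R]_n) u v : \sum_i u i * mv A v i = \sum_i v i * mv A^T u i.
Proof.
rewrite /mv; under eq_bigr => i _ do rewrite mulr_sumr.
rewrite exchange_big; apply: eq_bigr => j _ /=; rewrite mulr_sumr; apply: eq_bigr => i _.
by rewrite mxE; ring.
Qed.

Lemma gdotC u v : gdot u v = gdot v u.
Proof. by rewrite /gdot sum_mvT g0_sym. Qed.

Lemma gdotDl u v w : gdot (fun i => u i + v i) w = gdot u w + gdot v w.
Proof. by rewrite /gdot -big_split; apply: eq_bigr => i _; rewrite mulrDl. Qed.

Lemma gdotZl c u w : gdot (fun i => c * u i) w = c * gdot u w.
Proof. by rewrite /gdot mulr_sumr; apply: eq_bigr => i _; rewrite mulrA. Qed.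

Lemma gdotDr u v w : gdot w (fun i => u i + v i) = gdot w u + gdot w v.
Proof. by rewrite gdotC gdotDl !(gdotC w). Qed.

Lemma gdotZr c u w : gdot w (fun i => c * u i) = c * gdot w u.
Proof. by rewrite gdotC gdotZl (gdotC w). Qed.

Lemma eq_gdot u u' v v' : u =1 u' -> v =1 v' -> gdot u v = gdot u' v'.
Proof. by move=> uu vv; apply: eq_bigr => i _; rewrite uu (eq_mv _ _ vv). Qed.

Lemma gdotJ u v : gdot u (mv J v) = bdot u v - bdot v u.
Proof.
rewrite /gdot; under eq_bigr => i _ do rewrite mv_mul g0J.
rewrite {2}/bdot sum_mvT /bdot -sumrB; apply: eq_bigr => i _; rewrite -mulrBr; congr (_ * _).
by rewrite /mv -sumrB; apply: eq_bigr => j _; rewrite !mxE mulrBl.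
Qed.

Lemma gdotJ_skew u v : gdot (mv J u) v = - gdot u (mv J v).
Proof. by rewrite gdotC !gdotJ opprB. Qed.

Lemma gdotJ0 u : gdot u (mv J u) = 0.
Proof. by rewrite gdotJ subrr. Qed.

Lemma prim_zero (t : R) : 0 <= t <= 1 -> prim (fun=> 0) t = 0 :> R.
Proof.
move=> t01; rewrite (@prim_uniq _ _ (fun=> 0)) ?subrr//; exact: cont01_cst.
Qed.

Lemma fQ_0 s i (t : R) : 0 <= t <= 1 -> fQ J s z0 i t = 0.
Proof.
move=> t01; rewrite /fQ (@eq_prim _ _ (fun=> 0)) ?prim_zero// => r _.
by rewrite /frcU /frcX mv0 mulr0 subr0.
Qed.

Lemma fI_0 s i (t : R) : 0 <= t <= 1 -> fI J alf s z0 i t = 0.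
Proof.
move=> t01; rewrite /fI (@eq_prim _ _ (fun=> 0)) ?prim_zero// => r _.
by rewrite /rotn /frcU mv0 !mulr0 subr0.
Qed.

Lemma fU0_0 s i : fU0 J alf xi s z0 i =
  s * (- (2^-1 * mv J xi i) + alf i0 ^+ 2 * sig alf s i0 * xi i).
Proof.
have i1 : 0 <= (1 : R) <= 1 by rewrite ler01 lexx.
have E j : fG J alf xi s z0 j = s * mv J xi j.
  have Z : mv J (fun k => fI J alf s z0 k 1) j = 0.
    by rewrite (@eq_mv _ _ J _ (fun=> 0)) ?mv0// => k; rewrite fI_0.
  by rewrite /fG fQ_0// /rot Z fI_0// !mulr0 addr0 subr0 addr0.
rewrite /fU0 (@eq_mv _ _ _ _ (fun j => s * mv J xi j))// E mvZ (mvJJ J2).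
rewrite /unit_fam; case: eqVneq => [->|_]; first by ring.
by rewrite !(mulr0, oppr0, addr0); ring.
Qed.

Lemma mvJ_fX s i (t : R) : s != 0 -> 0 <= t <= 1 ->
  mv J (fun j => fX J alf xi s z0 j t) i = s^-1 * (fU J alf xi s z0 i t - fU0 J alf xi s z0 i).
Proof.
move=> s0 t01.
pose w j := fU J alf xi s z0 j t - fU0 J alf xi s z0 j.
rewrite (@eq_mv _ _ _ _ (fun j => (fun x => - (s * x ^+ 2)^-1) (alf j) * mv J w j)); last first.
  move=> j; rewrite /fX mulNr; congr (- (_ * _)); apply: eq_mv => k.
  by rewrite fQ_0// subr0.
rewrite (mvJ_diag alf_gt0 J2 (fun x => - (s * x ^+ 2)^-1)) (mvJJ J2) /w.
by field; rewrite s0 alf_neq0.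
Qed.

(** [J] is skew for [g0], so the flow [U' = s J U] conserves the speed. *)
Lemma gdot_fU s (t : R) : 0 <= t <= 1 ->
  gdot ((fU J alf xi s z0)^~ t) ((fU J alf xi s z0)^~ t) = gdot (fU0 J alf xi s z0) (fU0 J alf xi s z0).
Proof.
move=> t01; have [t0 t1] := andP t01.
have cz : cont_frc (z0 : R -> ('I_n + 'I_n + bool) -> R) by move=> i; exact: cont01_cst.
have dU i (r : R) : 0 <= r <= 1 -> is_derive r 1 (fU J alf xi s z0 i)
    (s * mv J ((fU J alf xi s z0)^~ r) i).
  move=> r01; apply: (der_eq (fU_der alf_gt0 J2 xi s i cz r01)).
  by rewrite /frcU addr0.
have D (r : R) : 0 <= r <= 1 -> is_derive r 1 (fun r => gdot ((fU J alf xi s z0)^~ r) ((fU J alf xi s z0)^~ r)) 0.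
  move=> r01.
  have D1 : is_derive r 1 (fun r => gdot ((fU J alf xi s z0)^~ r) ((fU J alf xi s z0)^~ r))
     (\sum_i (s * mv J ((fU J alf xi s z0)^~ r) i * mv g0 ((fU J alf xi s z0)^~ r) i +
       fU J alf xi s z0 i r * mv g0 (fun j => s * mv J ((fU J alf xi s z0)^~ r) j) i)).
    by apply: dersum => i; apply: derM; [exact: dU|apply: der_mv => j; exact: dU].
  apply: (der_eq D1); rewrite big_split /=.
  set u := (fU J alf xi s z0)^~ r.
  transitivity (gdot (fun j => s * mv J u j) u + gdot u (fun j => s * mv J u j)) => //.
  by rewrite gdotZl gdotZr gdotJ_skew gdotJ0 oppr0 !mulr0 addr0.
have bd (r : R) : 0 <= r <= 1 -> `|0 : R| <= 0 by rewrite normr0.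
have := lip_seg_der D bd (lexx 0) t0 t1.
rewrite mul0r normr_le0 subr_eq0 => /eqP ->.
by apply: eq_gdot => i; exact: fU_0.
Qed.

(* [2^-1 X . B X + (2 s)^-1 (t |U0|^2 - <X, U0>)] is a primitive, as [s J X = U - U0] and [|U|]
   is conserved. *)
Lemma area_st s : s != 0 -> nonresonant alf s ->
  prim (fun t => bdot (fun i => st J alf xi s z0 (inl (inr i)) t) (fun i => st J alf xi s z0 (inl (inl i)) t)) 1 =
  2^-1 * bdot xi xi + (2 * s)^-1 *
    (gdot (fU0 J alf xi s z0) (fU0 J alf xi s z0) - gdot xi (fU0 J alf xi s z0)).
Proof.
move=> s0 nr; set c := gdot (fU0 J alf xi s z0) (fU0 J alf xi s z0).
have cz : cont_frc (z0 : R -> ('I_n + 'I_n + bool) -> R) by move=> i; exact: cont01_cst.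
have i1 : 0 <= (1 : R) <= 1 by rewrite ler01 lexx.
pose U i := fU J alf xi s z0 i; pose X i := fX J alf xi s z0 i.
have dU i (r : R) : 0 <= r <= 1 -> is_derive r 1 (U i) (s * mv J (U^~ r) i).
  move=> r01; apply: (der_eq (fU_der alf_gt0 J2 xi s i cz r01)).
  by rewrite /frcU addr0.
have dX i (r : R) : 0 <= r <= 1 -> is_derive r 1 (X i) (U i r).
  move=> r01; apply: (der_eq (fX_der alf_gt0 J2 xi i s0 cz r01)).
  by rewrite /frcX addr0.
pose P t := 2^-1 * bdot (X^~ t) (X^~ t) + (2 * s)^-1 * (t * c - gdot (X^~ t) (fU0 J alf xi s z0)).
have dP (t : R) : 0 <= t <= 1 -> is_derive t 1 P (bdot (U^~ t) (X^~ t)).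
  move=> t01.
  have D1 : is_derive t 1 (fun t => bdot (X^~ t) (X^~ t))
      (\sum_i (U i t * mv B (X^~ t) i + X i t * mv B (U^~ t) i)).
    by apply: dersum => i; apply: derM; [exact: dX|apply: der_mv => j; exact: dX].
  have D2 : is_derive t 1 (fun t => gdot (X^~ t) (fU0 J alf xi s z0))
      (\sum_i (U i t * mv g0 (fU0 J alf xi s z0) i + X i t * 0)).
    by apply: dersum => i; exact: derM (dX i t t01) (dercst t _).
  have D3 := derD (derMl (2^-1) D1) (derMl ((2 * s)^-1) (derB (derM (derid t) (dercst t c)) D2)).
  apply: (der_eq D3).
  have -> : \sum_i (U i t * mv g0 (fU0 J alf xi s z0) i + X i t * 0) = gdot (U^~ t) (fU0 J alf xi s z0).
    by apply: eq_bigr => i _; rewrite mulr0 addr0.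
  rewrite big_split /= mul1r mulr0 addr0.
  have H : bdot (U^~ t) (X^~ t) - bdot (X^~ t) (U^~ t) = s^-1 * (c - gdot (U^~ t) (fU0 J alf xi s z0)).
    rewrite -gdotJ (@eq_gdot _ (U^~ t) _ (fun i => s^-1 * (U i t + (-1) * fU0 J alf xi s z0 i)))//.
      by rewrite gdotZr gdotDr gdotZr mulN1r gdot_fU.
    by move=> i; rewrite mvJ_fX// mulN1r.
  rewrite -/(bdot (U^~ t) (X^~ t)) -/(bdot (X^~ t) (U^~ t)).
  have -> : bdot (X^~ t) (U^~ t) = bdot (U^~ t) (X^~ t) - s^-1 * (c - gdot (U^~ t) (fU0 J alf xi s z0)).
    by rewrite -H; ring.
  by field.
have cA : cont01 (fun t => bdot (U^~ t) (X^~ t)).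
  apply: cont01_sum => i; apply: cont01_mul.
    by move=> t t01; exact: is_derive_continuous (dU i t t01).
  apply: cont01_sum => j; apply: cont01_mul; first exact: cont01_cst.
  by move=> t t01; exact: is_derive_continuous (dX j t t01).
rewrite (prim_uniq cA dP i1) /P.
have X1 i : X i 1 = xi i by exact: fX_1.
have X0 i : X i 0 = 0 by exact: fX_0.
have -> : bdot (X^~ 1) (X^~ 1) = bdot xi xi by apply: eq_bigr => i _; rewrite X1 (eq_mv _ _ X1).
have -> : bdot (X^~ 0) (X^~ 0) = 0 by apply: big1 => i _; rewrite X0 mul0r.
have -> : gdot (X^~ 0) (fU0 J alf xi s z0) = 0 by apply: big1 => i _; rewrite X0 mul0r.
rewrite (@eq_gdot (X^~ 1) xi _ (fU0 J alf xi s z0))//; ring.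
Qed.

Lemma gdot_unit : gdot xi xi = g0 i0 i0.
Proof.
rewrite /gdot (bigD1 i0)//= big1 ?addr0; last by move=> j /negbTE h; rewrite /unit_fam h mul0r.
rewrite /unit_fam eqxx mul1r /mv (bigD1 i0)//= eqxx mulr1 big1 ?addr0// => j /negbTE h.
by rewrite h mulr0.
Qed.

Lemma gdot_unitJ : gdot (mv J xi) (mv J xi) = alf i0 ^+ 2 * g0 i0 i0.
Proof.
rewrite gdotJ_skew (@eq_gdot xi xi _ (fun i => - alf i0 ^+ 2 * xi i))//; last first.
  move=> i; rewrite (mvJJ J2) /unit_fam; case: eqVneq => [->|_]; first by rewrite mulNr.
  by rewrite !mulr0 oppr0.
by rewrite gdotZr gdot_unit; ring.
Qed.

(** The initial velocity paired with [J xi] is a fixed multiple of [s]: the multiplier can be read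
    off the initial velocity. *)
Lemma gdot_fU0J s : gdot (fU0 J alf xi s z0) (mv J xi) = - (s / 2 * (alf i0 ^+ 2 * g0 i0 i0)).
Proof.
rewrite (@eq_gdot _ (fun i => s * ((- 2^-1) * mv J xi i + alf i0 ^+ 2 * sig alf s i0 * xi i)) _ (mv J xi))//.
  by rewrite gdotZl gdotDl !gdotZl gdot_unitJ gdotJ0; ring.
by move=> i; rewrite fU0_0 mulNr.
Qed.

Lemma area_formula s : s != 0 -> nonresonant alf s -> let kap := alf i0 ^+ 2 * sig alf s i0 in
  prim (fun t => bdot (fun i => st J alf xi s z0 (inl (inr i)) t) (fun i => st J alf xi s z0 (inl (inl i)) t)) 1 =
  2^-1 * bdot xi xi + 2^-1 * g0 i0 i0 * (s * (alf i0 ^+ 2 / 4 + kap ^+ 2) - kap).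
Proof.
move=> s0 nr kap; rewrite area_st//.
have E : fU0 J alf xi s z0 =1 (fun i => s * ((- 2^-1) * mv J xi i + kap * xi i)).
  by move=> i; rewrite fU0_0 mulNr.
have xJ : gdot (mv J xi) xi = 0 by rewrite gdotC gdotJ0.
rewrite (eq_gdot E E) (@eq_gdot xi xi _ _ (frefl _) E).
rewrite !(gdotZl, gdotZr, gdotDl, gdotDr) gdot_unitJ gdotJ0 xJ gdot_unit; field.
by [].
Qed.

End enclosed_area.

(** * Bounds near the resonances, and derivatives at 0 from the right *)

Section trigonometric_bounds.
Context {R : realType}.

(** The inverse of one plus the sum of the inverses is such a bound, and it also makes sense when
    [I] is empty. *)
Lemma finite_pos_lb (I : finType) (f : I -> R) : (forall i, 0 < f i) ->
  exists2 m : R, 0 < m & forall i, m <= f i.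
Proof.
move=> f0; have S0 : 0 <= \sum_i (f i)^-1 by apply: sumr_ge0 => i _; rewrite invr_ge0 ltW.
have S1 : 0 < (\sum_i (f i)^-1) + 1 by rewrite ltr_wpDl.
exists ((\sum_i (f i)^-1) + 1)^-1; first by rewrite invr_gt0.
move=> i; rewrite -[leRHS]invrK lef_pV2 ?posrE ?invr_gt0// (bigD1 i)//=.
rewrite -addrA lerDl addr_ge0// sumr_ge0// => j _.
by rewrite invr_ge0 ltW.
Qed.

(** If [s] is a resonance, the next one is [2 pi / al] away; otherwise the cosine, being
    1-Lipschitz, stays below 1 for a while. *)
Lemma nonresonant_right (al s : R) : 0 < al ->
  exists2 de : R, 0 < de & forall u, 0 < u <= de -> 2 - 2 * cos ((s + u) * al) != 0.
Proof.
move=> al0; have [c1|c1] := eqVneq (cos (s * al)) 1.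
  have s1 : sin (s * al) = 0 by apply/eqP; rewrite -norm_cos_eq1 c1 normr1.
  exists (pi / al); first by rewrite divr_gt0// pi_gt0.
  move=> u /andP[u0 ud]; rewrite (mulrDl s u al) cosD s1 mul0r subr0 c1 mul1r.
  have : cos (u * al) < 1.
    rewrite -cos0 ltr_cos ?in_itv/= ?mulr_gt0 ?lexx ?pi_ge0//.
    by apply/andP; split; [rewrite mulr_ge0// ltW|rewrite -ler_pdivlMr].
  by move=> h; rewrite gt_eqF//; lra.
have c2 : cos (s * al) < 1 by rewrite lt_neqAle c1 cos_le1.
exists ((1 - cos (s * al)) / (2 * al)); first by rewrite divr_gt0 ?mulr_gt0// subr_gt0.
move=> u /andP[u0 ud].
have h : `|cos ((s + u) * al) - cos (s * al)| <= (1 - cos (s * al)) / 2.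
  rewrite (le_trans (norm_cos_sub _ _))// (mulrDl s u al) addrAC subrr add0r ger0_norm ?mulr_ge0 ?(ltW u0) ?(ltW al0)//.
  move: ud; rewrite -ler_pdivlMr// => /le_trans; apply.
  by rewrite le_eqVlt; apply/orP; left; apply/eqP; field; rewrite gt_eqF.
have /ler_normlP[_ h2] := h.
by rewrite gt_eqF//; lra.
Qed.

(** Amounts to [tan (v / 2) <= v], from [(1 - cos v) (1 + cos v) = sin v ^ 2 <= v sin v] and
    [0 < cos v]. It gives the rate of blow-up at the poles. *)
Lemma half_cot_ge (v : R) : 0 < v < pi / 2 -> (2 * v)^-1 <= sin v / (2 - 2 * cos v).
Proof.
move=> vb; have /andP[v0 v1] := vb.
have sv : 0 < sin v by apply: sin_gt0_pihalf.
have cv : 0 < cos v by apply: cos_gt0_pihalf; rewrite v1 andbT (lt_trans _ v0)// oppr_lt0 divr_gt0// pi_gt0.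
have sle : sin v <= v.
  by have := norm_sin_sub v 0; rewrite sin0 !subr0 (gtr0_norm sv) (gtr0_norm v0).
have c1 : cos v < 1.
  rewrite lt_neqAle cos_le1 andbT; apply/negP => /eqP c1.
  by have := cos2Dsin2 v; rewrite c1 => /eqP; rewrite expr1n -subr_eq0 addrAC subrr add0r sqrf_eq0 gt_eqF.
have D0 : 0 < 2 - 2 * cos v by lra.
rewrite ler_pdivlMr// mulrC ler_pdivrMr ?mulr_gt0//.
have cs := cos2Dsin2 v.
have : sin v * sin v <= sin v * v by rewrite ler_wpM2l// ltW.
have -> : sin v * sin v = (1 - cos v) * (1 + cos v) by rewrite -[X in X = _]expr2 -[LHS](addKr (cos v ^+ 2)) cs; ring.
have : 0 <= (1 - cos v) * cos v by rewrite mulr_ge0 ?ltW ?subr_gt0.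
by move=> h1 h2; lra.
Qed.

Lemma sin_period (x : R) k : sin (x + (pi *+ 2) *+ k) = sin x.
Proof. exact: periodicn (@sinD2pi R) _ _. Qed.

Lemma cos_period (x : R) k : cos (x + (pi *+ 2) *+ k) = cos x.
Proof. exact: periodicn (@cosD2pi R) _ _. Qed.

(** Curves are compared on [[0, 1]] only, and the difference quotients to the right already
    determine the derivative at 0. *)
Lemma is_derive_right_uniq {d : nat} (f g : R -> 'rV[R]_d) v w :
  is_derive (0 : R) 1 f v -> is_derive (0 : R) 1 g w ->
  (forall t : R, 0 <= t <= 1 -> f t = g t) -> v = w.
Proof.
move=> df dg fg; apply/rowP => l.
have cf := is_derive_cvg_seq (is_derive_rV_coord l df).
have cg := is_derive_cvg_seq (is_derive_rV_coord l dg).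
suff E : (fun n => n.+1%:R * (f (0 + n.+1%:R^-1) 0 l - f 0 0 l)) =
    (fun n => n.+1%:R * (g (0 + n.+1%:R^-1) 0 l - g 0 0 l)).
  by rewrite -(cvg_lim _ cf)// -(cvg_lim _ cg)// E.
apply: funext => k; rewrite add0r !fg ?lexx ?ler01//.
by rewrite invr_ge0 ler0n invf_le1 ?ltr0n// ler1n.
Qed.

End trigonometric_bounds.

(** * Many extremals with common endpoints *)

Section many_solutions.
Context {R : realType} {n d : nat} (b : 'M[R]_(n, d)) (e : 'rV[R]_d).
Context (bs : 'M[R]_(n, d)) (es : 'rV[R]_d).
Context (K : 'I_n -> 'I_n -> 'rV[R]_d -> R) (dK : 'I_n -> 'I_n -> 'I_d -> 'rV[R]_d -> R).
Context (a : 'I_n -> 'rV[R]_d -> R) (da : 'I_n -> 'I_d -> 'rV[R]_d -> R).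
Context (y0 : 'rV[R]_d) (g0 : 'M[R]_n) (rho : R).
Hypothesis K_C11 : forall i j, exists2 C : R, 0 <= C & C11 y0 rho C (K i j) (dK i j).
Hypothesis a_C11 : forall j, exists2 C : R, 0 <= C & C11 y0 rho C (a j) (da j).
Hypothesis a_y0 : forall j, a j y0 = 0.
Hypothesis b_bs : forall i j, dot (row i b) (row j bs) = (i == j)%:R.
Hypothesis b_es : forall i, dot (row i b) es = 0.
Hypothesis e_bs : forall j, dot e (row j bs) = 0.
Hypothesis e_es : dot e es = 1.
Hypothesis dual_span : forall v, v = dot v e *: es + \sum_j dot v (row j b) *: row j bs.
Hypothesis K0g0 : metric_inv0 K y0 *m g0 = 1%:M.
Hypothesis g0_sym : g0^T = g0.
Local Notation J := (metric_inv0 K y0 *m curv0 b da y0).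
Local Notation B := (jac0 b da y0).
Context (alf : 'I_n -> R).
Hypothesis alf_gt0 : forall i, 0 < alf i.
Hypothesis J2 : J *m J = - diag_mx (\row_i alf i ^+ 2).
Context (i0 : 'I_n).
Hypothesis g0_gt0 : 0 < g0 i0 i0.
Local Notation xi := (unit_fam (R := R) i0).
Local Notation al := (alf i0).
Local Notation zeta := (zeta0 b K da y0 alf xi).
Local Notation z0 := (fun _ _ => 0).

Let g0J : g0 *m J = B - B^T.
Proof. by rewrite mulmxA (mulmx1C K0g0) mul1mx. Qed.

Let kap s := al ^+ 2 * sig alf s i0.
(** The shift to [k.+1] leaves out the multiplier 0, at which the model formulas divide by 0. *)
Let sk (k : nat) : R := (pi *+ 2) *+ k.+1 / al.

Let zetaE s : s != 0 -> nonresonant alf s -> zeta s =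
  2^-1 * bdot B xi xi + 2^-1 * g0 i0 i0 * (s * (al ^+ 2 / 4 + kap s ^+ 2) - kap s).
Proof. by move=> s0 nr; rewrite -(area_formula i0 alf_gt0 J2 g0_sym g0J). Qed.

Let sk_lb k : pi *+ 2 / al <= sk k.
Proof.
rewrite /sk ler_wpM2r ?invr_ge0 ?(ltW (alf_gt0 _))// (mulrS (pi *+ 2) k) lerDl mulrn_wge0//.
by rewrite mulrn_wge0// pi_ge0.
Qed.

Let s0_gt0 : 0 < pi *+ 2 / al :> R.
Proof. by rewrite divr_gt0// mulrn_wgt0// pi_gt0. Qed.

(** [sk k * al] is a multiple of the period, so only the offset [u] from the pole counts. *)
Let kap_lb k u : 0 < u -> u * al < pi / 2 -> (2 * u)^-1 <= kap (sk k + u).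
Proof.
move=> u0 ual; rewrite /kap /sig.
have -> : (sk k + u) * al = u * al + (pi *+ 2) *+ k.+1.
  by rewrite mulrDl /sk mulfVK ?gt_eqF// addrC.
rewrite sin_period cos_period.
have ua : 0 < u * al < pi / 2 by rewrite mulr_gt0.
have := half_cot_ge ua.
set D := 2 - 2 * cos _; set sn := sin _ => h.
have -> : al ^+ 2 * (sn * (al * D)^-1) = al * (sn / D).
  by rewrite invfM; set E := D^-1; field; rewrite gt_eqF.
have -> : (2 * u)^-1 = al * (2 * (u * al))^-1.
  by field; rewrite !gt_eqF.
by rewrite ler_wpM2l// ltW.
Qed.

(* [kap] has a pole at the conjugate multiplier [sk k]. *)
Let zeta_lb k u : 0 < u -> u * al < pi / 2 -> u <= (pi *+ 2 / al) / 4 -> nonresonant alf (sk k + u) ->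
  2^-1 * bdot B xi xi + g0 i0 i0 / (4 * u) <= zeta (sk k + u).
Proof.
move=> u0 ual us nr; set s := sk k + u.
have s_ge : pi *+ 2 / al <= s by rewrite /s (le_trans (sk_lb k))// lerDl ltW.
have s_gt0 : 0 < s by apply: lt_le_trans s_ge.
rewrite zetaE ?gt_eqF// lerD2l.
have kb : (2 * u)^-1 <= kap s := kap_lb k u0 ual.
have k0 : 0 < kap s by rewrite (lt_le_trans _ kb)// invr_gt0 mulr_gt0.
have sk2 : 2 <= s * kap s.
  apply: (@le_trans _ _ (4 * u * (2 * u)^-1)).
    by rewrite le_eqVlt; apply/orP; left; apply/eqP; field; rewrite gt_eqF.
  rewrite ler_pM// ?mulr_ge0 ?invr_ge0 ?mulr_ge0 ?(ltW u0)//.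
  by rewrite (le_trans _ s_ge)// -ler_pdivlMl// mulrC.
have -> : g0 i0 i0 / (4 * u) = 2^-1 * g0 i0 i0 * (2 * u)^-1 by field; rewrite gt_eqF.
rewrite ler_wpM2l ?mulr_ge0 ?invr_ge0 ?(ltW g0_gt0)// (le_trans kb)//.
have : kap s <= kap s * (s * kap s - 1) by rewrite ler_peMr ?(ltW k0)// lerBrDr.
have : 0 <= s * (al ^+ 2 / 4) by rewrite mulr_ge0 ?(ltW s_gt0)// divr_ge0// sqr_ge0.
have -> : s * (al ^+ 2 / 4 + kap s ^+ 2) - kap s = s * (al ^+ 2 / 4) + kap s * (s * kap s - 1) by ring.
by move=> h1 h2; apply: le_trans h2 _; rewrite lerDr.
Qed.

Theorem many_solutions (m : nat) (r : R) : 0 < r <= rho ->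
  exists (y1 : 'rV[R]_d) (Y P : 'I_m.+1 -> R -> 'rV[R]_d), [/\ y1 != y0,
    forall k, [/\ ham_sol b e K dK a da (Y k) (P k), Y k 0 = y0, Y k 1 = y1 &
      forall t : R, 0 <= t <= 1 -> `|Y k t - y0| < r] &
    forall k l, k != l -> exists2 t : R, 0 <= t <= 1 & Y k t != Y l t].
Proof.
move=> /andP[r0 rr].
have al0 := alf_gt0 i0.
have pi0 : 0 < pi :> R := pi_gt0 R.
(* Other frequencies may also resonate at [sk k]; to the right of it each of them leaves a gap free
   of resonances, and these finitely many gaps have a common length. *)
have /choice[D HD] (kj : 'I_m.+1 * 'I_n) : exists de : R, 0 < de /\
    forall u, 0 < u <= de -> 2 - 2 * cos ((sk kj.1 + u) * alf kj.2) != 0.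
  by have [de de0 H] := nonresonant_right (sk kj.1) (alf_gt0 kj.2); exists de.
have [de1 de10 Hde1] := finite_pos_lb (fun kj => (HD kj).1).
(* The bound [pi / (4 al)] gives [de * al < pi / 2] and keeps multipliers from different intervals
   at least [pi / al] apart. *)
pose de := Num.min de1 (pi / (4 * al)).
have de0 : 0 < de by rewrite lt_min de10 divr_gt0// mulr_gt0.
have nr (k : 'I_m.+1) u : 0 < u <= de -> nonresonant alf (sk k + u).
  move=> /andP[u0 ud] i; apply: (HD (k, i)).2; rewrite u0 (le_trans ud)//.
  by rewrite (le_trans _ (Hde1 _))// ge_min lexx.
have deal : de * al < pi / 2.
  apply: (@le_lt_trans _ _ (pi / 4)).
    rewrite -ler_pdivlMr//; have : de <= pi / (4 * al) by rewrite ge_min lexx orbT.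
    by move/le_trans; apply; rewrite invfM mulrA.
  by rewrite ltr_pM2l// ltf_pV2 ?posrE// ltr_nat.
(* Exceeds [zeta0] by at least 1 at the right ends of all the intervals. *)
pose Zh := 1 + \sum_(k < m.+1) `|zeta (sk k + de)|.
have Zh_ub (k : 'I_m.+1) : zeta (sk k + de) + 1 <= Zh.
  rewrite /Zh addrC lerD2l (le_trans (ler_norm _))// (bigD1 k)//= lerDl.
  by rewrite sumr_ge0.
pose b0 := 2^-1 * bdot B xi xi.
pose w := `|Zh + 1 - b0| + 1.
have w0 : 0 < w by rewrite ltr_wpDl.
(* So close to the poles that the term [g0 / (4 u)] of [zeta_lb] lifts [zeta0] to at least [Zh + 1]
   at all the left ends. *)
pose u := Num.min de (Num.min ((pi *+ 2 / al) / 4) (g0 i0 i0 / (4 * w))).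
have u0 : 0 < u by rewrite lt_min de0/= lt_min !divr_gt0 ?mulr_gt0// mulrn_wgt0.
have ude : u <= de by rewrite ge_min lexx.
have Zh_lb (k : 'I_m.+1) : Zh <= zeta (sk k + u) - 1.
  have ual : u * al < pi / 2 by rewrite (le_lt_trans _ deal)// ler_wpM2r// ltW.
  have us : u <= (pi *+ 2 / al) / 4 by rewrite !ge_min lexx !orbT.
  have nru : nonresonant alf (sk k + u) by apply: nr; rewrite u0.
  rewrite lerBrDr; apply: le_trans (zeta_lb u0 ual us nru).
  rewrite -lerBlDl (@le_trans _ _ w)//; first by rewrite (le_trans (ler_norm _))// lerDl.
  have : u <= g0 i0 i0 / (4 * w) by rewrite !ge_min lexx !orbT.
  by rewrite !ler_pdivlMr ?mulr_gt0// => h; rewrite (_ : w * (4 * u) = u * (4 * w))//; ring.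
pose W := \sum_i `|mv g0 (mv J xi) i|.
have W0 : 0 <= W by apply: sumr_ge0.
have W1 : 0 < W + 1 by rewrite ltr_wpDl.
(* Multipliers [pi / al] apart change the pairing with [J xi] by at least [gap / 2], whereas a
   common initial velocity allows a change of at most [2 eps W < gap / 4]. *)
pose gap := al * pi * g0 i0 i0.
have gap0 : 0 < gap by rewrite !mulr_gt0.
pose eps := gap / (8 * (W + 1)).
have eps0 : 0 < eps by rewrite divr_gt0// mulr_gt0.
have K_C11' i j : exists2 C : R, 0 <= C & C11 y0 r C (K i j) (dK i j).
  have [C C0 HC] := K_C11 i j; exists C => // x y hx hy.
  by apply: HC; rewrite (le_trans _ rr).
have a_C11' j : exists2 C : R, 0 <= C & C11 y0 r C (a j) (da j).
  have [C C0 HC] := a_C11 j; exists C => // x y hx hy.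
  by apply: HC; rewrite (le_trans _ rr).
have /choice[eta_ Heta] (k : 'I_m.+1) : exists eta1 : R, 0 < eta1 /\ forall eta, 0 < eta <= eta1 ->
  exists (s : R) (y p : R -> 'rV[R]_d), [/\ sk k + u <= s <= sk k + de, ham_sol b e K dK a da y p,
  y 0 = y0 /\ y 1 = y0 + eta ^+ 2 *: ((\sum_j xi j *: row j b) + (eta * (eta * Zh)) *: e),
  forall t : R, 0 <= t <= 1 -> `|y t - y0| < r &
  exists2 v : 'rV[R]_d, is_derive (0 : R) 1 y v &
    forall i, `|dot v (row i bs) / eta ^+ 2 - fU0 J alf xi s z0 i| <= eps].
  have s1_gt0 : 0 < sk k + u by rewrite addr_gt0// (lt_le_trans s0_gt0)// sk_lb.
  have s12 : sk k + u <= sk k + de by rewrite lerD2l.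
  have nres s : sk k + u <= s <= sk k + de -> nonresonant alf s.
    move=> /andP[h1 h2]; rewrite -(subrKC (sk k) s); apply: nr.
    by rewrite lerBlDl h2 andbT (lt_le_trans u0)// lerBrDl.
  have Zb : zeta (sk k + de) + 1 <= Zh <= zeta (sk k + u) - 1 by rewrite Zh_ub Zh_lb.
  have [eta1 e1 H] := shooting r0 K_C11' a_C11' a_y0 b_bs b_es e_bs e_es dual_span K0g0
    alf_gt0 J2 s1_gt0 s12 nres eps0 Zb.
  by exists eta1; split.
(* One [eta] serves all the intervals, so that all the extremals end at the same point [y1]. *)
have [eta eta0 Heta1] := finite_pos_lb (fun k => (Heta k).1).
pose y1 := y0 + eta ^+ 2 *: ((\sum_j xi j *: row j b) + (eta * (eta * Zh)) *: e).
have /choice[q Hq] (k : 'I_m.+1) : exists q : R * (R -> 'rV[R]_d) * (R -> 'rV[R]_d),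
  [/\ sk k + u <= q.1.1 <= sk k + de, ham_sol b e K dK a da q.1.2 q.2,
  q.1.2 0 = y0 /\ q.1.2 1 = y1,
  forall t : R, 0 <= t <= 1 -> `|q.1.2 t - y0| < r &
  exists2 v : 'rV[R]_d, is_derive (0 : R) 1 q.1.2 v &
    forall i, `|dot v (row i bs) / eta ^+ 2 - fU0 J alf xi q.1.1 z0 i| <= eps].
  have [_ /(_ eta)[|s [y [p H]]]] := Heta k; first by rewrite eta0 Heta1.
  by exists (s, y, p).
exists y1, (fun k => (q k).1.2), (fun k => (q k).2); split.
- apply/eqP => /(congr1 (fun v => dot (v - y0) (row i0 bs))).
  rewrite subrr /y1 addrAC subrr add0r dotZl dotDl dotZl e_bs mulr0 addr0 dotC dot_sumr (bigD1 i0)//=.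
  rewrite big1; last by move=> j ji; rewrite dotZr dotC b_bs (negbTE ji) mulr0.
  rewrite dotZr dotC b_bs eqxx /unit_fam eqxx !mulr1 addr0 => /eqP.
  rewrite mulr1 [X in _ == X]big1 ?sqrf_eq0 ?gt_eqF// => l _.
  by rewrite mxE mul0r.
- by move=> k; have [_ ? [? ?] ? _] := Hq k; split.
move=> k l kl; apply: contrapT => H.
have same (t : R) : 0 <= t <= 1 -> (q k).1.2 t = (q l).1.2 t.
  by move=> t01; apply/eqP; apply: contrapT => /negP h; apply: H; exists t.
have [sbk _ _ _ [v dv Hv]] := Hq k; have [sbl _ _ _ [v' dv' Hv']] := Hq l.
have vv : v = v' := is_derive_right_uniq dv dv' same.
rewrite -vv in Hv'.
pose V i := dot v (row i bs) / eta ^+ 2.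
have close s (h : forall i, `|V i - fU0 J alf xi s z0 i| <= eps) :
    `|gdot g0 V (mv J xi) + s / 2 * (al ^+ 2 * g0 i0 i0)| <= eps * W.
  have := gdot_fU0J i0 J2 g0_sym g0J s.
  move=> E; rewrite -[X in _ + X]opprK -E.
  rewrite /gdot -sumrB (le_trans (ler_norm_sum _ _ _))// /W mulr_sumr; apply: ler_sum => i _.
  by rewrite -mulrBl normrM ler_wpM2r.
have h1 := close _ Hv; have h2 := close _ Hv'.
have : `|((q k).1.1 - (q l).1.1) / 2 * (al ^+ 2 * g0 i0 i0)| <= eps * W + eps * W.
  rewrite (_ : _ * _ = (gdot g0 V (mv J xi) + (q k).1.1 / 2 * (al ^+ 2 * g0 i0 i0)) -
    (gdot g0 V (mv J xi) + (q l).1.1 / 2 * (al ^+ 2 * g0 i0 i0))); last by ring.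
  by rewrite (le_trans (ler_normB _ _))// lerD.
apply/negP; rewrite -ltNge.
have epsW : eps * W + eps * W < gap / 4.
  have e8 : eps * (8 * (W + 1)) = gap by rewrite /eps mulfVK// gt_eqF// mulr_gt0.
  by rewrite -e8; move: eps0; lra.
apply: (lt_le_trans epsW).
have sep : pi / al <= `|(q k).1.1 - (q l).1.1|.
  move: sbk sbl; set s := (q k).1.1; set s' := (q l).1.1 => sbk sbl.
  wlog lt : k l s s' sbk sbl {H same dv Hv dv' Hv' h1 h2 kl} / (k < l)%N.
    move: kl; rewrite -val_eqE neq_ltn => /orP[] kl' Hw; first exact: (Hw k l).
    by rewrite distrC; exact: (Hw l k).
  rewrite distrC (le_trans _ (ler_norm _))//.
  have skl : sk k + pi *+ 2 / al <= sk l.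
    rewrite /sk -mulrDl ler_wpM2r ?invr_ge0 ?(ltW al0)// -mulrSr.
    by apply: ler_wpMn2l => //; rewrite mulrn_wge0// ltW.
  have ded : de <= pi / al.
    have : de <= pi / (4 * al) by rewrite ge_min lexx orbT.
    move/le_trans; apply; rewrite ler_wpM2l ?(ltW pi0)// lef_pV2 ?posrE ?mulr_gt0//.
    by rewrite ler_peMl ?(ltW al0)// ler1n.
  move: sbk sbl => /andP[_ k2] /andP[l1 _]; move: skl; rewrite mulr2n mulrDl; move: u0 ded k2 l1; lra.
rewrite normrM normrM (ger0_norm (_ : 0 <= al ^+ 2 * g0 i0 i0)) ?mulr_ge0 ?sqr_ge0 ?(ltW g0_gt0) ?(ltW al0)//.
rewrite (ger0_norm (_ : 0 <= 2^-1)) ?invr_ge0//.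
apply: (@le_trans _ _ (pi / al * 2^-1 * (al ^+ 2 * g0 i0 i0))).
  rewrite (_ : pi / al * 2^-1 * (al ^+ 2 * g0 i0 i0) = gap / 2); last by rewrite /gap; field; rewrite gt_eqF.
  by rewrite ler_pM2l// lef_pV2 ?posrE// ler_nat.
apply: ler_wpM2r; first by rewrite mulr_ge0 ?sqr_ge0 ?(ltW g0_gt0).
by apply: ler_wpM2r; rewrite ?invr_ge0.
Qed.

End many_solutions.

(** * Normal form of a skew matrix relative to a scalar product *)

Section skew_normal_form.
Import complex.
Context {R : realType}.

Definition posdef n (g : 'M[R]_n) := forall v : 'rV[R]_n, v != 0 -> 0 < (v *m g *m v^T) 0 0.

Lemma posdef_congr n (g M : 'M[R]_n) : M \in unitmx -> posdef g -> posdef (M *m g *m M^T).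
Proof.
move=> uM pg v v0; have := pg (v *m M); rewrite trmx_mul !mulmxA; apply.
by apply: contra_neq v0 => vM; rewrite -(mulmxK uM v) vM mul0mx.
Qed.

Lemma dotmx_gt0 n (v : 'rV[R]_n) : v != 0 -> 0 < (v *m v^T) 0 0.
Proof.
move=> v0; have [i vi] : exists i, v 0 i != 0.
  apply/existsP; rewrite -negb_forall; apply: contra v0 => /forallP H.
  by apply/eqP/rowP => i; rewrite mxE; apply/eqP; exact: H.
rewrite mxE (bigD1 i)//= ltr_wpDr//.
  by apply: sumr_ge0 => j _; rewrite mxE -expr2 sqr_ge0.
by rewrite mxE -expr2 exprn_even_gt0.
Qed.

(** Induction on the size: eliminating the first row and column leaves the Schur complement, which
    is again symmetric and positive definite. *)
Lemma cholesky n (g : 'M[R]_n) : g^T = g -> posdef g ->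
  exists2 L, L \in unitmx & L *m g *m L^T = 1%:M.
Proof.
elim: n g => [|n IH] g gs pg; first by exists 1%:M; [exact: unitmx1|apply/matrixP => -[]].
move: g gs pg; rewrite -[n.+1]/(1 + n)%N => g gs pg.
pose a := g 0 0; pose r := ursubmx g.
have a0 : 0 < a.
  have d0 : delta_mx 0 0 != 0 :> 'rV[R]_(1 + n).
    by apply/eqP => /rowP/(_ 0); rewrite !mxE !eqxx => /eqP; rewrite oner_eq0.
  have := pg _ d0; rewrite trmx_delta -rowE -colE.
  by rewrite /a !mxE.
have ulE : ulsubmx g = a%:M by rewrite [LHS]mx11_scalar /a !mxE; congr ((g _ _)%:M); exact: val_inj.
have dlE : dlsubmx g = r^T by rewrite /r trmx_ursub gs.
pose c := - a^-1 *: r^T.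
pose M : 'M[R]_(1 + n) := block_mx 1%:M 0 c 1%:M.
have uM : M \in unitmx by rewrite unitmxE det_lblock !det1 mulr1 unitr1.
pose g2 := c *m r + drsubmx g.
have ME : M *m g *m M^T = block_mx a%:M 0 0 g2.
  rewrite -[g]submxK ulE dlE -/r /M tr_block_mx !trmx1 trmx0 !mulmx_block.
  rewrite !mul1mx !mul0mx !mulmx1 !mulmx0 !addr0.
  have ca : c *m a%:M + r^T = 0.
    by rewrite mul_mx_scalar /c scalerA mulrN divff ?gt_eqF// scaleN1r addNr.
  have ac : a%:M *m c^T + r = 0.
    by rewrite -[a%:M]tr_scalar_mx -trmx_mul -[X in _ + X]trmxK -linearD ca linear0.
  by rewrite ca ac mul0mx add0r.
have g2s : g2^T = g2.
  have : (M *m g *m M^T)^T = M *m g *m M^T by rewrite !trmx_mul trmxK gs mulmxA.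
  by rewrite ME tr_block_mx => /eq_block_mx[].
have pg2 : posdef g2.
  move=> v v0; have := posdef_congr uM pg; rewrite ME => /(_ (row_mx 0 v)).
  rewrite tr_row_mx mul_row_block !mul0mx mulmx0 !add0r mul_row_col mul0mx add0r.
  apply; apply: contra_neq v0 => /eqP; rewrite -[0 : 'rV_(1 + n)]row_mx0 => /eqP/eq_row_mx[].
  by [].
have [L uL LE] := IH g2 g2s pg2.
have sa : 0 < Num.sqrt a by rewrite sqrtr_gt0.
pose N : 'M[R]_(1 + n) := block_mx (Num.sqrt a)^-1%:M 0 0 L.
exists (N *m M).
  rewrite unitmx_mul uM andbT unitmxE det_lblock det_scalar1 unitrM -unitmxE uL andbT.
  by rewrite unitrV unitfE gt_eqF.
rewrite trmx_mul mulmxA -!mulmxA [M *m _]mulmxA [M *m g *m _]mulmxA ME.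
rewrite mulmxA mulmx_block !mul0mx !mulmx0 !addr0 !add0r.
rewrite tr_block_mx mulmx_block !trmx0 !mul0mx !mulmx0 !addr0 !add0r LE tr_scalar_mx -!scalar_mxM.
rewrite (_ : _ * a * _ = 1) ?scalar_mx_block//.
by rewrite -{2}(sqr_sqrtr (ltW a0)); field; rewrite gt_eqF.
Qed.

(** The spectral theorem is applied over the complex numbers. The eigenvalues are real, and two real
    matrices similar over the complex numbers are similar over the reals. *)
Lemma symmetric_real_diag n (S : 'M[R]_n) : S^T = S ->
  exists2 Q, Q \in unitmx & exists D : 'rV[R]_n, Q *m S = diag_mx D *m Q.
Proof.
move=> Ss; pose rc := real_complex R; pose A := map_mx rc S.
have Ar : A \is a realmx.
  by apply/mxOverP => i j; rewrite mxE; apply/complex_realP; eexists.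
have As : A \is symmetricmx.
  apply/is_hermitianmxP; rewrite expr0 scale1r map_mx_id//.
  by rewrite /A map_trmx Ss.
have Ah := realsym_hermsym As Ar.
have /orthomx_spectralP E := hermitian_normalmx Ah.
have Dr := hermitian_spectral_diag_real Ah.
have uP := spectral_unit A.
have sim : similar_in unitmx A (diag_mx (spectral_diag A)).
  exists (spectralmx A) => //; apply/(similarP uP).
  by rewrite {2}E !mulmxA mulmxV// mul1mx.
have Br : diag_mx (spectral_diag A) \is a realmx.
  apply/mxOverP => i j; rewrite mxE; move/mxOverP: Dr => Dr.
  by case: eqP => _; rewrite ?mulr1n ?mulr0n ?Dr// realE lexx.
have [P] := real_similar sim Ar Br; rewrite inE => /andP[/mxOverP Pr Pu] /(similarP Pu) PE.
pose re (z : complex R) := complex.Re z.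
have reK (z : complex R) : z \is Num.real -> rc (re z) = z by move=> /complex_realP[k ->].
have PK : map_mx rc (map_mx re P) = P by apply/matrixP => i j; rewrite !mxE reK.
have DK : map_mx rc (map_mx re (spectral_diag A)) = spectral_diag A.
  by apply/matrixP => i j; rewrite !mxE reK//; move/mxOverP: Dr; exact.
exists (map_mx re P); first by rewrite -(map_unitmx rc) PK.
exists (map_mx re (spectral_diag A)).
have inj (X Y : 'M[R]_n) : map_mx rc X = map_mx rc Y -> X = Y.
  by move=> /matrixP H; apply/matrixP => i j; have := H i j; rewrite !mxE => /complexI.
by apply: inj; rewrite !map_mxM map_diag_mx PK DK.
Qed.

(** Normalizing [g] by [L] turns [Om] into a skew [O1], whose square is symmetric and negative
    definite; the matrix [Q] diagonalizing it yields the frequencies. [Q] is only known to be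
    invertible, so [g] need not become the identity, but [J] becomes the conjugate [Q O1 Q^-1]. *)
Lemma skew_normal_form n (g Om : 'M[R]_n) : g^T = g -> posdef g -> Om^T = - Om -> Om \in unitmx ->
  exists2 P, P \in unitmx & exists2 alf : 'I_n -> R, forall i, 0 < alf i &
    let J := invmx (P *m g *m P^T) *m (P *m Om *m P^T) in
    J *m J = - diag_mx (\row_i alf i ^+ 2).
Proof.
move=> gs pg Os uO; have [L uL LE] := cholesky gs pg.
pose O1 := L *m Om *m L^T.
have O1s : O1^T = - O1 by rewrite /O1 !trmx_mul trmxK Os mulNmx mulmxN mulmxA.
have uO1 : O1 \in unitmx by rewrite !unitmx_mul uL uO unitmx_tr uL.
have SS : (O1 *m O1)^T = O1 *m O1 by rewrite trmx_mul O1s mulNmx mulmxN opprK.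
have [Q uQ [D QD]] := symmetric_real_diag SS.
(* For the eigenvector [v], [D_i |v| ^ 2 = v O1 ^ 2 v^T = - |v O1| ^ 2]. *)
have D0 i : D 0 i < 0.
  pose v := row i Q.
  have v0 : v != 0.
    apply/eqP => vz; have : row i (Q *m invmx Q) = 0 by rewrite row_mul -/v vz mul0mx.
    by rewrite mulmxV// => /rowP/(_ i); rewrite !mxE eqxx => /eqP; rewrite oner_eq0.
  have vO : v *m O1 != 0.
    by apply: contra_neq v0 => h; rewrite -(mulmxK uO1 v) h mul0mx.
  have e1 : v *m (O1 *m O1) = D 0 i *: v.
    rewrite /v -row_mul QD; apply/rowP => j; rewrite !mxE (bigD1 i)//= mxE eqxx mulr1n big1 ?addr0//.
    by move=> k ki; rewrite mxE eq_sym (negbTE ki) mulr0n mul0r.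
  have e2 : D 0 i * (v *m v^T) 0 0 = - ((v *m O1) *m (v *m O1)^T) 0 0.
    have : (v *m (O1 *m O1) *m v^T) 0 0 = D 0 i * (v *m v^T) 0 0 by rewrite e1 -scalemxAl mxE.
    by move=> <-; rewrite trmx_mul O1s mulNmx mulmxN [in RHS]mxE opprK !mulmxA.
  have := dotmx_gt0 v0; have := dotmx_gt0 vO => h1 h2.
  by rewrite -(pmulr_llt0 _ h2) e2 oppr_lt0.
pose P2 := (invmx Q)^T.
have uP2 : P2 \in unitmx by rewrite unitmx_tr unitmx_inv.
exists (P2 *m L); first by rewrite unitmx_mul uP2.
exists (fun i => Num.sqrt (- D 0 i)); first by move=> i; rewrite sqrtr_gt0 oppr_gt0.
have E1 : P2 *m L *m g *m (P2 *m L)^T = P2 *m P2^T.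
  by rewrite trmx_mul -!mulmxA [L *m (g *m _)]mulmxA [L *m g *m _]mulmxA LE mul1mx.
have E2 : P2 *m L *m Om *m (P2 *m L)^T = P2 *m O1 *m P2^T.
  by rewrite trmx_mul /O1 !mulmxA.
have E3 : invmx (P2 *m P2^T) = Q *m invmx P2.
  have uPP : P2 *m P2^T \in unitmx by rewrite unitmx_mul uP2 unitmx_tr uP2.
  have H : P2 *m P2^T *m (Q *m invmx P2) = 1%:M.
    by rewrite mulmxA -[P2 *m _ *m Q]mulmxA {2}/P2 trmxK mulVmx// mulmx1 mulmxV.
  by rewrite -[LHS]mulmx1 -H mulKmx.
move=> J; have -> : J = Q *m O1 *m invmx Q.
  by rewrite /J E1 E2 E3 !mulmxA mulmxKV// /P2 trmxK.
rewrite 2!mulmxA mulmxKV // -[Q *m O1 *m O1]mulmxA QD mulmxK //.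
apply/matrixP => i j; rewrite !mxE sqr_sqrtr ?oppr_ge0 ?ltW//.
by rewrite mulNrn opprK.
Qed.

End skew_normal_form.

(** * Frames adapted to a contact form *)

Section contact_frame.
Context {R : realType} {n : nat} (M : contact_subriemannian_manifold R n.+1).
Context (c : chart R n.+1 M) (c_atlas : atlas c) (y0 : 'rV[R]_n.+1).
Context (W : set 'rV[R]_n.+1) (al : 'rV[R]_n.+1 -> 'rV[R]_n.+1) (k : 'I_n.+1).
Hypothesis W_open : open W.
Hypothesis W_y0 : W y0.
Hypothesis W_img : W `<=` cimg c.
Hypothesis al_smooth : smooth_map_on W al.
Hypothesis al_k : forall y, W y -> al y 0 k != 0.
Hypothesis distrP : forall y v, W y -> distr c (cinv c y) v <-> form_app al y v = 0.
Hypothesis nondeg : forall v, distr c (cinv c y0) v ->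
  (forall w, distr c (cinv c y0) w -> form_diff al y0 v w = 0) -> v = 0.

Definition transv : 'rV[R]_n.+1 := delta_mx 0 k.
Definition transv_dual : 'rV[R]_n.+1 := (al y0 0 k)^-1 *: al y0.
Local Notation ev := transv.
Local Notation es := transv_dual.

Lemma dotE (u v : 'rV[R]_n.+1) : dot u v = (u *m v^T) 0 0.
Proof. by rewrite mxE; apply: eq_bigr => l _; rewrite mxE. Qed.

Lemma dot_row_mx m p (A : 'M[R]_(m, n.+1)) (B : 'M[R]_(p, n.+1)) i j :
  dot (row i A) (row j B) = (A *m B^T) i j.
Proof. by rewrite mxE; apply: eq_bigr => l _; rewrite !mxE. Qed.

Lemma form_app_dot y v : form_app al y v = dot (al y) v. Proof. by []. Qed.

Lemma dot_transv u : dot u ev = u 0 k.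
Proof.
rewrite /dot (bigD1 k)//= mxE !eqxx mulr1 big1 ?addr0// => l lk.
by rewrite mxE (negbTE lk) mulr0.
Qed.

Let W_cdom y : W y -> cdom c (cinv c y). Proof. by move=> /W_img/cimgP[]. Qed.

Lemma distr_sum m (u : 'I_m -> R) (X : 'I_m -> 'rV[R]_n.+1) y : W y ->
  (forall i, distr c (cinv c y) (X i)) -> distr c (cinv c y) (\sum_i u i *: X i).
Proof.
move=> Wy HX; apply/(distrP _ Wy); rewrite form_app_dot dot_sumr big1// => i _.
by have /(distrP _ Wy) := HX i; rewrite form_app_dot dotZr => ->; rewrite mulr0.
Qed.

Lemma distrB y u v : W y -> distr c (cinv c y) u -> distr c (cinv c y) v ->
  distr c (cinv c y) (u - v).
Proof.
move=> Wy /(distrP _ Wy) hu /(distrP _ Wy) hv; apply/(distrP _ Wy).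
by rewrite form_app_dot dotBr -!form_app_dot hu hv subrr.
Qed.

Lemma metric0l y w : W y -> distr c (cinv c y) w -> metric c (cinv c y) 0 w = 0.
Proof.
move=> Wy dw; have d0 := distr0 c_atlas (W_cdom Wy).
have := metric_linear 1 c_atlas (W_cdom Wy) d0 d0 dw.
by rewrite scaler0 addr0 mul1r => /eqP; rewrite -subr_eq0 opprD addNKr oppr_eq0 => /eqP.
Qed.

Lemma metric_suml m (u : 'I_m -> R) (X : 'I_m -> 'rV[R]_n.+1) y w : W y ->
  (forall i, distr c (cinv c y) (X i)) -> distr c (cinv c y) w ->
  metric c (cinv c y) (\sum_i u i *: X i) w = \sum_i u i * metric c (cinv c y) (X i) w.
Proof.
move=> Wy; elim: m u X => [|m IH] u X HX dw; first by rewrite !big_ord0 metric0l.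
rewrite !big_ord_recl (metric_linear _ c_atlas (W_cdom Wy))//; last exact: distr_sum.
by rewrite IH.
Qed.

Lemma metric_sumr m (u : 'I_m -> R) (X : 'I_m -> 'rV[R]_n.+1) y w : W y ->
  (forall i, distr c (cinv c y) (X i)) -> distr c (cinv c y) w ->
  metric c (cinv c y) w (\sum_i u i *: X i) = \sum_i u i * metric c (cinv c y) w (X i).
Proof.
move=> Wy HX dw; rewrite (metric_symmetric c_atlas (W_cdom Wy))//; last exact: distr_sum.
rewrite metric_suml//; apply: eq_bigr => i _.
by rewrite (metric_symmetric c_atlas (W_cdom Wy)).
Qed.

Section with_basis.
Variables (b bs : 'M[R]_(n, n.+1)).
Hypothesis b_bs : b *m bs^T = 1%:M.
Hypothesis b_es : b *m es^T = 0.
Hypothesis e_bs : ev *m bs^T = 0.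

Lemma transv_dualK : ev *m es^T = 1%:M.
Proof.
rewrite [LHS]mx11_scalar -dotE dotC dot_transv !mxE mulVf//.
exact: al_k.
Qed.

Lemma frame_resolution : es^T *m ev + bs^T *m b = 1%:M.
Proof.
have H : col_mx ev b *m row_mx es^T bs^T = 1%:M.
  by rewrite mul_col_row transv_dualK e_bs b_es b_bs -scalar_mx_block.
have := @mulmx1C _ n.+1 (col_mx ev b) (row_mx es^T bs^T) H.
by rewrite -(mul_row_col es^T bs^T ev b).
Qed.

Lemma basis_expansion v : v = dot v es *: ev + \sum_j dot v (row j bs) *: row j b.
Proof.
rewrite -[LHS]mulmx1 -frame_resolution mulmxDr !mulmxA; congr (_ + _).
  by rewrite [v *m _]mx11_scalar -dotE mul_scalar_mx.
rewrite mulmx_sum_row; apply: eq_bigr => j _; congr (_ *: _).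
by rewrite mxE; apply: eq_bigr => l _; rewrite !mxE.
Qed.

Lemma dual_expansion v : v = dot v ev *: es + \sum_j dot v (row j b) *: row j bs.
Proof.
rewrite -[LHS]mulmx1 -[1%:M]trmx1 -frame_resolution linearD /= !trmx_mul !trmxK mulmxDr !mulmxA.
congr (_ + _).
  by rewrite [v *m _]mx11_scalar -dotE mul_scalar_mx.
rewrite mulmx_sum_row; apply: eq_bigr => j _; congr (_ *: _).
by rewrite mxE; apply: eq_bigr => l _; rewrite !mxE.
Qed.

(** The only coefficient for which [row j b + a_j e] is annihilated by [al y]. *)
Definition frame_a j (y : 'rV[R]_n.+1) : R := - form_app al y (row j b) / al y 0 k.
Local Notation afun := frame_a.
Local Notation frame := (hframe b ev afun).
Definition frame_gram y : 'M[R]_n := \matrix_(i, j) metric c (cinv c y) (frame y i) (frame y j).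
Local Notation G := frame_gram.
Definition frame_K i j y : R := invmx (G y) i j.

Lemma frame_distr y i : W y -> distr c (cinv c y) (frame y i).
Proof.
move=> Wy; apply/(distrP _ Wy); rewrite form_app_dot dotDr dotZr dot_transv.
by rewrite /frame_a mulfVK ?al_k// form_app_dot addrN.
Qed.

Lemma dot_frame y i j : dot (row j bs) (frame y i) = (i == j)%:R.
Proof.
rewrite dotC dotDl dotZl dot_row_mx b_bs mxE.
have -> : dot ev (row j bs) = 0.
  transitivity ((ev *m bs^T) 0 j); last by rewrite e_bs mxE.
  by rewrite mxE; apply: eq_bigr => l _; rewrite !mxE.
by rewrite mulr0 addr0.
Qed.

(** The difference of the two sides lies in the distribution and pairs to 0 with the rows of [bs],
    so it is a multiple of [e], which is transverse to the distribution. *)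
Lemma frame_span y v : W y -> distr c (cinv c y) v ->
  v = \sum_i dot v (row i bs) *: frame y i.
Proof.
move=> Wy dv; apply/eqP; rewrite -subr_eq0; apply/eqP; set w := _ - _.
have dw : distr c (cinv c y) w.
  by apply: distrB => //; apply: distr_sum => // i; exact: frame_distr.
have wb j : dot w (row j bs) = 0.
  rewrite /w dotBl [X in _ - X]dotC dot_sumr (bigD1 j)//= dotZr dot_frame eqxx mulr1.
  by rewrite big1 ?addr0 ?subrr// => i ij; rewrite dotZr dot_frame (negbTE ij) mulr0.
have wE : w = dot w es *: ev.
  rewrite [LHS]basis_expansion big1 ?addr0// => j _; by rewrite wb scale0r.
have /(distrP _ Wy) := dw; rewrite wE form_app_dot dotZr dot_transv => /eqP.
by rewrite mulf_eq0 (negbTE (al_k Wy)) orbF => /eqP ->; rewrite scale0r.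
Qed.

Lemma metric_frame y (u v : 'I_n -> R) : W y ->
  metric c (cinv c y) (\sum_i u i *: frame y i) (\sum_i v i *: frame y i) =
  \sum_i u i * mv (G y) v i.
Proof.
move=> Wy; have dF i := frame_distr i Wy.
rewrite metric_suml//; last exact: distr_sum.
apply: eq_bigr => i _; congr (_ * _); rewrite metric_sumr//; apply: eq_bigr => j _.
by rewrite mxE mulrC.
Qed.

Lemma gram_sym y : W y -> (G y)^T = G y.
Proof.
move=> Wy; apply/matrixP => i j; rewrite !mxE (metric_symmetric c_atlas (W_cdom Wy))//; exact: frame_distr.
Qed.

Lemma gram_posdef y : W y -> posdef (G y).
Proof.
move=> Wy v v0.
have -> : (v *m G y *m v^T) 0 0 = metric c (cinv c y) (\sum_i v 0 i *: frame y i) (\sum_i v 0 i *: frame y i).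
  rewrite metric_frame// -mulmxA mxE; apply: eq_bigr => i _; congr (_ * _).
  by rewrite mxE; apply: eq_bigr => j _; rewrite [v^T _ _]mxE.
apply: metric_pos => //; first exact: W_cdom.
  by apply: distr_sum => // i; exact: frame_distr.
apply: contra_neq v0 => vz; apply/rowP => j.
have := congr1 (fun w => dot (row j bs) w) vz.
rewrite dot_sumr (bigD1 j)//= dotZr dot_frame eqxx mulr1 big1; last first.
  by move=> i ij; rewrite dotZr dot_frame (negbTE ij) mulr0.
by rewrite addr0 mxE => ->; rewrite /dot big1// => l _; rewrite [X in _ * X]mxE mulr0.
Qed.

Lemma posdef_unit m (g : 'M[R]_m) : posdef g -> g \in unitmx.
Proof.
move=> pg; rewrite -row_free_unit -kermx_eq0; apply/rowV0P => v /sub_kermxP vg.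
by apply/eqP; apply: contraT => /pg; rewrite vg mul0mx mxE ltxx.
Qed.

Lemma gram_unit y : W y -> G y \in unitmx.
Proof. by move=> /gram_posdef; exact: posdef_unit. Qed.

Lemma frame_K_sym y i j : W y -> frame_K i j y = frame_K j i y.
Proof. by move=> Wy; rewrite /frame_K -[in LHS](gram_sym Wy) -trmx_inv mxE. Qed.

Lemma smooth_frame_a j : smooth_on W (afun j).
Proof.
apply: smooth_mul => //.
  apply: (@smooth_eq _ _ _ (fun y => \sum_l al y 0 l * - b j l)) => //.
    by move=> y _; rewrite /form_app -sumrN; apply: eq_bigr => l _; rewrite mxE mulrN.
  by apply: smooth_sum => // l _; apply: smooth_mul => //; exact: smooth_cst.
by apply: smooth_inv => //; exact: al_k.
Qed.

Lemma smooth_frame_K i j : smooth_on W (frame_K i j).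
Proof.
apply: smooth_invmx => //; first exact: gram_unit.
have sm m : smooth_map_on W (fun y => frame y m).
  move=> l; apply: (@smooth_eq _ _ _ (fun y => b m l + afun m y * ev 0 l)) => //.
    by move=> y _; rewrite !mxE.
  apply: smooth_add => //; first exact: smooth_cst.
  by apply: smooth_mul => //; [exact: smooth_frame_a|exact: smooth_cst].
move=> p q; apply: (@smooth_eq _ _ _ (fun y => metric c (cinv c y) (frame y p) (frame y q))) => //.
  by move=> y _; rewrite mxE.
by apply: metric_smooth => // y Wy; exact: frame_distr.
Qed.

Lemma mv_gram_ctrl y p i : W y -> mv (G y) (hctrl b ev frame_K afun y p) i = hmom b ev afun y p i.
Proof.
move=> Wy; transitivity (mv (G y) (mv (invmx (G y)) (hmom b ev afun y p)) i); first by [].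
rewrite mv_mul mulmxV ?gram_unit// /mv (bigD1 i)//= mxE eqxx mul1r big1 ?addr0// => j ji.
by rewrite mxE eq_sym (negbTE ji) mul0r.
Qed.

Lemma frame_vel_distr y p : W y -> distr c (cinv c y) (hvel b ev frame_K afun y p).
Proof. by move=> Wy; apply: distr_sum => // i; exact: frame_distr. Qed.

Lemma frame_vel_metric y p : W y ->
  metric c (cinv c y) (hvel b ev frame_K afun y p) (hvel b ev frame_K afun y p) =
  2 * ham b ev frame_K afun y p.
Proof.
move=> Wy; rewrite /hvel metric_frame// ham_ctrl mulrA divff ?pnatr_eq0// mul1r.
by apply: eq_bigr => i _; rewrite mv_gram_ctrl.
Qed.

(** Expands [0 <= |v - hvel| ^ 2], as [hvel] is the vector of the distribution dual to [p] for the
    metric. *)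
Lemma frame_fenchel y v p : W y -> distr c (cinv c y) v ->
  dot p v <= 2^-1 * metric c (cinv c y) v v + ham b ev frame_K afun y p.
Proof.
move=> Wy dv; pose u i := dot v (row i bs).
have vE : v = \sum_i u i *: frame y i by exact: frame_span.
have pv : dot p v = \sum_i u i * hmom b ev afun y p i.
  by rewrite vE dot_sumr; apply: eq_bigr => i _; rewrite dotZr hmom_frame.
pose V := hctrl b ev frame_K afun y p.
have dV := frame_vel_distr p Wy.
have := metric_ge0 c_atlas (W_cdom Wy) (distrB Wy dv dV).
have -> : v - hvel b ev frame_K afun y p = \sum_i (u i - V i) *: frame y i.
  by rewrite {1}vE /hvel -sumrB; apply: eq_bigr => i _; rewrite scalerBl.
rewrite metric_frame// {2}vE {2}vE metric_frame// pv ham_ctrl.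
set A := \sum_i u i * mv (G y) u i.
have -> : \sum_i (u i - V i) * mv (G y) (fun i => u i - V i) i =
   A - 2 * (\sum_i u i * hmom b ev afun y p i) + \sum_i V i * hmom b ev afun y p i.
  have gV i : mv (G y) V i = hmom b ev afun y p i by exact: mv_gram_ctrl.
  have sw : \sum_i V i * mv (G y) u i = \sum_i u i * hmom b ev afun y p i.
    rewrite sum_mvT (gram_sym Wy); apply: eq_bigr => i _.
    by rewrite gV.
  under eq_bigr => i _ do rewrite mvB mulrBl !mulrBr gV.
  rewrite !sumrB sw -/A; ring.
by move: A => A; set B := \sum_i u i * _; set D := \sum_i V i * _; lra.
Qed.

Lemma frame_a_y0 j : form_app al y0 (row j b) = 0 -> frame_a j y0 = 0.
Proof. by rewrite /frame_a => ->; rewrite oppr0 mul0r. Qed.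

End with_basis.

Definition dalpha l m : R := 'D_(delta_mx 0 l) (fun y => al y 0 m) y0.
Definition dform : 'M[R]_n.+1 := \matrix_(l, m) (dalpha l m - dalpha m l).

Lemma W_box : exists2 r : R, 0 < r & forall z, `|z - y0| <= r -> W z.
Proof.
have /nbhs_ballP[eps /= e0 He] : nbhs y0 W by apply: open_nbhs_nbhs; split.
exists (eps / 2); first by rewrite divr_gt0.
move=> z zr; apply: He; rewrite -ball_normE /= distrC (le_lt_trans zr)//.
by rewrite gtr_pMr // invf_lt1// ltr1n.
Qed.

Lemma is_derive_lincomb m (f : 'I_m -> 'rV[R]_n.+1 -> R) (l w : 'I_m -> R) x v :
  (forall i, is_derive x v (f i) (l i)) ->
  is_derive x v (fun y => \sum_i f i y * w i) (\sum_i l i * w i).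
Proof.
move=> df; rewrite (_ : (fun y => _) = \sum_i (w i \*: f i)).
  rewrite (_ : \sum_i l i * w i = \sum_i w i *: l i); last by apply: eq_bigr => i _; rewrite mulrC.
  by apply: is_derive_sum => i; exact: is_deriveZ.
by apply: funext => y; rewrite fct_sumE; apply: eq_bigr => i _; rewrite mulrC.
Qed.

Lemma form_app_dir v w :
  is_derive y0 v (fun y => form_app al y w) (\sum_m (\sum_l dalpha l m * v 0 l) * w 0 m).
Proof.
apply: is_derive_lincomb => m; have [r r0 Hr] := W_box.
have [C _ HC] := class_C2_C11 Hr (al_smooth m 2).
by apply: (C11_dir v HC); rewrite subrr normr0.
Qed.

Lemma form_diffE v w : form_diff al y0 v w = (v *m dform *m w^T) 0 0.
Proof.
rewrite /form_diff; have [_ ->] := form_app_dir v w; have [_ ->] := form_app_dir w v.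
rewrite -mulmxA mxE.
under [X in _ - X]eq_bigr => m _ do rewrite mulr_suml.
rewrite [X in _ - X]exchange_big -sumrB.
transitivity (\sum_m \sum_l v 0 l * ((dalpha l m - dalpha m l) * w 0 m)).
  apply: eq_bigr => m _ /=; rewrite mulr_suml -sumrB; apply: eq_bigr => l _; ring.
rewrite exchange_big; apply: eq_bigr => l _ /=; rewrite -mulr_sumr; congr (_ * _).
by rewrite mxE; apply: eq_bigr => m _; rewrite !mxE.
Qed.

Lemma dform_skew : dform^T = - dform.
Proof. by apply/matrixP => i j; rewrite !mxE opprB. Qed.

(** Differentiates [a_i al_k = - al (b_i)] at [y0]; the derivative of [al_k] drops out because [a_i]
    vanishes there. *)
Lemma frame_da b i l : form_app al y0 (row i b) = 0 ->
  'D_(delta_mx 0 l) (frame_a b i) y0 = - (al y0 0 k)^-1 * \sum_m dalpha l m * b i m.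
Proof.
move=> fb; have k0 := al_k W_y0.
have [_ /(_ l)[da _]] := @smooth_frame_a b i 1%N.
have [_ /(_ l)[dk _]] := al_smooth k 1%N.
have E1 := deriveM (da _ W_y0) (dk _ W_y0).
rewrite frame_a_y0// scale0r add0r in E1.
have E2 : 'D_(delta_mx 0 l) (frame_a b i * (fun y => al y 0 k)) y0 =
    'D_(delta_mx 0 l) (fun y => form_app al y (- row i b)) y0.
  apply: near_eq_derive; have : nbhs y0 W by apply: open_nbhs_nbhs; split.
  apply: filterS => y Wy; rewrite /= /GRing.mul /= /frame_a mulfVK ?al_k//.
  by rewrite !form_app_dot dotNr.
have [_ E3] := form_app_dir (delta_mx 0 l) (- row i b).
have : al y0 0 k * 'D_(delta_mx 0 l) (frame_a b i) y0 = - \sum_m dalpha l m * b i m.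
  transitivity ('D_(delta_mx 0 l) (frame_a b i * (fun y => al y 0 k)) y0); first by rewrite E1.
  rewrite E2 E3 -sumrN; apply: eq_bigr => m _; rewrite !mxE mulrN; congr (- (_ * _)).
  rewrite (bigD1 l)//= mxE !eqxx mulr1 big1 ?addr0// => l' ll.
  by rewrite mxE (negbTE ll) mulr0.
by move=> H; rewrite mulNr -mulrN -H mulKf.
Qed.

(** The link between the model and the contact structure: the antisymmetrized Jacobian of the frame
    coefficients is the differential of [al] on the [b_j], up to the factor [al_k]. *)
Lemma frame_curv b : (forall j, form_app al y0 (row j b) = 0) ->
  curv0 b (fun i l => 'D_(delta_mx 0 l) (frame_a b i)) y0 = (al y0 0 k)^-1 *: (b *m dform *m b^T).
Proof.
move=> fb.
have jE i j : jac0 b (fun i l => 'D_(delta_mx 0 l) (frame_a b i)) y0 i j =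
    - (al y0 0 k)^-1 * \sum_l \sum_m dalpha l m * b i m * b j l.
  rewrite mxE /dot mulr_sumr; apply: eq_bigr => l _; rewrite mxE frame_da// mxE -mulrA mulr_suml.
  by [].
apply/matrixP => i j; rewrite mxE [X in _ + X]mxE [in X in _ - X]mxE !jE -mulrBr.
rewrite mulNr -mulrN [in RHS]mxE; congr (_ * _); rewrite opprB.
rewrite [X in _ - X]exchange_big -sumrB /= -mulmxA [RHS]mxE; apply: eq_bigr => l _.
rewrite mxE mulr_sumr -sumrB; apply: eq_bigr => m _; rewrite !mxE; ring.
Qed.

(** The coordinate vectors other than the [k]-th, corrected along the latter so as to lie in the
    kernel of [al y0]. *)
Definition ker_basis : 'M[R]_(n, n.+1) := \matrix_(j, l)
  ((l == lift k j)%:R - al y0 0 (lift k j) / al y0 0 k * (l == k)%:R).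
Definition ker_dual : 'M[R]_(n, n.+1) := \matrix_(j, l) (l == lift k j)%:R.

Let sum_delta m (F : 'I_m -> R) i : \sum_l (l == i)%:R * F l = F i.
Proof. by rewrite (bigD1 i)//= eqxx mul1r big1 ?addr0// => l /negbTE ->; rewrite mul0r. Qed.

Lemma ker_basisK : ker_basis *m ker_dual^T = 1%:M.
Proof.
apply/matrixP => i j; rewrite mxE.
under eq_bigr => l _ do rewrite [X in _ * X]mxE [X in _ * X]mxE mulrC.
rewrite sum_delta !mxE [lift k j == k]eq_sym (negbTE (neq_lift _ _)) mulr0 subr0.
by rewrite (inj_eq (@lift_inj _ k)) eq_sym.
Qed.

Lemma ker_basis_form j : form_app al y0 (row j ker_basis) = 0.
Proof.
rewrite /form_app (eq_bigr (fun l => (l == lift k j)%:R * al y0 0 l -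
  (l == k)%:R * (al y0 0 (lift k j) / al y0 0 k * al y0 0 l))).
  by rewrite sumrB !sum_delta mulfVK ?subrr// al_k.
by move=> l _; rewrite !mxE; ring.
Qed.

Lemma ker_basis_es : ker_basis *m es^T = 0.
Proof.
apply/matrixP => i j; rewrite mxE [RHS]mxE.
transitivity ((al y0 0 k)^-1 * form_app al y0 (row i ker_basis)); last by rewrite ker_basis_form mulr0.
by rewrite /form_app mulr_sumr; apply: eq_bigr => l _; rewrite ord1 !mxE; ring.
Qed.

Lemma ker_dual_transv : ev *m ker_dual^T = 0.
Proof.
apply/matrixP => i j; rewrite mxE [RHS]mxE.
rewrite (eq_bigr (fun l => (l == k)%:R * (l == lift k j)%:R)).
  by rewrite sum_delta (negbTE (neq_lift _ _)).
by move=> l _; rewrite !mxE ord1.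
Qed.

Definition ker_curv : 'M[R]_n := (al y0 0 k)^-1 *: (ker_basis *m dform *m ker_basis^T).

Lemma ker_curv_skew : ker_curv^T = - ker_curv.
Proof.
rewrite /ker_curv linearZ /= !trmx_mul trmxK dform_skew mulNmx mulmxN mulmxA.
by rewrite scalerN.
Qed.

(** A row vector [u] killed by the matrix gives a vector [u *m ker_basis] of the distribution on
    which the differential of [al] is degenerate, hence 0. *)
Lemma ker_curv_unit : ker_curv \in unitmx.
Proof.
rewrite -row_free_unit -kermx_eq0; apply/rowV0P => u /sub_kermxP.
rewrite /ker_curv -scalemxAr => /eqP; rewrite scaler_eq0 invr_eq0 (negbTE (al_k W_y0)) /= => /eqP uO.
have dC j : distr c (cinv c y0) (row j ker_basis) by apply/(distrP _ W_y0); exact: ker_basis_form.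
have v0 : u *m ker_basis = 0.
  apply: nondeg.
    by rewrite mulmx_sum_row; apply: distr_sum.
  move=> w dw; rewrite form_diffE.
  have -> : w = (\row_j dot w (row j ker_dual)) *m ker_basis.
    rewrite mulmx_sum_row.
    rewrite {1}(frame_span ker_basisK ker_basis_es ker_dual_transv W_y0 dw); apply: eq_bigr => j _.
    by rewrite mxE /hframe frame_a_y0 ?ker_basis_form// scale0r addr0.
  rewrite trmx_mul !mulmxA.
  have -> : u *m ker_basis *m dform *m ker_basis^T = 0 by rewrite -uO !mulmxA.
  by rewrite mul0mx mxE.
by rewrite -[u]mulmx1 -ker_basisK mulmxA v0 mul0mx.
Qed.

Theorem many_geodesics (m : nat) (r : R) : (0 < n)%N -> 0 < r ->
  exists (y1 : 'rV[R]_n.+1) (Y : 'I_m.+1 -> R -> 'rV[R]_n.+1), [/\ `|y1 - y0| < r,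
    forall i, [/\ geodesic (cinv c \o Y i), Y i 0 = y0, Y i 1 = y1 &
      forall t : R, 0 <= t <= 1 -> cimg c (Y i t)] &
    forall i j, i != j -> exists2 t : R, 0 <= t <= 1 & Y i t != Y j t].
Proof.
move=> n0 r0; have [rho rho0 Hrho] := W_box.
have dC j : distr c (cinv c y0) (row j ker_basis) by apply/(distrP _ W_y0); exact: ker_basis_form.
pose gC := frame_gram ker_basis y0.
have [P uP [alf alf0 PJ]] := skew_normal_form (gram_sym ker_basis W_y0)
  (gram_posdef ker_basisK ker_dual_transv W_y0) ker_curv_skew ker_curv_unit.
(* The basis is changed by the [P] of the normal form, and the dual covectors by its inverse
   transpose, so that [J ^ 2] is diagonal in the new frame. *)
pose b := P *m ker_basis; pose bs := (invmx P)^T *m ker_dual.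
have b_bs : b *m bs^T = 1%:M.
  by rewrite /b /bs trmx_mul trmxK mulmxA -[P *m _ *m _]mulmxA ker_basisK mulmx1 mulmxV.
have b_es : b *m es^T = 0 by rewrite /b -mulmxA ker_basis_es mulmx0.
have e_bs : ev *m bs^T = 0 by rewrite /bs trmx_mul mulmxA ker_dual_transv mul0mx.
have rowb i : row i b = \sum_j P i j *: row j ker_basis.
  by rewrite /b row_mul mulmx_sum_row; apply: eq_bigr => j _; rewrite mxE.
have fb i : form_app al y0 (row i b) = 0.
  by rewrite form_app_dot rowb dot_sumr big1// => j _; rewrite dotZr -form_app_dot ker_basis_form mulr0.
pose K := frame_K b; pose a := frame_a b.
pose dK i j l := 'D_(delta_mx 0 l) (K i j); pose da i l := 'D_(delta_mx 0 l) (a i).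
have K_C11 i j : exists2 C : R, 0 <= C & C11 y0 rho C (K i j) (dK i j).
  exact: (class_C2_C11 Hrho (smooth_frame_K b_bs e_bs i j 2)).
have a_C11 j : exists2 C : R, 0 <= C & C11 y0 rho C (a j) (da j).
  exact: (class_C2_C11 Hrho (smooth_frame_a b j 2)).
have a_y0 j : a j y0 = 0 by apply: frame_a_y0.
pose g0 := frame_gram b y0.
have g0E : g0 = P *m gC *m P^T.
  apply/matrixP => i j; rewrite -mulmxA !mxE /hframe !frame_a_y0// !scale0r !addr0 !rowb.
  rewrite metric_suml//; last exact: distr_sum.
  apply: eq_bigr => p _; congr (_ * _); rewrite metric_sumr// mxE; apply: eq_bigr => q _.
  by rewrite mulrC !mxE /hframe !frame_a_y0 ?ker_basis_form// !scale0r !addr0.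
have K0E : metric_inv0 K y0 = invmx g0 by apply/matrixP => i j; rewrite mxE.
have ug0 : g0 \in unitmx by exact: (gram_unit b_bs e_bs W_y0).
have K0g0 : metric_inv0 K y0 *m g0 = 1%:M by rewrite K0E mulVmx.
have cE : curv0 b da y0 = P *m ker_curv *m P^T.
  rewrite /da frame_curv// /ker_curv -scalemxAr -scalemxAl /b trmx_mul.
  by rewrite !mulmxA.
have J2 : (metric_inv0 K y0 *m curv0 b da y0) *m (metric_inv0 K y0 *m curv0 b da y0) =
    - diag_mx (\row_i alf i ^+ 2).
  by rewrite K0E g0E cE; exact: PJ.
pose i0 : 'I_n := Ordinal n0.
have g0_gt0 : 0 < g0 i0 i0.
  have d0 : delta_mx 0 i0 != 0 :> 'rV[R]_n.
    by apply/eqP => /rowP/(_ i0); rewrite !mxE !eqxx => /eqP; rewrite oner_eq0.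
  have := gram_posdef b_bs e_bs W_y0 d0; rewrite trmx_delta -rowE -colE.
  by rewrite mxE mxE.
(* [rho / 2] is the tube required by [normal_geodesic], and [r] the distance allowed for the
   endpoint. *)
have r1 : 0 < Num.min r (rho / 2) <= rho.
  rewrite lt_min r0 divr_gt0//= ge_min; apply/orP; right.
  by rewrite ler_piMr ?(ltW rho0)// invf_le1// ler1n.
have [||||y1 [Y [Pc [y10 HY HD]]]] := @many_solutions R n n.+1 b ev bs es K dK a da y0 g0 rho
  K_C11 a_C11 a_y0 _ _ _ _ (dual_expansion b_bs b_es e_bs) K0g0 (gram_sym b W_y0) alf alf0 J2 i0 g0_gt0 m _ r1.
- by move=> i j; rewrite dot_row_mx b_bs mxE.
- move=> i; transitivity ((b *m es^T) i 0); last by rewrite b_es mxE.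
  by rewrite mxE; apply: eq_bigr => l _; rewrite !mxE.
- move=> j; transitivity ((ev *m bs^T) 0 j); last by rewrite e_bs mxE.
  by rewrite mxE; apply: eq_bigr => l _; rewrite !mxE.
- by rewrite dotE transv_dualK mxE.
exists y1, Y; split => //.
  have [_ _ <- H] := HY ord0; rewrite (lt_le_trans (H 1 _)) ?lexx ?ler01//.
  by rewrite ge_min lexx.
move=> i; have [sol Y0 Y1 Yb] := HY i.
have Yb2 (t : R) : 0 <= t <= 1 -> `|Y i t - y0| < rho / 2.
  by move=> /Yb /lt_le_trans; apply; rewrite ge_min lexx orbT.
split => //.
- apply: (@normal_geodesic R n n.+1 M c c_atlas b ev K dK a da y0 rho rho0 K_C11 a_C11 _ _ _ _ _ (Y i) (Pc i) sol Yb2).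
  + by move=> p q y /Hrho; exact: frame_K_sym.
  + by move=> y /Hrho /W_img.
  + by move=> y p /Hrho; exact: frame_vel_distr.
  + by move=> y p /Hrho; exact: (frame_vel_metric b_bs e_bs).
  + by move=> y v p /Hrho Wy; exact: (frame_fenchel b_bs b_es e_bs).
  + by rewrite Y0 Y1.
- move=> t /Yb2 h; apply: W_img; apply: Hrho; rewrite (le_trans (ltW h))//.
  by rewrite ler_piMr ?(ltW rho0)// invf_le1// ler1n.
Qed.

End contact_frame.

(** * From extremals to the number of local geodesics *)

Lemma many_local_geodesics (R : realType) (d : nat) (M : contact_subriemannian_manifold R d)
    (c : chart R d M) (y0 : 'rV[R]_d) (m : nat) (r : R) : atlas c -> cimg c y0 -> 0 < r ->
  exists (y1 : 'rV[R]_d) (Y : 'I_m.+1 -> R -> 'rV[R]_d), [/\ `|y1 - y0| < r,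
    forall i, [/\ geodesic (cinv c \o Y i), Y i 0 = y0, Y i 1 = y1 &
      forall t : R, 0 <= t <= 1 -> cimg c (Y i t)] &
    forall i j, i != j -> exists2 t : R, 0 <= t <= 1 & Y i t != Y j t].
Proof.
case: d M c y0 => [M|n M] c y0; first by have := csr_dim_gt1 M.
move=> ac cy0 r0; have n0 : (0 < n)%N := csr_dim_gt1 M.
have [W [al [[oW Wy0] Wc sal H]]] := distr_contact ac cy0.
have [a0 _ nondeg] := H _ Wy0.
have [k ak] : exists k, al y0 0 k != 0.
  apply: contrapT => nk; move/eqP: a0; apply; apply/rowP => k; rewrite mxE.
  by apply/eqP; apply: contrapT => /negP h; apply: nk; exists k.
(* The neighbourhood is shrunk so that one fixed component of the form vanishes nowhere on it. *)
pose V := W `&` [set y | al y 0 k != 0].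
have oV : open V.
  rewrite openE => y [Wy ky].
  apply: (@filterI _ _ (nbhs_filter y)); first by apply: open_nbhs_nbhs; split.
  have cy := class_C_continuous (sal k 0%N) Wy.
  exact: (cvgr_neq0 _ cy ky).
have VW : V `<=` W by move=> y [].
apply: (@many_geodesics R n M c ac y0 V al k oV) => //.
- by move=> y /VW /Wc.
- by move=> i p; apply: class_C_sub VW (sal i p).
- by move=> y [].
- by move=> y v /VW /H[_ + _]; apply.
Qed.

Lemma counting_ge (R : realType) (T : choiceType) (A : set T) m (f : 'I_m -> T) :
  injective f -> (forall i, A (f i)) -> (m%:R%:E <= counting A :> \bar R)%E.
Proof.
move=> injf Af; rewrite /counting; case: asboolP => [fA|_]; last exact: leey.
rewrite lee_fin ler_nat.
have -> : m = size [seq f i | i <- enum 'I_m] by rewrite size_map size_enum_ord.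
apply: uniq_leq_size; first by rewrite map_inj_uniq// enum_uniq.
by move=> _ /mapP[i _ ->]; rewrite in_fset_set// inE.
Qed.

Theorem theorem9 (R : realType) (d : nat)
    (M : contact_subriemannian_manifold R d) (q : M)
    (c : chart R d M) (c_chart : atlas c) (c_q : cdom c q) :
  exists q_ : nat -> M,
    (q_ n @[n --> \oo] --> q) /\ (nu c q (q_ n) @[n --> \oo] --> +oo%E).
Proof.
pose y0 := cmap c q; have y0c : cimg c y0 by exists q.
have qE : cinv c y0 = q by exact: cmapK.
(* The [n]-th point is within [1 / (n + 1)] of [q] in coordinates and is joined to it by at least
   [n + 1] geodesics. *)
have /choice[y1 Hy1] (n : nat) : exists y1 : 'rV[R]_d, exists Y : 'I_n.+1 -> R -> 'rV[R]_d,
  [/\ `|y1 - y0| < n.+1%:R^-1,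
    forall i, [/\ geodesic (cinv c \o Y i), Y i 0 = y0, Y i 1 = y1 &
      forall t : R, 0 <= t <= 1 -> cimg c (Y i t)] &
    forall i j, i != j -> exists2 t : R, 0 <= t <= 1 & Y i t != Y j t].
  by apply: many_local_geodesics; rewrite ?invr_gt0.
exists (fun n => cinv c (y1 n)); split.
  have cv : y1 n @[n --> \oo] --> y0.
    apply/cvgrPdist_lt => eps e0.
    have := @cvg_harmonic R => /cvgrPdist_lt/(_ eps e0); apply: filterS => n.
    have [Y [h _ _]] := Hy1 n.
    rewrite sub0r normrN /harmonic ger0_norm ?invr_ge0// distrC => h2.
    exact: lt_trans h h2.
  rewrite -qE.
  exact: (cvg_comp _ _ cv (cinv_continuous y0c)).
have ge n : (n.+1%:R%:E <= nu c q (cinv c (y1 n)))%E.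
  have [Y [_ HY HD]] := Hy1 n.
  apply: (@counting_ge _ _ _ _ (fun i (t : `[0%R, 1%R :> R]%classic) => cinv c (Y i (\val t)))).
    move=> i j ij; apply/eqP; apply: contraT => /HD[t t01 /negP[]].
    have t01' : (t \in `[0%R, 1%R :> R]%classic) by rewrite inE /= in_itv.
    (* The curves differ in coordinates, and since they stay in the image of the chart, [cmap]
       recovers their coordinates from the points of [M]. *)
    have := congr1 (fun g => cmap c (g (exist _ t t01'))) ij; rewrite /=.
    have [_ _ _ /(_ t t01)/cimgP[_ ->]] := HY i; have [_ _ _ /(_ t t01)/cimgP[_ ->]] := HY j.
    by move=> ->.
  move=> i; have [gi Y0 Y1 Yc] := HY i; exists (cinv c \o Y i) => //; split => //=.
  - by rewrite Y0.
  - by rewrite Y1.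
  - by move=> p [t /=]; rewrite in_itv/= => t01 <-; have [] := cimgP (Yc t t01).
apply/cvgeyPge => A; near=> n; apply: le_trans (ge n); rewrite lee_fin.
rewrite (@le_trans _ _ n%:R) ?ler_nat//.
by near: n; exact: nbhs_infty_ger.
Unshelve. all: by end_near. Qed.
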